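(* Let $\Omega=\bigcup_{i=1}^n(\alpha_i,\beta_i)$ with $-\infty<\alpha_1<\beta_1<\alpha_2<\beta_2<\dots<\alpha_n<\beta_n<\infty$, and let $\mathsf D|_{C_c^\infty(\Omega)}$ be the operator $f\mapsto\frac1{2\pi i}f'$ in $L^2(\Omega)$ with domain $C_c^\infty(\Omega)$. Assume that $\Omega$ is a spectral set with spectrum $\Lambda$. Define the unbounded operator $A$ on $L^2(\Omega)$ by $$A\left(\sum_{\lambda\in\Lambda}f_\lambda e_\lambda\right)=\sum_{\lambda\in\Lambda}\lambda f_\lambda e_\lambda,\qquad\mathscr D(A)=\left\{f=\sum_{\lambda\in\Lambda}f_\lambda e_\lambda:\sum_{\lambda\in\Lambda}|\lambda|^2|f_\lambda|^2<\infty\right\}.$$ Then $A$ is conjugate to the multiplication operator $M_I$ by the Fourier transform, i.e. $$A=\mathcal F_\Lambda^{-1}M_I\mathcal F_\Lambda.$$ The domain $\mathscr D(A)$ contains $\mathscr D_0(\Omega)$ and all functions $e_\lambda$, $\lambda\in\Lambda$, and $A$ is a self-adjoint extension of $\mathsf D|_{C_c^\infty(\Omega)}$ with the property that all eigenvectors are constant multiples of exponential functions $ce_\lambda$, $c\in\mathbb C$, $\lambda\in\Lambda$. Conversely, if there exists a self-adjoint extension $A$ of $\mathsf D|_{C_c^\infty(\Omega)}$ with the property that all eigenvectors are constant multiples of exponential functions $ce_\lambda$, $c\in\mathbb C$, $\lambda\in\mathbb R$, then $\Omega$ is spectral, with spectrum $$\Lambda:=\{\lambda\in\mathbb R:e_\lambda\in\mathscr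 D(A)\}=\sigma(A).$$
   Context: For $\lambda\in\mathbb R$, $e_\lambda(x)=e^{2\pi i\lambda x}$. The set $\Omega$ is spectral with spectrum $\Lambda\subset\mathbb R$ if $\{e_\lambda:\lambda\in\Lambda\}$ is an orthogonal basis of $L^2(\Omega)$. The Lebesgue measure on $\Omega$ is renormalized to $\frac1{|\Omega|}dx$, so that the $e_\lambda$ have norm one in $L^2(\Omega)$. The Fourier transform associated to a spectrum $\Lambda$ is the unitary operator $\mathcal F_\Lambda:L^2(\Omega)\to l^2(\Lambda)$, $\mathcal F_\Lambda f=(\langle f,e_\lambda\rangle)_{\lambda\in\Lambda}$. The operator $M_I$ of multiplication by the identity function on $l^2(\Lambda)$ is $M_I(a_\lambda)_{\lambda\in\Lambda}=(\lambda a_\lambda)_{\lambda\in\Lambda}$ with domain $\mathscr D(M_I)=\{(a_\lambda)\in l^2(\Lambda):\sum_\lambda|\lambda|^2|a_\lambda|^2<\infty\}$. $\mathscr D_0(\Omega)$ is the set of $f:\Omega\to\mathbb C$ that are absolutely continuous on each $J_i=(\alpha_i,\beta_i)$, with $f(\alpha_i+)=f(\beta_i-)=0$ for all $i$ and $f'\in L^2(\Omega)$. *)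

(* Defs.v *)
From HB Require Import structures.
From mathcomp Require Import all_boot all_order all_algebra ring_quotient.
From mathcomp Require Import all_classical all_reals all_analysis.
From mathcomp Require Import measurable_realfun summability.
From mathcomp Require Import complex ring lra.

Set Implicit Arguments.
Unset Strict Implicit.
Unset Printing Implicit Defensive.
Import Order.TTheory GRing.Theory Num.Theory.
Import numFieldNormedType.Exports.

Local Open Scope classical_set_scope.
Local Open Scope ring_scope.
Local Open Scope complex_scope.
Local Notation Re := complex.Re.
Local Notation Im := complex.Im.

Section complex_facts.
Context {R : realType}.
Implicit Types (z w a : R[i]).

(* |z|^2, as an element of R rather than R[i]. *)
Definition normsq z : R := Re z ^+ 2 + Im z ^+ 2.

Lemma ReM z w : Re (z * w) = Re z * Re w - Im z * Im w.
Proof. by case: z w => [a b] [c d]. Qed.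
Lemma ImM z w : Im (z * w) = Re z * Im w + Im z * Re w.
Proof. by case: z w => [a b] [c d] /=. Qed.
Lemma ReD z w : Re (z + w) = Re z + Re w.
Proof. by case: z w => [a b] [c d]. Qed.
Lemma ImD z w : Im (z + w) = Im z + Im w.
Proof. by case: z w => [a b] [c d]. Qed.
Lemma conjCE z : Num.conj z = (z^*)%C.
Proof. by []. Qed.
Lemma RecJ z : Re (Num.conj z) = Re z. Proof. by case: z. Qed.
Lemma ImcJ z : Im (Num.conj z) = - Im z. Proof. by case: z. Qed.

Lemma complex_eqP z w : Re z = Re w -> Im z = Im w -> z = w.
Proof. by case: z w => [a b] [c d] /= -> ->. Qed.

Lemma normsq_ge0 z : 0 <= normsq z.
Proof. by rewrite addr_ge0 ?sqr_ge0. Qed.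
Lemma normsq_eq0 z : normsq z = 0 -> z = 0.
Proof.
case: z => a b; rewrite /normsq/= => /eqP.
by rewrite paddr_eq0 ?sqr_ge0// !sqrf_eq0 => /andP[/eqP-> /eqP->].
Qed.
Lemma normsqM z w : normsq (z * w) = normsq z * normsq w.
Proof. by rewrite /normsq ReM ImM; ring. Qed.
Lemma normsqZD a z w :
  normsq (a * z + w) <= 2 * normsq a * normsq z + 2 * normsq w.
Proof.
rewrite -[leRHS]/(2 * normsq a * normsq z + 2 * normsq w) -mulrA -normsqM.
move: (a * z) => y; rewrite /normsq ReD ImD.
have := sqr_ge0 (Re y - Re w); have := sqr_ge0 (Im y - Im w).
by rewrite !expr2; lra.
Qed.
Lemma normsq_mulJ z w :
  `|Re (z * Num.conj w)| <= normsq z + normsq w /\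
  `|Im (z * Num.conj w)| <= normsq z + normsq w.
Proof.
rewrite ReM ImM RecJ ImcJ /normsq.
move: (Re z) (Im z) (Re w) (Im w) => a b c e.
have := sqr_ge0 (a + c); have := sqr_ge0 (a - c).
have := sqr_ge0 (b + e); have := sqr_ge0 (b - e).
have := sqr_ge0 (a + e); have := sqr_ge0 (a - e).
have := sqr_ge0 (b + c); have := sqr_ge0 (b - c).
have := sqr_ge0 a; have := sqr_ge0 b; have := sqr_ge0 c; have := sqr_ge0 e.
rewrite !expr2 => *.
by split; rewrite ler_norml; apply/andP; split; lra.
Qed.
Lemma conjMJ z w : Num.conj (z * Num.conj w) = w * Num.conj z.
Proof. by apply: complex_eqP; rewrite !(ReM, ImM, RecJ, ImcJ); ring. Qed.
End complex_facts.

Section square_integrable.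
Context d (T : measurableType d) (R : realType).
Variable mu : {measure set T -> \bar R}.
Implicit Types f g : T -> R[i].

Definition cmeasurable f :=
  measurable_fun setT (fun x => Re (f x)) /\
  measurable_fun setT (fun x => Im (f x)).

Definition square_integrable f :=
  cmeasurable f /\ (\int[mu]_x (normsq (f x))%:E < +oo)%E.

Lemma measurable_normsq f : cmeasurable f ->
  measurable_fun setT (fun x => normsq (f x)).
Proof.
by move=> [mr mi]; apply: measurable_funD; apply: measurable_funX.
Qed.

Lemma cmeasurableM f g : cmeasurable f -> cmeasurable g ->
  cmeasurable (fun x => f x * g x).
Proof.
move=> [fr fi] [gr gi]; split.
- under eq_fun do rewrite ReM.
  by apply: measurable_funB; apply: measurable_funM.
- under eq_fun do rewrite ImM.
  by apply: measurable_funD; apply: measurable_funM.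
Qed.

Lemma cmeasurableD f g : cmeasurable f -> cmeasurable g ->
  cmeasurable (fun x => f x + g x).
Proof.
move=> [fr fi] [gr gi]; split.
- by under eq_fun do rewrite ReD; apply: measurable_funD.
- by under eq_fun do rewrite ImD; apply: measurable_funD.
Qed.

Lemma cmeasurableJ f : cmeasurable f -> cmeasurable (fun x => Num.conj (f x)).
Proof.
move=> [fr fi]; split; first by under eq_fun do rewrite RecJ.
by under eq_fun do rewrite ImcJ; apply: measurable_funN.
Qed.

Lemma cmeasurable_cst (c : R[i]) : cmeasurable (fun=> c).
Proof. by split; exact: measurable_cst. Qed.

Lemma sqintP f : square_integrable f <->
  cmeasurable f /\ mu.-integrable setT (fun x => (normsq (f x))%:E).
Proof.
split=> -[mf fi]; split=> //.
- apply/integrableP; split; first exact/measurable_EFinP/measurable_normsq.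
  by under eq_integral do rewrite gee0_abs ?lee_fin ?normsq_ge0//.
- move/integrableP : fi => [_].
  by under eq_integral do rewrite gee0_abs ?lee_fin ?normsq_ge0//.
Qed.

Lemma square_integrableZD (a : R[i]) f g :
  square_integrable f -> square_integrable g ->
  square_integrable (fun x => a * f x + g x).
Proof.
move=> /sqintP[mf fi] /sqintP[mg gi].
have mh : cmeasurable (fun x => a * f x + g x).
  by apply: cmeasurableD => //; apply: cmeasurableM => //; exact: cmeasurable_cst.
apply/sqintP; split=> //.
have hi : mu.-integrable setT
    (fun x => (2 * normsq a)%:E * (normsq (f x))%:E + 2%:E * (normsq (g x))%:E)%E.
  by apply: integrableD => //; exact: integrableZl.
apply: (le_integrable _ _ _ hi) => //.
  exact/measurable_EFinP/measurable_normsq.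
move=> x _; rewrite -!EFinM -EFinD lee_fin ger0_norm ?normsq_ge0//.
rewrite ger0_norm; last first.
  by rewrite addr_ge0// mulr_ge0// ?normsq_ge0// mulr_ge0 ?normsq_ge0.
exact: normsqZD.
Qed.

Definition sqint : {pred T -> R[i]} := [pred f | `[< square_integrable f >]].

Lemma sqint_inP f : reflect (square_integrable f) (f \in sqint).
Proof. exact: asboolP. Qed.

Lemma sqint_submod_closed : submod_closed sqint.
Proof.
split=> [|a f g].
  apply/sqint_inP; apply/sqintP; split; first exact: cmeasurable_cst.
  by under eq_fun do rewrite /normsq expr0n addr0; exact: integrable0.
move=> /sqint_inP fi /sqint_inP gi; apply/sqint_inP.
exact: square_integrableZD.
Qed.
HB.instance Definition _ :=
  GRing.isSubmodClosed.Build _ _ sqint sqint_submod_closed.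

Record L2fun := MkL2fun { L2fun_val :> T -> R[i]; _ : L2fun_val \in sqint }.
HB.instance Definition _ := [isSub for L2fun_val].
HB.instance Definition _ := [Choice of L2fun by <:].
HB.instance Definition _ := [SubChoice_isSubLmodule of L2fun by <:].

Lemma L2funP (f : L2fun) : square_integrable f.
Proof. by case: f => f /= /sqint_inP. Qed.

Lemma L2fun_addE (f g : L2fun) x : (f + g) x = f x + g x.
Proof. by []. Qed.
Lemma L2fun_oppE (f : L2fun) x : (- f) x = - f x.
Proof. by []. Qed.
Lemma L2fun_scaleE a (f : L2fun) x : (a *: f) x = a * f x.
Proof. by []. Qed.

Definition l2null : {pred L2fun} :=
  [pred f : L2fun | `[< {ae mu, forall x, f x = 0} >]].

Lemma l2nullP (f : L2fun) : reflect {ae mu, forall x, f x = 0} (f \in l2null).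
Proof. exact: asboolP. Qed.

Lemma l2null_submod_closed : submod_closed l2null.
Proof.
split=> [|a f g]; first by apply/l2nullP; exact: aeW.
move=> /l2nullP f0 /l2nullP g0; apply/l2nullP.
apply: filterS2 f0 g0 => x f0 g0.
by rewrite L2fun_addE L2fun_scaleE f0 g0 mulr0 add0r.
Qed.
HB.instance Definition _ :=
  GRing.isSubmodClosed.Build _ _ l2null l2null_submod_closed.

(* L^2(mu; C): square-integrable functions modulo equality mu-a.e. *)
Definition L2 : Type := Quotient.quot l2null.
HB.instance Definition _ := GRing.Zmodule.on L2.
HB.instance Definition _ := EqQuotient.on L2.

Local Open Scope quotient_scope.

Definition L2_class (f : L2fun) : L2 := \pi_L2 f.

Lemma L2_classP (f g : L2fun) :
  L2_class f = L2_class g <-> {ae mu, forall x, f x = g x}.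
Proof.
split=> [/eqP|fg].
  rewrite -Quotient.idealrBE => /l2nullP; apply: filterS => x /eqP.
  by rewrite L2fun_addE L2fun_oppE subr_eq0 => /eqP.
apply/eqP; rewrite -Quotient.idealrBE; apply/l2nullP.
by apply: filterS fg => x fgx; rewrite L2fun_addE L2fun_oppE fgx subrr.
Qed.

(* A chosen representative; by [L2_reprP] it is meaningful only up to
   mu-null sets. *)
Definition L2_repr (u : L2) : L2fun := repr u.

Lemma L2_reprK : cancel L2_repr L2_class.
Proof. exact: reprK. Qed.

Lemma L2_reprP (f : L2fun) : {ae mu, forall x, L2_repr (L2_class f) x = f x}.
Proof. by apply/L2_classP; rewrite L2_reprK. Qed.

Lemma L2_classD (f g : L2fun) : L2_class (f + g) = L2_class f + L2_class g.
Proof. by rewrite /L2_class !piE. Qed.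

Lemma L2_class0 : L2_class 0 = 0.
Proof. by rewrite /L2_class !piE. Qed.

Definition L2_scale (a : R[i]) (u : L2) : L2 := L2_class (a *: L2_repr u).

Lemma L2_scale_class (a : R[i]) (f : L2fun) :
  L2_class (a *: f) = L2_scale a (L2_class f).
Proof.
by apply/L2_classP; apply: filterS (L2_reprP f) => x fx; rewrite !L2fun_scaleE fx.
Qed.

Lemma L2_scaleA a b u : L2_scale a (L2_scale b u) = L2_scale (a * b) u.
Proof. by rewrite -[u]L2_reprK -!L2_scale_class scalerA. Qed.

Lemma L2_scale1 : left_id 1 L2_scale.
Proof. by move=> u; rewrite -[u]L2_reprK -!L2_scale_class scale1r. Qed.

Lemma L2_scaleDr : right_distributive L2_scale +%R.
Proof.
move=> a u v; rewrite -[u]L2_reprK -[v]L2_reprK -L2_classD -!L2_scale_class.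
by rewrite -L2_classD scalerDr.
Qed.

Lemma L2_scaleDl u : {morph L2_scale^~ u : a b / a + b}.
Proof.
by move=> a b; rewrite -[u]L2_reprK -!L2_scale_class -L2_classD scalerDl.
Qed.

HB.instance Definition _ := GRing.Zmodule_isLmodule.Build R[i] L2
  L2_scaleA L2_scale1 L2_scaleDr L2_scaleDl.

Lemma L2_classZ (a : R[i]) (f : L2fun) :
  L2_class (a *: f) = a *: L2_class f.
Proof. exact: L2_scale_class. Qed.

Definition cintegral (f : T -> R[i]) : R[i] :=
  (\int[mu]_x Re (f x)) +i* (\int[mu]_x Im (f x)).

Definition cintegrable (f : T -> R[i]) :=
  mu.-integrable setT (EFin \o (fun x => Re (f x))) /\
  mu.-integrable setT (EFin \o (fun x => Im (f x))).

Lemma cintegrableM f g : square_integrable f -> square_integrable g ->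
  cintegrable (fun x => f x * Num.conj (g x)).
Proof.
move=> /sqintP[mf fi] /sqintP[mg gi].
have [mr mi] := cmeasurableM mf (cmeasurableJ mg).
have hi : mu.-integrable setT
    (fun x => (normsq (f x))%:E + (normsq (g x))%:E)%E by exact: integrableD.
split; apply: (le_integrable _ _ _ hi) => //.
- exact/measurable_EFinP.
- move=> x _; rewrite /= lee_fin [leRHS]ger0_norm ?addr_ge0 ?normsq_ge0 ?sqr_ge0//.
  exact: (normsq_mulJ _ _).1.
- exact/measurable_EFinP.
- move=> x _; rewrite /= lee_fin [leRHS]ger0_norm ?addr_ge0 ?normsq_ge0 ?sqr_ge0//.
  exact: (normsq_mulJ _ _).2.
Qed.

Lemma cintegralZD (a : R[i]) f g : cintegrable f -> cintegrable g ->
  cintegral (fun x => a * f x + g x) = a * cintegral f + cintegral g.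
Proof.
move=> [fr fi] [gr gi]; apply: complex_eqP.
- rewrite ReD ReM /cintegral/=.
  under eq_Rintegral do rewrite ReD ReM.
  rewrite RintegralD//=; last first.
    rewrite (_ : _ \o _ = (fun x => (Re a)%:E * (Re (f x))%:E - (Im a)%:E * (Im (f x))%:E)%E)//.
    by apply: integrableB => //; exact: integrableZl.
  rewrite RintegralB//=; last 2 first.
  - exact: (integrableZl _ _ fr).
  - exact: (integrableZl _ _ fi).
  by rewrite !RintegralZl.
- rewrite ImD ImM /cintegral/=.
  under eq_Rintegral do rewrite ImD ImM.
  rewrite RintegralD//=; last first.
    rewrite (_ : _ \o _ = (fun x => (Re a)%:E * (Im (f x))%:E + (Im a)%:E * (Re (f x))%:E)%E)//.
    by apply: integrableD => //; exact: integrableZl.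
  rewrite RintegralD//=; last 2 first.
  - exact: (integrableZl _ _ fi).
  - exact: (integrableZl _ _ fr).
  by rewrite !RintegralZl.
Qed.

Lemma cintegralJ f : cintegrable f ->
  cintegral (fun x => Num.conj (f x)) = Num.conj (cintegral f).
Proof.
move=> [fr fi]; apply: complex_eqP; rewrite ?RecJ ?ImcJ /cintegral/=.
  by apply: eq_Rintegral => x _; rewrite RecJ.
rewrite -mulN1r -RintegralZl//; apply: eq_Rintegral => x _.
by rewrite ImcJ mulN1r.
Qed.

Lemma ae_eq_cintegral f g : cmeasurable f -> cmeasurable g ->
  {ae mu, forall x, f x = g x} -> cintegral f = cintegral g.
Proof.
move=> [fr fi] [gr gi] fg; congr (_ +i* _); congr fine; apply: ae_eq_integral => //.
- exact/measurable_EFinP.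
- exact/measurable_EFinP.
- by apply: filterS fg => x -> _.
- exact/measurable_EFinP.
- exact/measurable_EFinP.
- by apply: filterS fg => x -> _.
Qed.

(* Linear in the first argument, conjugate-linear in the second. *)
Definition l2dot (u v : L2) : R[i] :=
  cintegral (fun x => L2_repr u x * Num.conj (L2_repr v x)).

Lemma l2dotE (f g : L2fun) : l2dot (L2_class f) (L2_class g) =
  cintegral (fun x => f x * Num.conj (g x)).
Proof.
have m (h : L2fun) : cmeasurable h by case: (L2funP h).
apply: ae_eq_cintegral.
- by apply: cmeasurableM => //; exact: cmeasurableJ.
- by apply: cmeasurableM => //; exact: cmeasurableJ.
- by apply: filterS2 (L2_reprP f) (L2_reprP g) => x -> ->.
Qed.

Lemma l2dotJ u v : l2dot u v = (-1) ^+ false * Num.conj (l2dot v u).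
Proof.
rewrite expr0 mul1r -cintegralJ; last by apply: cintegrableM; exact: L2funP.
by congr cintegral; apply/funext => x; rewrite conjMJ.
Qed.

Lemma l2dotZDl v : scalar (l2dot^~ v).
Proof.
move=> a u1 u2; rewrite -[u1]L2_reprK -[u2]L2_reprK -[v]L2_reprK.
rewrite -L2_classZ -L2_classD !l2dotE -cintegralZD; last 2 first.
- by apply: cintegrableM; exact: L2funP.
- by apply: cintegrableM; exact: L2funP.
congr cintegral; apply/funext => x.
by rewrite L2fun_addE L2fun_scaleE mulrDl mulrA.
Qed.

Lemma l2dotZDr u : linear_for (Num.conj \; *%R) (l2dot u).
Proof.
move=> a v1 v2; rewrite l2dotJ expr0 mul1r l2dotZDl rmorphD rmorphM/=.
by rewrite [l2dot u v1]l2dotJ [l2dot u v2]l2dotJ expr0 !mul1r.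
Qed.

HB.instance Definition _ := @bilinear_isBilinear.Build R[i] L2 L2 R[i]
  *%R (Num.conj \; *%R) l2dot (l2dotZDl, l2dotZDr).
HB.instance Definition _ := @isHermitianSesquilinear.Build R[i] L2 false
  Num.conj l2dot l2dotJ.

Lemma l2dot_gt0 (u : L2) : u != 0 -> 0 < l2dot u u.
Proof.
move=> u0; have [f fu] : exists f : L2fun, L2_class f = u.
  by exists (L2_repr u); exact: L2_reprK.
have E : l2dot u u = (\int[mu]_x normsq (f x))%:C.
  rewrite -fu l2dotE; apply: complex_eqP => /=.
    apply: eq_Rintegral => x _; rewrite ReM RecJ ImcJ /normsq !expr2.
    by rewrite mulrN opprK.
  rewrite (_ : (fun x => _) = cst 0) ?Rintegral_cst ?mul0r//.
  by apply/funext => x; rewrite ImM RecJ ImcJ mulrN mulrC addNr.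
rewrite E ltcR lt_neqAle Rintegral_ge0 ?andbT => [|x _]; last exact: normsq_ge0.
apply/eqP => /esym i0; move/eqP : u0; apply; move/(congr1 (@EFin R)) : i0.
have [mf fi] := (sqintP f).1 (L2funP f).
rewrite fineK; last first.
  exact: integrable_fin_num.
rewrite -fu -L2_class0 => int0; apply/L2_classP.
have : ae_eq mu setT (fun x => (normsq (f x))%:E) (cst 0%E).
  apply: (ae_eq_integral_abs _ measurableT _).1.
    exact/measurable_EFinP/measurable_normsq.
  by under eq_integral do rewrite gee0_abs ?lee_fin ?normsq_ge0//.
by apply: filterS => x /(_ I) [] /normsq_eq0.
Qed.

HB.instance Definition _ := @isDotProduct.Build R[i] L2 l2dot l2dot_gt0.
End square_integrable.

(* The Cauchy-Schwarz and triangle inequalities of sesquilinear.v are only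
   available in finite dimension. *)
Section hermitian_norm.
Local Open Scope ring_scope.
Variables (C : numClosedFieldType) (U : lmodType C).
Variable dot : {dot U for Num.conj}.

Lemma dot_cauchy_schwarz u v :
  `|dot u v| <= sqrtC (dot u u) * sqrtC (dot v v).
Proof.
rewrite -ler_sqr ?nnegrE ?mulr_ge0 ?sqrtC_ge0 ?dnorm_ge0//.
rewrite exprMn !sqrtCK normCK.
have [->|v0] := eqVneq v 0; first by rewrite linear0r mul0r mulr_ge0 ?dnorm_ge0.
have vp : 0 < dot v v by rewrite dnorm_gt0.
set a := dot u v / dot v v.
have ra : (dot v v)^* = dot v v by rewrite conj_Creal// gtr0_real.
have := dnorm_ge0 dot (u - a *: v).
rewrite dnormB dnormZ linearZr_LR/= normCK.
have -> : a * a^* * dot v v = dot u v * (dot u v)^* / dot v v.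
  by rewrite /a rmorphM fmorphV/= ra; field; rewrite gt_eqF.
have -> : a^* * dot u v = dot u v * (dot u v)^* / dot v v.
  by rewrite /a rmorphM fmorphV/= ra; field; rewrite gt_eqF.
set w := _ / _.
have -> : w^* = w.
  by rewrite /w !rmorphM fmorphV/= ra conjCK [(_ ^* * _)%R]mulrC.
rewrite opprD addrA addrK subr_ge0 /w ler_pdivrMr//.
Qed.

Lemma dot_norm_triangle u v :
  sqrtC (dot (u + v) (u + v)) <= sqrtC (dot u u) + sqrtC (dot v v).
Proof.
rewrite -ler_sqr ?nnegrE ?addr_ge0 ?sqrtC_ge0 ?dnorm_ge0//.
rewrite sqrrD !sqrtCK dnormD [leRHS]addrAC lerD2l.
have := dot_cauchy_schwarz u v.
move: (dot u v) => z zle.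
have -> : z + z^* = 'Re z *+ 2.
  by rewrite ReE -mulr_natr mulfVK.
rewrite lerMn2r/= (le_trans _ zle)//.
exact: (leif_Re_Creal z).1.
Qed.

Lemma dot_normZ a u : sqrtC (dot (a *: u) (a *: u)) = `|a| * sqrtC (dot u u).
Proof. by rewrite dnormZ sqrtCM ?nnegrE ?exprn_ge0// ?dnorm_ge0// sqrCK. Qed.

Lemma dot_norm_eq0 u : sqrtC (dot u u) = 0 -> u = 0.
Proof. by move/eqP; rewrite sqrtC_eq0 dnorm_eq0 => /eqP. Qed.
End hermitian_norm.

Section L2_norm.
Context d (T : measurableType d) (R : realType).
Variable mu : {measure set T -> \bar R}.

HB.instance Definition _ := @Lmodule_isNormed.Build R[i] (L2 mu)
  (fun u => sqrtC (l2dot u u)) (dot_norm_triangle (@l2dot _ _ _ mu))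
  (dot_normZ (@l2dot _ _ _ mu)) (@dot_norm_eq0 _ _ (@l2dot _ _ _ mu)).

Lemma l2normE (u : L2 mu) : `|u| = sqrtC (l2dot u u). Proof. by []. Qed.

End L2_norm.

(* Operators are identified with their graphs, so that equality of operators
   (domains included) is Leibniz equality and extension is inclusion. The norm
   of H is meant to be the one induced by dot, as it is on L2 mu. *)
Section hilbert_space.
Context (C : numClosedFieldType) (H : normedModType C).
Variable dot : {dot H for Num.conj}.

(* Unconditional norm convergence, along the net of finite subsets of I. *)
Definition hassum (I : choiceType) (x : I -> H) (s : H) :=
  partial_sum x @ totally --> s.

Definition linear_span (I : choiceType) (x : I -> H) : set H :=
  [set u | exists (r : seq I) (c : I -> C), u = \sum_(i <- r) c i *: x i].

Definition orthogonal_basis (I : choiceType) (e : I -> H) :=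
  [/\ forall i, e i != 0,
      forall i j, i != j -> dot (e i) (e j) = 0 &
      dense (linear_span e)].

Definition linear_operator (A : set (H * H)) :=
  [/\ A 0,
      forall (a : C) p q, A p -> A q -> A (a *: p + q) &
      forall u v w, A (u, v) -> A (u, w) -> v = w].

Definition op_domain (A : set (H * H)) : set H :=
  [set u | exists v, A (u, v)].

Definition adjoint (A : set (H * H)) : set (H * H) :=
  [set p | forall q, A q -> dot q.2 p.1 = dot q.1 p.2].

Definition self_adjoint (A : set (H * H)) :=
  [/\ linear_operator A, dense (op_domain A) & adjoint A = A].

Definition eigenvector (A : set (H * H)) (z : C) (u : H) :=
  u != 0 /\ A (u, z *: u).

(* z is in the resolvent set when A - z is a bijection from the domain of A
   onto H, with a bounded inverse B. *)
Definition resolvent_set (A : set (H * H)) : set C :=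
  [set z | exists B : H -> H,
    (forall u v, A (u, v + z *: u) <-> u = B v) /\
    exists M : C, forall v, `|B v| <= M * `|v|].

Definition op_spectrum (A : set (H * H)) : set C := ~` resolvent_set A.

End hilbert_space.

Section differentiation.
Context (R : realType).
Implicit Types f : R -> R[i].

Definition smooth (g : R -> R) := forall k x, derivable (derive1n k g) x 1.

Definition csmooth f :=
  smooth (fun x => Re (f x)) /\ smooth (fun x => Im (f x)).

(* derive1 is a junk value where f is not differentiable; it is used only for
   functions that are differentiable almost everywhere. *)
Definition cderive f (x : R) : R[i] :=
  derive1 (fun y => Re (f y)) x +i* derive1 (fun y => Im (f y)) x.

Definition absolutely_continuous_on (J : set R) f :=
  forall eps : R, 0 < eps -> exists2 delta : R, 0 < delta &
    forall (m : nat) (a b : 'I_m -> R),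
      (forall k, [/\ a k <= b k, J (a k) & J (b k)]) ->
      trivIset setT (fun k => [set` `]a k, b k[]) ->
      \sum_(k < m) (b k - a k) < delta ->
      \sum_(k < m) `|f (b k) - f (a k)| < eps%:C.

End differentiation.

Section Omega.
Context (R : realType) (n : nat) (alpha beta : 'I_n -> R).

Definition Omega : set (measurableTypeR R) :=
  \bigcup_i [set` `]alpha i, beta i[].

Lemma measurable_Omega : measurable Omega.
Proof.
by apply: fin_bigcup_measurable => // i _; exact: measurable_itv.
Qed.

Lemma Omega_lty : (lebesgue_measure Omega < +oo)%E.
Proof.
apply: (@le_lt_trans _ _ (\sum_(i \in [set: 'I_n])
  lebesgue_measure ([set` `]alpha i, beta i[] : set (measurableTypeR R)))%E).
  apply: content_sub_fsum; [exact: finite_finset| |exact: measurable_Omega|by []].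
  by move=> i _; exact: measurable_itv.
rewrite fsbig_finite/=; last exact: finite_finset.
apply: (big_ind (fun x : \bar R => (x < +oo)%E)) => //.
- by move=> x y; exact: lte_add_pinfty.
- move=> i _; rewrite lebesgue_measure_itv/=.
  by case: ifP => // _; rewrite -EFinB ltry.
Qed.

Lemma inv_vol_ge0 : 0 <= (fine (lebesgue_measure Omega))^-1.
Proof. by rewrite invr_ge0 fine_ge0. Qed.

(* The normalized measure dx / |Omega|, carried by Omega. *)
Definition mu_Omega : {measure set (measurableTypeR R) -> \bar R} :=
  mscale (NngNum inv_vol_ge0) (mrestr lebesgue_measure measurable_Omega).

Lemma mu_Omega_lty : (mu_Omega setT < +oo)%E.
Proof.
rewrite /mu_Omega/= /mscale/= /mrestr setTI.
by rewrite lte_mul_pinfty// ?lee_fin ?inv_vol_ge0// Omega_lty.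
Qed.

(* e^(2 pi i lambda x) *)
Definition expi (lambda x : R) : R[i] :=
  cos (2 * pi * lambda * x) +i* sin (2 * pi * lambda * x).

Lemma square_integrable_expi lambda :
  square_integrable mu_Omega (expi lambda : measurableTypeR R -> R[i]).
Proof.
have mul_cont : continuous (fun x : R => 2 * pi * lambda * x).
  by move=> x; apply: cvgM; [exact: cvg_cst|exact: cvg_id].
split.
  split; apply: continuous_measurable_fun => x.
    by apply: (continuous_comp (mul_cont x)); exact: continuous_cos.
  by apply: (continuous_comp (mul_cont x)); exact: continuous_sin.
under eq_integral do rewrite /normsq/= cos2Dsin2.
by rewrite integral_cst// mul1e mu_Omega_lty.
Qed.

Definition represents (u : L2 mu_Omega) (f : R -> R[i]) :=
  {ae mu_Omega, forall x, L2_repr u x = f x}.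

Definition expL2 (lambda : R) : L2 mu_Omega :=
  L2_class
    (MkL2fun (introT (sqint_inP mu_Omega _) (square_integrable_expi lambda))).

Lemma expL2E lambda : represents (expL2 lambda) (expi lambda).
Proof. exact: L2_reprP. Qed.

Definition is_spectrum (Lambda : set R) :=
  orthogonal_basis (@l2dot _ _ _ mu_Omega) (fun l : Lambda => expL2 (val l)).

Definition test_function (f : R -> R[i]) :=
  [/\ csmooth f, compact (closure [set x | f x != 0]) &
      closure [set x | f x != 0] `<=` Omega].

(* The graph of f |-> f' / (2 pi i) on C_c^oo(Omega). *)
Definition D_Cc : set (L2 mu_Omega * L2 mu_Omega) :=
  [set p | exists f, [/\ test_function f, represents p.1 f &
     represents p.2 (fun x => ((2 * pi)%:C * 'i%C)^-1 * cderive f x)]].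

Definition D0_Omega : set (L2 mu_Omega) :=
  [set u | exists f, [/\ represents u f,
    forall i, absolutely_continuous_on [set` `]alpha i, beta i[] f,
    forall i, (f : R -> R[i]^o) x @[x --> (alpha i)^'+] --> (0 : R[i]^o) /\
              (f : R -> R[i]^o) x @[x --> (beta i)^'-] --> (0 : R[i]^o) &
    exists v, represents v (cderive f)]].

Section spectrum.
Variable Lambda : set R.

Definition l2_Lambda : set (Lambda -> R[i]) :=
  [set a | (\esum_(l in [set: Lambda]) (normsq (a l))%:E < +oo)%E].

(* sum |lambda|^2 |a_lambda|^2 < oo *)
Definition wl2_Lambda : set (Lambda -> R[i]) :=
  [set a | (\esum_(l in [set: Lambda]) (val l ^+ 2 * normsq (a l))%:E < +oo)%E].

Definition fourier (u : L2 mu_Omega) : Lambda -> R[i] :=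
  fun l => l2dot u (expL2 (val l)).

Definition fourier_unitary :=
  [/\ linear fourier, set_bij setT l2_Lambda fourier &
      forall u, (\esum_(l in [set: Lambda]) (normsq (fourier u l))%:E =
                 (Re (l2dot u u))%:E)%E].

Definition fourier_op : set (L2 mu_Omega * (Lambda -> R[i])) :=
  [set p | p.2 = fourier p.1].

(* The graph of M_I. The condition p.2 \in l^2 is wl2_Lambda p.1. *)
Definition mult_id : set ((Lambda -> R[i]) * (Lambda -> R[i])) :=
  [set p | [/\ l2_Lambda p.1, wl2_Lambda p.1 &
     p.2 = fun l => (val l)%:C * p.1 l]].

(* sum f_lambda e_lambda |-> sum lambda f_lambda e_lambda, for coefficients
   such that sum |lambda|^2 |f_lambda|^2 < oo. *)
Definition spectral_op : set (L2 mu_Omega * L2 mu_Omega) :=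
  [set p | exists f : Lambda -> R[i],
    [/\ hassum (fun l => f l *: expL2 (val l)) p.1, wl2_Lambda f &
        hassum (fun l => ((val l)%:C * f l) *: expL2 (val l)) p.2]].

End spectrum.

End Omega.

Arguments is_spectrum {R n} alpha beta Lambda.
Arguments D_Cc {R n} alpha beta _.
Arguments D0_Omega {R n} alpha beta _.
Arguments expL2 {R n} alpha beta lambda.
Arguments l2_Lambda {R} Lambda _.
Arguments wl2_Lambda {R} Lambda _.
Arguments fourier {R n} alpha beta Lambda u.
Arguments fourier_unitary {R n} alpha beta Lambda.
Arguments fourier_op {R n} alpha beta Lambda _.
Arguments mult_id {R} Lambda _.
Arguments spectral_op {R n} alpha beta Lambda _.

(* Main.v *)
(* Write D for the operator f |-> f' / (2 pi i). If L is a spectrum, the e_l are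
   an orthonormal basis and A is the diagonal operator (u, v) in A iff
   <v, e_l> = l <u, e_l> for all l; its self-adjointness, its eigenvectors and
   its conjugacy with M_I are read off coefficients. Integration by parts for an
   absolutely continuous f vanishing at the ends of every interval gives
   <f', e_l> = 2 pi i l <f, e_l>, so A extends D on D_0(Omega). An absolutely
   continuous function is the integral of a density because its variation
   function has a Stieltjes measure that charges no null set.

   Conversely, let A be a self-adjoint extension of D on C_c^oo(Omega). Then A is
   contained in the adjoint of D, so (u, v) in A forces
   u(q) - u(p) = 2 pi i int_p^q v for almost all p < q in a same interval. Hence
   A e_l = l e_l whenever e_l is in the domain, these e_l are orthonormal, and
   graph-bounded sequences of A are almost everywhere equicontinuous, so
   relatively compact in L2. If the e_l were not total, compactness would make
   the minimum of |A w|^2 over unit vectors w orthogonal to all e_l be attained,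
   and the minimizer would yield an eigenvector of A orthogonal to every e_l,
   contrary to the hypothesis on eigenvectors. So A is diagonal in the basis e_l;
   its spectrum is the set of the l because <e_l, e_m> is near 1 for l near m, so
   that this set is uniformly discrete. *)
Require Import Defs.
From HB Require Import structures.
From mathcomp Require Import all_boot all_order all_algebra ring_quotient.
From mathcomp Require Import finmap.
From mathcomp Require Import all_classical all_reals all_analysis.
From mathcomp Require Import measurable_realfun summability.
From mathcomp Require Import complex ring lra.

Set Implicit Arguments.
Unset Strict Implicit.
Unset Printing Implicit Defensive.
Import Order.TTheory GRing.Theory Num.Theory.
Import numFieldNormedType.Exports.

Local Open Scope classical_set_scope.
Local Open Scope ring_scope.
Local Open Scope complex_scope.
Local Notation Re := complex.Re.
Local Notation Im := complex.Im.
Local Notation ReM := Defs.ReM.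
Local Notation ImM := Defs.ImM.
Local Notation ReD := Defs.ReD.
Local Notation ImD := Defs.ImD.

(** * Orthonormal systems and diagonal operators *)

(** [A] need not be bounded below or above, so <A w, w> may have no extremum. |A w|^2 has an
    infimum, and its minimizing sequences are bounded in the graph norm, which is what compactness
    asks for. The price is an eigenvector of A^2 only; factoring A^2 - m into A - sqrt m and A +
    sqrt m brings back one of [A]. Compactness is obtained without a resolvent: at Lebesgue points
    the increment of [u] over a short cell is controlled by the norm of [v], so finitely many cell
    averages determine [u] up to a small error, and finitely many bounded real sequences converge
    together along an ultrafilter. For integration by parts, an absolutely continuous function is a
    difference of two monotone ones, so that positive measures and Radon-Nikodym derivatives are
    available. Integrals are real throughout: functions are split into real and imaginary parts, and
    the factor i of the derivative exchanges the two. *)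

Section inner_product.
Context (R : realType) (H : normedModType R[i]) (dot : {dot H for Num.conj}).
Hypothesis normE : forall u : H, `|u| = sqrtC (dot u u).
Implicit Types (u v w : H) (a : R[i]).

(** The norm of [H] takes values in [R[i]]; estimates are carried out on its square as a real
    number, which avoids square roots and stays within reach of [lra]. *)
Definition sqn u : R := Re (dot u u).

Lemma dotDl u v w : dot (u + v) w = dot u w + dot v w.
Proof. exact: linearDl. Qed.
Lemma dotDr u v w : dot u (v + w) = dot u v + dot u w.
Proof. exact: linearD. Qed.
Lemma dotBl u v w : dot (u - v) w = dot u w - dot v w.
Proof. exact: linearBl. Qed.
Lemma dotBr u v w : dot u (v - w) = dot u v - dot u w.
Proof. exact: linearB. Qed.
Lemma dotZl a u v : dot (a *: u) v = a * dot u v.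
Proof. by rewrite linearZl_LR. Qed.
Lemma dotZr a u v : dot u (a *: v) = Num.conj a * dot u v.
Proof. by rewrite linearZr_LR. Qed.
Lemma dot0l u : dot 0 u = 0. Proof. exact: linear0l. Qed.
Lemma dot0r u : dot u 0 = 0. Proof. exact: linear0r. Qed.
Lemma dot_conj u v : dot v u = Num.conj (dot u v).
Proof. by rewrite (hermC dot v u) /= expr0 mul1r. Qed.
Lemma dot_suml I (r : seq I) (F : I -> H) u :
  dot (\sum_(i <- r) F i) u = \sum_(i <- r) dot (F i) u.
Proof.
elim: r => [|i r IH]; first by rewrite !big_nil dot0l.
by rewrite !big_cons dotDl IH.
Qed.
Lemma dot_sumr I (r : seq I) (F : I -> H) u :
  dot u (\sum_(i <- r) F i) = \sum_(i <- r) dot u (F i).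
Proof.
elim: r => [|i r IH]; first by rewrite !big_nil dot0r.
by rewrite !big_cons dotDr IH.
Qed.

Lemma dot_sqn u : dot u u = (sqn u)%:C.
Proof.
have := dnorm_ge0 dot u; rewrite lecE /= => /andP[/eqP i0 _].
exact: complex_eqP.
Qed.

Lemma sqn_ge0 u : 0 <= sqn u.
Proof. by rewrite -lecR -dot_sqn dnorm_ge0. Qed.

Lemma sqn_eq0 u : sqn u = 0 -> u = 0.
Proof. by move=> u0; apply/eqP; rewrite -(dnorm_eq0 dot) dot_sqn u0. Qed.

Lemma sqn0 : sqn 0 = 0. Proof. by rewrite /sqn dot0l. Qed.

Lemma conjM_normsq a : a * Num.conj a = (normsq a)%:C.
Proof.
by apply: complex_eqP; rewrite /normsq ?(ReM, ImM, RecJ, ImcJ) /=; ring.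
Qed.

Lemma sqnZ a u : sqn (a *: u) = normsq a * sqn u.
Proof.
by rewrite /sqn dotZl dotZr mulrA conjM_normsq ReM /= mul0r subr0.
Qed.

Lemma sqnN u : sqn (- u) = sqn u.
Proof. by rewrite -scaleN1r sqnZ /normsq /= oppr0; ring. Qed.

Lemma sqnB_sym u v : sqn (u - v) = sqn (v - u).
Proof. by rewrite -sqnN opprB. Qed.

Lemma sqnD u v : sqn (u + v) = sqn u + sqn v + 2 * Re (dot u v).
Proof.
rewrite /sqn dotDl !dotDr (dot_conj u v) !ReD RecJ; ring.
Qed.

Lemma sqnB u v : sqn (u - v) = sqn u + sqn v - 2 * Re (dot u v).
Proof.
rewrite sqnD sqnN -scaleN1r dotZr ReM RecJ ImcJ /=; ring.
Qed.

Lemma parallelogram u v : sqn (u + v) + sqn (u - v) = 2 * sqn u + 2 * sqn v.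
Proof. by rewrite sqnD sqnB; ring. Qed.

Lemma sqnD_le u v : sqn (u + v) <= 2 * sqn u + 2 * sqn v.
Proof. by rewrite -parallelogram lerDl sqn_ge0. Qed.

Lemma sqnB_le u v w : sqn (u - w) <= 2 * sqn (u - v) + 2 * sqn (v - w).
Proof. by have := sqnD_le (u - v) (v - w); rewrite addrA subrK. Qed.

Lemma normsq_dot_le u v : normsq (dot u v) <= sqn u * sqn v.
Proof.
have [->|v0] := eqVneq v 0.
  by rewrite dot0r sqn0 mulr0 /normsq /= expr0n addr0.
have v0' : 0 < sqn v.
  rewrite lt_neqAle sqn_ge0 andbT; apply/eqP => /esym/sqn_eq0 /eqP.
  exact/negP.
(* This is |v|^2 times the component of [u] orthogonal to [v], scaled to avoid a division; its
   squared norm is |v|^2 (|u|^2 |v|^2 - |<u, v>|^2). *)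
have := sqn_ge0 ((sqn v)%:C *: u - dot u v *: v).
rewrite sqnB !sqnZ dotZl dotZr [Num.conj _ * _]mulrC conjM_normsq.
rewrite !ReM /= {1}/normsq /= expr0n /= => h.
have : 0 <= sqn v * (sqn v * sqn u - normsq (dot u v)).
  by apply: le_trans h _; rewrite /normsq le_eqVlt; apply/orP; left; apply/eqP; ring.
by rewrite pmulr_rge0// subr_ge0 mulrC.
Qed.

Lemma norm_lt_sqn u (e : R) : 0 < e -> (`|u| < e%:C) = (sqn u < e ^+ 2).
Proof.
move=> e0; rewrite normE -ltr_sqr ?nnegrE ?sqrtC_ge0 ?dnorm_ge0//; last first.
  by rewrite lecR ltW.
by rewrite sqrtCK dot_sqn -rmorphXn ltcR.
Qed.

Lemma posC_real (e : R[i]) : 0 < e -> exists2 r : R, 0 < r & e = r%:C.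
Proof.
case: e => a b; rewrite ltcE /= => /andP[/eqP b0 a0]; exists a => //.
by rewrite b0.
Qed.

Lemma sqn_cvgP (F : set_system H) {FF : Filter F} u :
  F --> u <-> forall e : R, 0 < e -> \forall v \near F, sqn (u - v) < e.
Proof.
split=> [/fcvgrPdist_lt Fu e e0|Fu].
  have se0 : 0 < Num.sqrt e by rewrite sqrtr_gt0.
  have := Fu (Num.sqrt e)%:C; rewrite ltcR => /(_ se0).
  by apply: filterS => v; rewrite norm_lt_sqn// sqr_sqrtr// ltW.
apply/fcvgrPdist_lt => _ /posC_real[r r0 ->].
by have := Fu (r ^+ 2) (exprn_gt0 _ r0); apply: filterS => v; rewrite norm_lt_sqn.
Qed.

Lemma sqn_cvgfP (T : Type) (F : set_system T) {FF : Filter F} (f : T -> H) u :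
  f @ F --> u <-> forall e : R, 0 < e -> \forall x \near F, sqn (u - f x) < e.
Proof. exact: sqn_cvgP. Qed.

Lemma sqn_open_ball u (e : R) : 0 < e ->
  nbhs u [set v | sqn (u - v) < e].
Proof. by move=> e0; apply: (proj1 (sqn_cvgP u)). Qed.

Lemma sqn_denseP (S : set H) :
  dense S <-> forall u (e : R), 0 < e -> exists2 v, S v & sqn (u - v) < e.
Proof.
split=> [dS u e e0|dS O [u Ou] oO].
  have := dS _ _ (open_interior [set v | sqn (u - v) < e]).
  case; first by exists u; exact: sqn_open_ball.
  by move=> v [/interior_subset uv Sv]; exists v.
have /nbhs_ballP[_ /= /posC_real[r r0 ->] rO] := open_nbhs_nbhs (conj oO Ou).
have [v Sv uv] := dS u (r ^+ 2) (exprn_gt0 _ r0).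
exists v; split => //; apply: rO; rewrite -ball_normE /ball_ /=.
by rewrite norm_lt_sqn.
Qed.

Lemma sqn_cauchy (F : set_system H) {FF : ProperFilter F} :
  (forall e : R, 0 < e ->
    exists2 S, F S & forall u v, S u -> S v -> sqn (u - v) < e) ->
  cauchy F.
Proof.
move=> Fc; apply/cauchyP => _ /posC_real[r r0 ->].
have [S FS Su] := Fc (r ^+ 2) (exprn_gt0 _ r0).
have [u uS] := filter_ex FS.
exists u; apply: filterS FS => v vS; rewrite -ball_normE /ball_ /=.
by rewrite norm_lt_sqn//; exact: Su.
Qed.

Lemma dot_cvg (T : Type) (F : set_system T) {FF : Filter F}
    (f : T -> H) u v (eps : R) : f @ F --> u -> 0 < eps ->
  \forall x \near F, normsq (dot u v - dot (f x) v) < eps.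
Proof.
move=> /sqn_cvgfP fu e0.
have d0 : 0 < eps / (sqn v + 1) by rewrite divr_gt0// ltr_wpDl// sqn_ge0.
apply: filterS (fu _ d0) => x fux; rewrite -dotBl.
apply: le_lt_trans (normsq_dot_le _ _) _.
apply: le_lt_trans (_ : _ <= eps / (sqn v + 1) * sqn v) _.
  by rewrite ler_wpM2r ?sqn_ge0// ltW.
rewrite mulrAC ltr_pdivrMr ?ltr_wpDl ?sqn_ge0// ltr_pM2l//.
by rewrite ltrDl.
Qed.

Lemma dot_lim_eq (T : Type) (F : set_system T) {FF : ProperFilter F}
    (f : T -> H) u v a :
  f @ F --> u -> (\forall x \near F, dot (f x) v = a) -> dot u v = a.
Proof.
move=> fu fv; apply/eqP; rewrite -subr_eq0; apply/eqP.
apply: normsq_eq0; apply/eqP; rewrite eq_le normsq_ge0 andbT.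
apply/ler_addgt0Pr => e e0; rewrite add0r.
have [x [fux <-]] := filter_ex (filterI (dot_cvg v fu e0) fv).
exact: ltW.
Qed.

(** Passage to the limit in an identity between inner products; it yields both the symmetry of
    diagonal operators and the closedness of self-adjoint ones. *)
Lemma dot_lim_eq2 (T : Type) (F : set_system T) {FF : ProperFilter F}
    (f g : T -> H) u v u' v' : f @ F --> u -> g @ F --> u' ->
  (\forall x \near F, dot (f x) v = dot (g x) v') -> dot u v = dot u' v'.
Proof.
move=> fu gu fg; apply/eqP; rewrite -subr_eq0; apply/eqP.
apply: normsq_eq0; apply/eqP; rewrite eq_le normsq_ge0 andbT.
apply/ler_addgt0Pr => e e0; rewrite add0r.
have e4 : 0 < e / 4 by rewrite divr_gt0.
have [x [[fux gux] fgx]] := filter_ex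
  (filterI (filterI (dot_cvg v fu e4) (dot_cvg v' gu e4)) fg).
have := normsqZD (-1) (dot u' v' - dot (g x) v') (dot u v - dot (f x) v).
rewrite [-1 * _ + _](_ : _ = dot u v - dot u' v'); last by rewrite -fgx; ring.
rewrite [normsq (-1)](_ : _ = 1); last by rewrite /normsq /= oppr0; ring.
by move: fux gux => /=; lra.
Qed.

End inner_product.

(** * Finite subsums of nonnegative families *)

Section esum_fset.
Context (R : realType) (I : choiceType) (f : I -> R).
Hypothesis f0 : forall i, 0 <= f i.

Lemma esum_fset_ub (A : {fset I}) :
  ((\sum_(i <- A) f i)%:E <= \esum_(i in [set: I]) (f i)%:E)%E.
Proof.
apply: esum_ge; exists [set` A]; first by split => //; exact: finite_fset.
by rewrite fsbig_finite//= set_fsetK sumEFin.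
Qed.

Lemma esum_le_fset (M : R) : (forall A : {fset I}, \sum_(i <- A) f i <= M) ->
  (\esum_(i in [set: I]) (f i)%:E <= M%:E)%E.
Proof.
move=> fM; apply: ge_ereal_sup => _ [X [fX _] <-].
by rewrite fsbig_finite//= sumEFin lee_fin.
Qed.

(** Cauchy criterion in one-sided form: compared with [A], no finite set gains as much as [e]. *)
Lemma esum_fset_approx (e : R) : 0 < e ->
  (\esum_(i in [set: I]) (f i)%:E < +oo)%E ->
  exists A : {fset I}, forall B : {fset I},
    \sum_(i <- B) f i < \sum_(i <- A) f i + e.
Proof.
move=> e0 fy; have fin : \esum_(i in [set: I]) (f i)%:E \is a fin_num.
  by rewrite ge0_fin_numE// esum_ge0// => i _; rewrite lee_fin.
have [_ [X [fX _] <-]] : exists2 x, [set \sum_(x \in A) (f x)%:E | A in fsets [set: I]]%E x &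
    (\esum_(i in [set: I]) (f i)%:E - e%:E < x)%E.
  exact: ub_ereal_sup_adherent.
rewrite fsbig_finite//= sumEFin => h; exists (fset_set X) => B.
rewrite -ltrBlDr -lte_fin; apply: le_lt_trans h.
by rewrite EFinD leeD2r// esum_fset_ub.
Qed.
End esum_fset.

#[local] Existing Instance totally_filter.

(** * Expansions in an orthonormal system *)

Section orthonormal.
Context (R : realType) (H : normedModType R[i]) (dot : {dot H for Num.conj}).
Hypothesis normE : forall u : H, `|u| = sqrtC (dot u u).
(** Completeness enters as a property of filters; [L2_complete] provides it for L2. *)
Hypothesis complete : forall F : set_system H, ProperFilter F -> cauchy F -> cvg F.
Context (I : choiceType) (e : I -> H).
Hypothesis orthonormal : forall i j, dot (e i) (e j) = (i == j)%:R.
Implicit Types (u v s : H) (a : I -> R[i]).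
Local Notation sqn := (sqn dot).
Local Notation coef u i := (dot u (e i)).

Lemma partial_sumE (x : I -> H) (A : {fset I}) :
  partial_sum x A = \sum_(i <- A) x i.
Proof. by rewrite [RHS]finmap.big_seq_fsetE. Qed.

Lemma dot_span_coef (A : {fset I}) a i :
  dot (\sum_(j <- A) a j *: e j) (e i) = if i \in A then a i else 0.
Proof.
rewrite dot_suml; case: ifPn => iA.
  rewrite (bigD1_seq i)//= dotZl orthonormal eqxx mulr1 big1 ?addr0// => j ji.
  by rewrite dotZl orthonormal (negbTE ji) mulr0.
rewrite big_seq big1 // => j jA; rewrite dotZl orthonormal.
by case: eqP jA iA => [-> ->|]//; rewrite mulr0.
Qed.

(** Pythagoras. Only the coefficients inside [A] matter, so the lemma serves for a vector and its
    expansion as well as for two partial sums of one series. *)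
Lemma sqn_sub_span u (A : {fset I}) a : (forall i, i \in A -> coef u i = a i) ->
  sqn (u - \sum_(i <- A) a i *: e i) = sqn u - \sum_(i <- A) normsq (a i).
Proof.
move=> ua; set p := \sum_(i <- A) _.
have h w : (forall i, i \in A -> coef w i = a i) ->
    dot w p = (\sum_(i <- A) normsq (a i))%:C.
  move=> wa; rewrite dot_sumr rmorph_sum/= big_seq [RHS]big_seq.
  by apply: eq_bigr => i iA; rewrite dotZr mulrC wa// conjM_normsq.
rewrite sqnB (h u)// /sqn (h p) /=; first by ring.
by move=> i iA; rewrite dot_span_coef iA.
Qed.

Lemma sqn_span (A : {fset I}) a :
  sqn (\sum_(i <- A) a i *: e i) = \sum_(i <- A) normsq (a i).
Proof.
have := @sqn_sub_span (\sum_(i <- A) a i *: e i) A a.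
rewrite subrr sqn0 => /(_ _)/esym/eqP; rewrite subr_eq0 => h; apply/eqP/h.
by move=> i iA; rewrite dot_span_coef iA.
Qed.

Lemma hassum_coef a s i : hassum (fun i => a i *: e i) s -> coef s i = a i.
Proof.
move=> as_; apply: (dot_lim_eq normE as_).
exists [fset i]%fset => // A /=; rewrite finmap.fsub1set => iA.
by rewrite partial_sumE dot_span_coef iA.
Qed.

Lemma bessel u (A : {fset I}) : \sum_(i <- A) normsq (coef u i) <= sqn u.
Proof.
rewrite -subr_ge0 -(@sqn_sub_span u A (fun i => coef u i))//.
exact: sqn_ge0.
Qed.

Lemma bessel_esum u :
  (\esum_(i in [set: I]) (normsq (coef u i))%:E <= (sqn u)%:E)%E.
Proof. by apply: esum_le_fset => A; exact: bessel. Qed.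

Lemma riesz_fischer a : (\esum_(i in [set: I]) (normsq (a i))%:E < +oo)%E ->
  exists s, hassum (fun i => a i *: e i) s.
Proof.
move=> ay; set F := (partial_sum (fun i => a i *: e i) @ totally).
have /cvg_ex[s Fs] : cvg F; last by exists s.
apply: complete; apply: (sqn_cauchy normE) => eps eps0.
(* Partial sums beyond [A] are within squared distance eps / 4 of the one over [A]; the two factors
   2 of [sqnB_le] bring this back to eps. *)
have e4 : 0 < eps / 4 by rewrite divr_gt0.
have [A AB] := esum_fset_approx (fun i => normsq_ge0 (a i)) e4 ay.
have near_A B : (A `<=` B)%fset ->
    sqn (\sum_(i <- B) a i *: e i - \sum_(i <- A) a i *: e i) < eps / 4.
  move=> /finmap.fsubsetP sAB; rewrite sqn_sub_span ?sqn_span.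
    by have := AB B; lra.
  by move=> i iA; rewrite dot_span_coef sAB.
exists [set partial_sum (fun i => a i *: e i) B | B in [set B | (A `<=` B)%fset]].
  by exists A => // B /= sAB; exists B.
move=> _ _ [B /= sAB <-] [B' /= sAB' <-]; rewrite !partial_sumE.
apply: le_lt_trans (sqnB_le _ _ (\sum_(i <- A) a i *: e i) _) _.
rewrite [X in _ + 2 * X]sqnB_sym.
by move: (near_A _ sAB) (near_A _ sAB'); lra.
Qed.

Lemma parseval a s : hassum (fun i => a i *: e i) s ->
  (\esum_(i in [set: I]) (normsq (a i))%:E = (sqn s)%:E)%E.
Proof.
move=> as_; apply/eqP; rewrite eq_le; apply/andP; split.
  under eq_esum do rewrite -(hassum_coef _ as_).
  exact: bessel_esum.
apply/lee_addgt0Pr => eps eps0.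
move/(sqn_cvgfP normE) : as_ (as_) => /(_ _ eps0)[A _ Aeps] as_.
have := Aeps A (finmap.fsubset_refl A); rewrite partial_sumE sqn_sub_span.
  rewrite ltrBlDl => /ltW h.
  apply: (@le_trans _ _ ((\sum_(i <- A) normsq (a i))%:E + eps%:E)%E).
    by rewrite -EFinD lee_fin.
  by rewrite leeD2r// esum_fset_ub.
by move=> i _; exact: hassum_coef.
Qed.

Lemma orthogonal_projection u : exists2 p,
  hassum (fun i => coef u i *: e i) p & forall i, coef (u - p) i = 0.
Proof.
have [|p up] := @riesz_fischer (fun i => coef u i).
  exact: le_lt_trans (bessel_esum u) (ltry _).
by exists p => // i; rewrite dotBl (hassum_coef _ up) subrr.
Qed.

(** A vector orthogonal to the span is at squared distance at least [sqn u] from each of its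
    elements, whereas density makes that distance arbitrarily small. *)
Lemma span_total : dense (linear_span e) ->
  forall u, (forall i, coef u i = 0) -> u = 0.
Proof.
move=> /(sqn_denseP normE) de u u0.
apply: (sqn_eq0 (dot := dot)); apply/eqP; rewrite eq_le sqn_ge0 andbT.
apply/ler_addgt0Pr => eps eps0; rewrite add0r.
have [_ [r [c ->]] uc] := de u eps eps0; apply: le_trans (ltW uc).
rewrite sqnB dot_sumr [\sum_(i <- r) dot _ _]big1 ?mulr0 ?subr0 ?lerDl ?sqn_ge0//.
by move=> i _; rewrite dotZr u0 mulr0.
Qed.

Lemma total_dense : (forall u, (forall i, coef u i = 0) -> u = 0) ->
  dense (linear_span e).
Proof.
move=> tot; apply/(sqn_denseP normE) => u eps eps0.
have [p up] := orthogonal_projection u.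
move/tot/eqP; rewrite subr_eq0 => /eqP upE; rewrite -{}upE in up.
move/(sqn_cvgfP normE) : up => /(_ _ eps0)[A _ Aeps].
exists (partial_sum (fun i => coef u i *: e i) A).
  by exists A, (fun i => coef u i); rewrite partial_sumE.
by apply: Aeps => /=; exact: finmap.fsubset_refl.
Qed.

Lemma hassum_of_coef : (forall u, (forall i, coef u i = 0) -> u = 0) ->
  forall u a, (forall i, coef u i = a i) -> hassum (fun i => a i *: e i) u.
Proof.
move=> tot u a ua; have [p up] := orthogonal_projection u.
move/tot/eqP; rewrite subr_eq0 => /eqP upE; rewrite -{}upE in up.
by under eq_fun do rewrite -ua.
Qed.

End orthonormal.

(** * The diagonal operator attached to an orthonormal basis *)

Section diagonal_operator.
Context (R : realType) (H : normedModType R[i]) (dot : {dot H for Num.conj}).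
Hypothesis normE : forall u : H, `|u| = sqrtC (dot u u).
Hypothesis complete : forall F : set_system H, ProperFilter F -> cauchy F -> cvg F.
Context (I : choiceType) (e : I -> H) (lam : I -> R).
Hypothesis orthonormal : forall i j, dot (e i) (e j) = (i == j)%:R.
Hypothesis total : forall u, (forall i, dot u (e i) = 0) -> u = 0.
Local Notation sqn := (sqn dot).
Local Notation coef u i := (dot u (e i)).

(** Abstract form of [spectral_op], convertible to it when [e] is the family of exponentials and
    [lam] the inclusion of [Lambda]. *)
Definition diag_op : set (H * H) :=
  [set p | exists f : I -> R[i],
    [/\ hassum (fun i => f i *: e i) p.1,
       (\esum_(i in [set: I]) (lam i ^+ 2 * normsq (f i))%:E < +oo)%E &
        hassum (fun i => ((lam i)%:C * f i) *: e i) p.2]].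

Lemma normsqCM (r : R) (z : R[i]) : normsq (r%:C * z) = r ^+ 2 * normsq z.
Proof. by rewrite normsqM {1}/normsq /= expr0n addr0. Qed.

Lemma coef_inj u v : (forall i, coef u i = coef v i) -> u = v.
Proof.
move=> uv; apply/eqP; rewrite -subr_eq0; apply/eqP; apply: total => i.
by rewrite dotBl uv subrr.
Qed.

(** The summability clause is automatic: the numbers [lam i * f i] are the coefficients of the
    vector [v], to which Bessel's inequality applies. *)
Lemma diag_opP u v :
  diag_op (u, v) <-> forall i, coef v i = (lam i)%:C * coef u i.
Proof.
split=> [[f /= [fu _ fv] i]|uv].
  by rewrite (hassum_coef normE orthonormal _ fu) (hassum_coef normE orthonormal _ fv).
exists (fun i => coef u i); split => /=.
- exact: (hassum_of_coef normE complete orthonormal total).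
- under eq_esum do rewrite -normsqCM -uv.
  exact: le_lt_trans (bessel_esum orthonormal v) (ltry _).
- exact: (hassum_of_coef normE complete orthonormal total).
Qed.

Lemma diag_op_domain : op_domain diag_op =
  [set u | exists2 f : I -> R[i], hassum (fun i => f i *: e i) u &
    (\esum_(i in [set: I]) (lam i ^+ 2 * normsq (f i))%:E < +oo)%E].
Proof.
apply/seteqP; split=> [u [v [f [fu fy _]]]|u [f fu fy]]; first by exists f.
have [|v fv] := riesz_fischer normE complete orthonormal (a := fun i => (lam i)%:C * f i).
  by under eq_esum do rewrite normsqCM.
by exists v, f.
Qed.

Lemma diag_op_basis i : diag_op (e i, (lam i)%:C *: e i).
Proof.
apply/diag_opP => j; rewrite dotZl orthonormal.
by case: eqP => [->//|]; rewrite !mulr0.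
Qed.

Lemma diag_op_linear : linear_operator diag_op.
Proof.
split=> [|a [u v] [u' v'] /diag_opP uv /diag_opP uv'|u v w /diag_opP uv /diag_opP uw].
- by apply/diag_opP => i; rewrite !dot0l mulr0.
- apply/diag_opP => i; rewrite !dotDl !dotZl uv uv' mulrDr; congr (_ + _).
  by rewrite mulrCA.
- by apply: coef_inj => i; rewrite uv uw.
Qed.

Lemma linear_domain_sum (A : set (H * H)) (r : seq I) (c : I -> R[i]) (w : I -> H) :
  linear_operator A -> (forall i, A (e i, w i)) ->
  A (\sum_(i <- r) c i *: e i, \sum_(i <- r) c i *: w i).
Proof.
move=> [A0 AD _] Ae; elim: r => [|i r IH]; first by rewrite !big_nil.
by rewrite !big_cons; exact: (AD _ _ _ (Ae i) IH).
Qed.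

Lemma diag_op_dense : dense (op_domain diag_op).
Proof.
have := total_dense normE complete orthonormal total.
move=> de O O0 oO; have [u [Ou [r [c uE]]]] := de O O0 oO; exists u; split => //.
rewrite {}uE; eexists.
apply: linear_domain_sum; [exact: diag_op_linear|exact: diag_op_basis].
Qed.

Lemma diag_op_self_adjoint : self_adjoint dot diag_op.
Proof.
split; [exact: diag_op_linear|exact: diag_op_dense|].
apply/seteqP; split=> -[u v] /= uv.
  (* Testing the adjoint relation on basis vectors already gives the coefficients of [v]. *)
  apply/diag_opP => i; have := uv _ (diag_op_basis i) => /=.
  rewrite dotZl (dot_conj _ u (e i)) (dot_conj _ v (e i)) => h.
  apply: (can_inj (@conjCK _)); rewrite -h rmorphM /=; congr (_ * _).
  by apply: complex_eqP; rewrite /= ?RecJ ?ImcJ/= ?oppr0.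
move/diag_opP : uv => uv -[x y] /= /diag_opP xy.
have hx := hassum_of_coef normE complete orthonormal total (u := x) (fun i => erefl).
have hy := hassum_of_coef normE complete orthonormal total (u := y) (fun i => erefl).
(* The expansions of [y] and [x] are truncated along the same finite sets, on which the identity
   holds term by term. *)
apply: (dot_lim_eq2 normE hy hx); apply: nearW => A.
rewrite !partial_sumE !dot_suml; apply: eq_bigr => i _.
rewrite !dotZl xy (dot_conj _ u) (dot_conj _ v) uv rmorphM /= mulrCA mulrA.
by congr (_ * _ * _); apply: complex_eqP; rewrite /= ?RecJ ?ImcJ/= ?oppr0.
Qed.
End diagonal_operator.

(** * Self-adjoint operators with compact embedding of the domain *)

Section compact_self_adjoint.
Context (R : realType) (H : normedModType R[i]) (dot : {dot H for Num.conj}).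
Hypothesis normE : forall u : H, `|u| = sqrtC (dot u u).
Hypothesis complete : forall F : set_system H, ProperFilter F -> cauchy F -> cvg F.
Local Notation sqn := (sqn dot).

Lemma sqn_cvg (T : Type) (F : set_system T) {FF : Filter F} (f : T -> H) u (eps : R) :
  f @ F --> u -> 0 < eps -> \forall x \near F, `|sqn u - sqn (f x)| < eps.
Proof.
move=> fu e0; have e2 : 0 < eps / 2 by rewrite divr_gt0.
have e4 : 0 < (eps / 4) ^+ 2 by rewrite exprn_gt0// divr_gt0.
move/(sqn_cvgfP normE): (fu) => /(_ _ e2) h1; have h2 := dot_cvg (FF := FF) normE u fu e4.
apply: filterS2 h1 h2 => x h1 h2.
have -> : sqn u - sqn (f x) = 2 * Re (dot u u - dot (f x) u) - sqn (u - f x).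
  rewrite sqnB -[X in _ * X]/(Re (dot u u - dot (f x) u)) ReD.
  have -> : Re (- dot (f x) u) = - Re (dot u (f x)).
    by rewrite (dot_conj dot u (f x)); case: (dot u (f x)).
  by rewrite /sqn; ring.
have h3 : `|Re (dot u u - dot (f x) u)| < eps / 4.
  rewrite -ltr_sqr ?nnegrE ?divr_ge0 ?(ltW e0)// real_normK ?num_real//.
  by apply: le_lt_trans h2; rewrite /normsq lerDl sqr_ge0.
have := sqn_ge0 dot (u - f x); move: h1 h3.
by rewrite !ltr_norml => h1 /andP[h3 h4] h5; apply/andP; split; lra.
Qed.

Context (A : set (H * H)).
Hypothesis sA : self_adjoint dot A.

Lemma sa_linear : linear_operator A. Proof. by case: sA. Qed.

Lemma sa_sym u v u' v' : A (u, v) -> A (u', v') -> dot v u' = dot u v'.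
Proof. by move=> uv; case: sA => _ _ {1}<- /(_ _ uv). Qed.

Lemma sa_max u v : (forall x y, A (x, y) -> dot y u = dot x v) -> A (u, v).
Proof.
move=> uv; have : adjoint dot A (u, v) by move=> [x y] /uv.
by case: sA => _ _ ->.
Qed.

Lemma sa_lin a u v u' v' : A (u, v) -> A (u', v') ->
  A (a *: u + u', a *: v + v').
Proof. by case: sa_linear => _ lA _ uv uv'; exact: (lA a _ _ uv uv'). Qed.

Lemma sa_sub u v u' v' : A (u, v) -> A (u', v') -> A (u - u', v - v').
Proof.
move=> uv uv'; have := sa_lin (-1) uv' uv.
by rewrite !scaleN1r [- _ + _]addrC [- _ + v]addrC.
Qed.

(** An adjoint is closed, and [A] is its own adjoint. *)
Lemma sa_closed (T : Type) (F : set_system T) {FF : ProperFilter F} (x y : T -> H) u v :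
  (\forall t \near F, A (x t, y t)) -> x @ F --> u -> y @ F --> v -> A (u, v).
Proof.
move=> xy xu yv; apply: sa_max => p q pq.
rewrite (dot_conj dot u q) (dot_conj dot v p); congr (Num.conj _).
apply: (dot_lim_eq2 normE xu yv); apply: filterS xy => t /(sa_sym pq) h.
by rewrite (dot_conj dot q) h -dot_conj.
Qed.

Context (I : choiceType) (e : I -> H) (lam : I -> R).
Hypothesis orthonormal : forall i j, dot (e i) (e j) = (i == j)%:R.
Hypothesis Ae : forall i, A (e i, (lam i)%:C *: e i).
Local Notation coef u i := (dot u (e i)).

Lemma sa_coef u v i : A (u, v) -> coef v i = (lam i)%:C * coef u i.
Proof.
move=> uv; rewrite (sa_sym uv (Ae i)) dotZr; congr (_ * _).
by apply: complex_eqP; rewrite /= ?RecJ ?ImcJ/= ?oppr0.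
Qed.

Let N u := forall i, coef u i = 0.

Lemma hassum_orth a p u : hassum (fun i => a i *: e i) p -> N u -> dot p u = 0.
Proof.
move=> ap Nu; apply: (dot_lim_eq normE ap); apply: nearW => B.
rewrite partial_sumE dot_suml big1// => i _.
by rewrite dotZl dot_conj Nu conjC0 mulr0.
Qed.

(** The closed span of the [e i] reduces [A]: the projections of [u] and [v] are limits of finite
    sums paired by [A], so the pair of projections lies in [A] by closedness and can be
    subtracted. *)
Lemma sa_projection u v : A (u, v) -> exists p q,
  [/\ A (u - p, v - q), N (u - p), N (v - q) &
    forall w, N w -> dot p w = 0 /\ dot q w = 0].
Proof.
move=> uv.
have [p up Np] := orthogonal_projection normE complete orthonormal u.
have [q vq Nq] := orthogonal_projection normE complete orthonormal v.
exists p, q; split => // [|w Nw]; last first.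
  by split; [exact: hassum_orth up Nw|exact: hassum_orth vq Nw].
apply: sa_sub => //; apply: (sa_closed _ up vq); apply: nearW => B.
rewrite !partial_sumE.
have -> : \sum_(i <- B) coef v i *: e i =
          \sum_(i <- B) coef u i *: ((lam i)%:C *: e i).
  by apply: eq_bigr => i _; rewrite (sa_coef i uv) scalerA mulrC.
by apply: linear_domain_sum => //; exact: sa_linear.
Qed.

(** Euler-Lagrange equation of the quotient |A x|^2 / |x|^2 on the complement of the [e i]: at a
    minimizer <y, v> = m <x, u> for all (x, y) in [A], and the maximality of [A] turns this into A v
    = m u. *)
Lemma sa_minimum_eq (m : R) u v :
  A (u, v) -> N u -> sqn v = m * sqn u ->
  (forall x y, A (x, y) -> N x -> m * sqn x <= sqn y) -> A (v, m%:C *: u).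
Proof.
move=> uv Nu vE mle.
have Nv : N v by move=> i; rewrite (sa_coef i uv) Nu mulr0.
have mJ : Num.conj m%:C = m%:C.
  by apply: complex_eqP; rewrite /= ?RecJ ?ImcJ/= ?oppr0.
have key x y : A (x, y) -> N x -> Re (dot y v) = m * Re (dot x u).
  move=> xy Nx; set b := Re (dot y v) - m * Re (dot x u).
  set c := sqn y - m * sqn x.
  have c0 : 0 <= c by rewrite subr_ge0 mle.
  (* Minimality compared with t x + u; the constant term of the quadratic in t vanishes by [vE]. *)
  have h (t : R) : 0 <= t * (2 * b + t * c).
    have Axt := sa_lin t%:C xy uv.
    have Nxt : N (t%:C *: x + u) by move=> i; rewrite dotDl dotZl Nx Nu mulr0 addr0.
    have := mle _ _ Axt Nxt; rewrite -subr_ge0.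
    rewrite !sqnD !sqnZ !dotZl !ReM vE /normsq /= => k.
    apply: le_trans k _; rewrite le_eqVlt; apply/orP; left; apply/eqP.
    by rewrite /b /c; ring.
  apply/eqP; rewrite -subr_eq0 -/b; apply/negP => /negP b0.
  (* For nonzero [b] this value of t makes the quadratic negative; the 1 allows [c = 0]. *)
  have := h (- b / (c + 1)).
  have c1 : c + 1 != 0 by rewrite gt_eqF// ltr_wpDl.
  have -> : - b / (c + 1) * (2 * b + - b / (c + 1) * c) =
     - (b / (c + 1)) ^+ 2 * (c + 2) by field.
  rewrite mulNr oppr_ge0 => k.
  have : 0 < (b / (c + 1)) ^+ 2 * (c + 2).
    rewrite mulr_gt0 ?ltr_wpDl// exprn_even_gt0//=.
    by rewrite mulf_neq0// invr_eq0.
  by rewrite ltNge k.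
have keyC x y : A (x, y) -> N x -> dot y v = m%:C * dot x u.
  move=> xy Nx; apply: complex_eqP.
    by rewrite (key _ _ xy Nx) ReM /= mul0r subr0.
  (* The real identity applied to i x gives the imaginary part. *)
  have Aix := sa_lin 'i%C xy (let: And3 A0 _ _ := sa_linear in A0).
  have Nix : N ('i%C *: x + 0) by move=> i; rewrite addr0 dotZl Nx mulr0.
  have := key _ _ Aix Nix; rewrite !addr0 !dotZl !ReM ImM /=; lra.
(* A general pair of [A] differs from one orthogonal to the [e i] by components whose products with
   [u] and [v] are 0. *)
apply: sa_max => x y xy.
have [p [q [Apq Np Nq pq]]] := sa_projection xy.
have := keyC _ _ Apq Np.
by rewrite dotZr mJ !dotBl (pq _ Nv).2 (pq _ Nu).1 !subr0.
Qed.

(** Compact embedding of the domain, in terms of ultrafilters: graph-bounded sequences are Cauchy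
    along every one of them, so that no subsequence has to be extracted. *)
Hypothesis compact_graph : forall (x y : nat -> H) (M : R),
  (forall k, [/\ A (x k, y k), sqn (x k) <= M & sqn (y k) <= M]) ->
  forall U : set_system nat, UltraFilter U -> forall eps : R, 0 < eps ->
  exists2 S, U S & forall k l, S k -> S l -> sqn (x k - x l) < eps.
Hypothesis eigen : forall (t : R) w, w != 0 -> A (w, t%:C *: w) ->
  exists i, coef w i != 0.

Lemma sa_no_eigen (t : R) w : N w -> A (w, t%:C *: w) -> w = 0.
Proof.
move=> Nw Aw; apply/eqP; apply/negP => /negP w0.
by have [j] := eigen w0 Aw; rewrite Nw eqxx.
Qed.

(** A minimizing sequence converges along an ultrafilter: the [x k] by [compact_graph], the [y k]
    because near-minimality makes them Cauchy as well. Closedness of [A] then gives a minimizer. *)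
Lemma sa_compact_no_minimum (m : R) :
  (forall x y, A (x, y) -> N x -> m * sqn x <= sqn y) ->
  (forall eps : R, 0 < eps -> exists x y,
     [/\ A (x, y), N x, sqn x = 1 & sqn y < m + eps]) -> False.
Proof.
move=> mle mlim.
have /choice[xy Pxy] (k : nat) : exists p : H * H,
    [/\ A p, N p.1, sqn p.1 = 1 & sqn p.2 < m + k.+1%:R^-1].
  have [|x [y [? ? ? ?]]] := mlim k.+1%:R^-1; first by rewrite invr_gt0.
  by exists (x, y).
pose x k := (xy k).1; pose y k := (xy k).2.
have Axy k : A (x k, y k) by have [] := Pxy k; rewrite /x /y; case: (xy k).
have Nx k : N (x k) by have [] := Pxy k.
have x1 k : sqn (x k) = 1 by have [] := Pxy k.
have ym k : sqn (y k) < m + k.+1%:R^-1 by have [] := Pxy k.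
have m0 : 0 <= m.
  apply/ler_addgt0Pr => eps /mlim[u [v [_ _ _ h]]].
  exact: le_trans (sqn_ge0 dot v) (ltW h).
have [U [UU oU]] := @ultraFilterLemma nat \oo _.
have bnd k : [/\ A (x k, y k), sqn (x k) <= m + 1 & sqn (y k) <= m + 1].
  split => //; first by rewrite x1 lerDr.
  rewrite (le_trans (ltW (ym k)))// lerD2l invf_le1// ler1n.
  exact.
have xc := compact_graph bnd UU.
have /cvg_ex[u xu] : cvg (x @ U).
  apply: complete; apply: (sqn_cauchy normE) => eps /xc[S US Seps].
  exists (x @` S); first by rewrite /fmap/=; apply: filterS US => k Sk; exists k.
  by move=> _ _ [k Sk <-] [l Sl <-]; exact: Seps.
have /cvg_ex[v yv] : cvg (y @ U).
  apply: complete; apply: (sqn_cauchy normE) => eps eps0.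
  (* By the parallelogram law |y_k - y_l|^2 = 2 |y_k|^2 + 2 |y_l|^2 - |y_k + y_l|^2, where the first
     two terms are below 4 (m + d) and the last is at least m |x_k + x_l|^2 >= m (4 - d). The
     difference is at most (m + 4) d, which is less than eps. *)
  pose d := eps / (m + 5).
  have d0 : 0 < d by rewrite divr_gt0// ltr_wpDl.
  have [S US Sd] := xc d d0.
  have Ud : U [set k | k.+1%:R^-1 < d] by apply: oU; exact: near_infty_natSinv_lt (PosNum d0).
  exists (y @` (S `&` [set k | k.+1%:R^-1 < d])).
    by rewrite /fmap/=; apply: filterS (filterI US Ud) => k Sk; exists k.
  move=> _ _ [k [Sk kd] <-] [l [Sl ld] <-].
  have Akl := sa_lin 1 (Axy k) (Axy l); rewrite !scale1r in Akl.
  have := mle _ _ Akl _; rewrite -(addrC (y l)) => h.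
  have {h} := h (fun i => _); rewrite [y l + _]addrC => h.
  have {}h : m * sqn (x k + x l) <= sqn (y k + y l).
    by apply: h => i; rewrite dotDl !Nx addr0.
  have := parallelogram dot (x k) (x l); have := parallelogram dot (y k) (y l).
  rewrite !x1 => py px; have xd := Sd _ _ Sk Sl; 
  have yk : sqn (y k) < m + d by apply: lt_trans (ym k) _; rewrite ltrD2l.
  have yl : sqn (y l) < m + d by apply: lt_trans (ym l) _; rewrite ltrD2l.
  have {}h : m * (4 - d) <= sqn (y k + y l).
    by apply: le_trans h; rewrite ler_wpM2l//; lra.
  have dE : d * (m + 5) = eps by rewrite /d divfK// gt_eqF// ltr_wpDl.
  have hm : m * (4 - d) = 4 * m - m * d by ring.
  have dm : d * (m + 5) = m * d + 5 * d by ring.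
  by rewrite hm in h; rewrite dm in dE; clearbody d; lra.
have Auv : A (u, v) by apply: (sa_closed _ xu yv); exact: nearW.
have Nu : N u by move=> i; apply: (dot_lim_eq normE xu); apply: nearW => k; exact: Nx.
have u1 : sqn u = 1.
  apply/eqP; rewrite -subr_eq0 -normr_le0; apply/ler_addgt0Pr => eps eps0.
  have [k] := filter_ex (sqn_cvg xu eps0); rewrite x1 add0r; exact: ltW.
have vm : sqn v = m.
  apply/eqP; rewrite eq_le; apply/andP; split; last first.
    by have := mle _ _ Auv Nu; rewrite u1 mulr1.
  apply/ler_addgt0Pr => eps eps0; have e2 : 0 < eps / 2 by rewrite divr_gt0.
  have Ue : U [set k | k.+1%:R^-1 < eps / 2].
    by apply: oU; exact: near_infty_natSinv_lt (PosNum e2).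
  have [k [/= h1]] := filter_ex (filterI Ue (sqn_cvg yv e2)).
  have {h1} : sqn (y k) < m + eps / 2 by apply: lt_trans (ym k) _; rewrite ltrD2l.
  by rewrite ltr_norml => h1 /andP[_ h2]; lra.
have Av := sa_minimum_eq Auv Nu (_ : sqn v = m * sqn u) mle.
have {}Av : A (v, m%:C *: u) by apply: Av; rewrite u1 mulr1.
have Nv : N v by move=> i; rewrite (sa_coef i Auv) Nu mulr0.
(* A (A u) = m u factors as (A - t)(A + t) u = 0: first A u + t u must vanish, being in the kernel
   of A - t, then [u], being in the kernel of A + t. *)
pose t := Num.sqrt m.
have tt : t * t = m by rewrite -expr2 sqr_sqrtr.
have w0 : t%:C *: u + v = 0.
  apply: (@sa_no_eigen t); first by move=> i; rewrite dotDl dotZl Nu Nv mulr0 addr0.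
  have := sa_lin t%:C Auv Av.
  by rewrite scalerDr scalerA -rmorphM/= tt [t%:C *: v + _]addrC.
have u0 : u = 0.
  apply: (@sa_no_eigen (- t)) => //; move/eqP : w0; rewrite addr_eq0 => /eqP w0.
  by rewrite rmorphN scaleNr w0 opprK.
by move: u1; rewrite u0 sqn0 => /eqP; rewrite eq_sym oner_eq0.
Qed.

(* The minimum of [sqn (A u)] over unit vectors [u] orthogonal to the [e i] is
   attained, by compactness, at a vector with [A (A u) = m u]; then either
   [A u + sqrt m u] or [u] is an eigenvector orthogonal to every [e i]. *)
Lemma sa_compact_total u : N u -> u = 0.
Proof.
move=> Nu; apply/eqP; apply/negP => /negP u0.
have su : 0 < sqn u.
  rewrite lt_neqAle sqn_ge0 andbT; apply/eqP => /esym/sqn_eq0 /eqP; exact/negP.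
have [_ /(sqn_denseP normE) dA _] := sA.
(* Closer to [u] than |u|, the vector [w] cannot be orthogonal to [u], so its component [w - p] is
   nonzero. This makes the set of values to be minimized nonempty. *)
have [w [z Awz] uw] := dA u _ su.
have [p [q [Apq Np _ pq]]] := sa_projection Awz.
have sp : 0 < sqn (w - p).
  rewrite lt_neqAle sqn_ge0 andbT; apply/eqP => /esym/sqn_eq0 /eqP.
  rewrite subr_eq0 => /eqP wp; move: uw; rewrite sqnB wp.
  rewrite (dot_conj dot p u) (pq _ Nu).1 conjC0 /= mulr0 subr0.
  by rewrite ltNge lerDl sqn_ge0.
pose E := [set sqn y | y in [set y | exists x, [/\ A (x, y), N x & sqn x = 1]]].
have scale x y : A (x, y) -> N x -> 0 < sqn x -> E (sqn y / sqn x).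
  move=> xy Nx x0; pose c := (Num.sqrt (sqn x))^-1.
  have c2 : c ^+ 2 = (sqn x)^-1 by rewrite exprVn sqr_sqrtr// ltW.
  have nc : normsq c%:C = (sqn x)^-1 by rewrite /normsq /= expr0n addr0.
  exists (c%:C *: y); last by rewrite sqnZ nc mulrC.
  exists (c%:C *: x); split.
  - have A0 : A 0 by case: sa_linear.
    by have := sa_lin c%:C xy A0; rewrite !addr0.
  - by move=> i; rewrite dotZl Nx mulr0.
  - by rewrite sqnZ nc mulVf// gt_eqF.
have E0 : has_inf E.
  split; first by exists (sqn (z - q) / sqn (w - p)); exact: scale.
  by exists 0 => _ [y _ <-]; exact: sqn_ge0.
apply: (@sa_compact_no_minimum (inf E)).
  move=> x y xy Nx; have [x0|x0] := ltP 0 (sqn x).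
    by rewrite -ler_pdivlMr//; apply: ge_inf; [exact: E0.2|exact: scale].
  have -> : sqn x = 0 by apply/eqP; rewrite eq_le x0 sqn_ge0.
  by rewrite mulr0 sqn_ge0.
move=> eps eps0; have [_ [y [x [xy Nx x1]] <-] yE] := inf_adherent eps0 E0.
by exists x, y.
Qed.

End compact_self_adjoint.

(** * The spectrum of a diagonal operator *)

Section diagonal_spectrum.
Context (R : realType) (H : normedModType R[i]) (dot : {dot H for Num.conj}).
Hypothesis normE : forall u : H, `|u| = sqrtC (dot u u).
Hypothesis complete : forall F : set_system H, ProperFilter F -> cauchy F -> cvg F.
Context (I : choiceType) (e : I -> H) (lam : I -> R).
Hypothesis orthonormal : forall i j, dot (e i) (e j) = (i == j)%:R.
Hypothesis total : forall u, (forall i, dot u (e i) = 0) -> u = 0.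
Local Notation sqn := (sqn dot).
Local Notation coef u i := (dot u (e i)).

(** Symmetry against the [e i] gives the coefficients of [v], and closedness puts the limits of
    finite sums into [A]. *)
Lemma sa_diag_op (A : set (H * H)) : self_adjoint dot A ->
  (forall i, A (e i, (lam i)%:C *: e i)) -> A = diag_op e lam.
Proof.
move=> sA Ae; apply/seteqP; split=> -[u v] uv.
  apply/(diag_opP normE complete lam orthonormal total) => i.
  exact: (sa_coef sA Ae i uv).
have [f [/= fu _ fv]] := uv.
apply: (sa_closed normE sA _ fu fv); apply: nearW => B.
rewrite !partial_sumE; under [X in A (_, X)]eq_bigr do rewrite mulrC -scalerA.
by apply: linear_domain_sum => //; exact: sa_linear sA.
Qed.

Lemma norm_sqr_sqn u : `|u| ^+ 2 = (sqn u)%:C.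
Proof. by rewrite normE sqrtCK dot_sqn. Qed.

(** The hypothesis says that the set of eigenvalues is closed; it keeps the divisors [lam i - z]
    away from 0, so that dividing coefficients by them is a bounded operator. *)
Lemma diag_op_spectrum :
  (forall z : R[i], (forall i, (lam i)%:C != z) ->
    exists2 c : R, 0 < c & forall i, c <= normsq ((lam i)%:C - z)) ->
  op_spectrum (diag_op e lam) = [set (lam i)%:C | i in [set: I]].
Proof.
move=> sep; apply/seteqP; split=> [z zs|_ [i _ <-] [B [AB _]]]; last first.
  (* At an eigenvalue, injectivity fails: both [e i] and 0 would be [B 0]. *)
  have e0 : e i = B 0.
    by apply/AB; rewrite add0r; exact: (diag_op_basis normE complete lam orthonormal total).
  have : (0 : H) = B 0.
    apply/AB; rewrite scaler0 addr0.
    by have [] := diag_op_linear normE complete lam orthonormal total.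
  rewrite -e0 => i0; have := orthonormal i i; rewrite eqxx -{1}i0 dot0l.
  by move=> /eqP; rewrite eq_sym oner_eq0.
apply: contrapT => zl; apply: zs.
have {}/sep[c c0 zc] : forall i, (lam i)%:C != z.
  by move=> i; apply/eqP => lz; apply: zl; exists i.
pose g v i := ((lam i)%:C - z)^-1 * coef v i.
have gz i : (lam i)%:C - z != 0.
  apply/eqP => lz; have := zc i; rewrite lz /normsq /= expr0n addr0 leNgt.
  by rewrite c0.
have gle v i : normsq (g v i) <= c^-1 * normsq (coef v i).
  rewrite ler_pdivlMl// [X in _ <= normsq X](_ : _ = ((lam i)%:C - z) * g v i).
    by rewrite normsqM ler_wpM2r// normsq_ge0.
  by rewrite /g mulVKf.
have gsum v : (\esum_(i in [set: I]) (normsq (g v i))%:E <= (c^-1 * sqn v)%:E)%E.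
  apply: esum_le_fset => // X; apply: le_trans (ler_sum _ (fun i _ => gle v i)) _.
  by rewrite -mulr_sumr ler_wpM2l ?invr_ge0 ?(ltW c0)//; exact: bessel.
have /choice[B Bg] v : exists s, hassum (fun i => g v i *: e i) s.
  apply: (riesz_fischer normE complete orthonormal).
  exact: le_lt_trans (gsum v) (ltry _).
exists B; split=> [u v|].
  rewrite (diag_opP normE complete lam orthonormal total); split=> [uv|-> i].
    apply: (coef_inj total) => i; rewrite (hassum_coef normE orthonormal i (Bg v)).
    apply: (mulfI (gz i)); rewrite /g mulVKf// mulrBl -uv dotDl dotZl.
    by rewrite addrK.
  rewrite dotDl dotZl (hassum_coef normE orthonormal i (Bg v)).
  apply/eqP; rewrite -subr_eq0 -addrA -mulrBl -[z - _]opprB mulNr.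
  by rewrite /g mulVKf// subrr.
exists (Num.sqrt c^-1)%:C => v.
rewrite -ler_sqr ?nnegrE ?mulr_ge0//; last by rewrite lecR sqrtr_ge0.
rewrite exprMn !norm_sqr_sqn -rmorphXn -rmorphM/= lecR sqr_sqrtr ?invr_ge0 ?(ltW c0)//.
by rewrite -lee_fin -(parseval normE orthonormal (Bg v)).
Qed.
End diagonal_spectrum.

(** * Completeness of L2 *)

Section fast_cauchy.
Context (R : realType).

(** The steps are at most sqrt M 2^-k, so the tail from n is at most 2 sqrt M 2^-n, whose square is
    the stated bound. *)
Lemma fast_cauchy_cvg (a : nat -> R) (M : R) :
  (forall k, 4 ^+ k * (a k.+1 - a k) ^+ 2 <= M) ->
  exists2 l, a k @[k --> \oo] --> l & forall n, (l - a n) ^+ 2 <= 4 * 4 ^- n * M.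
Proof.
move=> aM; have M0 : 0 <= M.
  by apply: le_trans (aM 0%N); rewrite mulr_ge0 ?sqr_ge0 ?exprn_ge0.
pose c := Num.sqrt M; have cM : c ^+ 2 = M by rewrite sqr_sqrtr.
have c0 : 0 <= c by rewrite sqrtr_ge0.
have step k : `|a k.+1 - a k| <= c * 2 ^- k.
  rewrite -ler_sqr ?nnegrE ?mulr_ge0 ?invr_ge0 ?exprn_ge0//.
  rewrite real_normK ?num_real// exprMn cM exprVn -exprM mulnC exprM.
  by rewrite -natrX ler_pdivlMr ?exprn_gt0// mulrC.
have dist n m : `|a (n + m)%N - a n| <= c * 2 * (2 ^- n - 2 ^- (n + m)).
  elim: m => [|m IH]; first by rewrite addn0 !subrr normr0 mulr0.
  rewrite addnS (le_trans (ler_distD (a (n + m)%N) _ _))//.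
  rewrite (le_trans (lerD (step _) IH))// exprS invfM.
  rewrite le_eqVlt; apply/orP; left; apply/eqP.
  by move: (2 ^- n) (2 ^- (n + m)) => x y; field.
have dist2 n m : (n <= m)%N -> `|a m - a n| <= c * 2 * 2 ^- n.
  move=> /subnKC <-; apply: le_trans (dist _ _) _.
  by rewrite ler_wpM2l ?mulr_ge0// gerBl invr_ge0 exprn_ge0.
have /cvg_ex[l al] : cvgn a.
  apply: cauchy_cvg; apply: cauchy_exP => eps eps0.
  have [n neps] : exists n, c * 2 * 2 ^- n < eps.
    have c1 : 0 < eps / (c * 2 + 1) by rewrite divr_gt0// ltr_wpDl// mulr_ge0.
    have [n _ nc] := near_infty_natSinv_expn_lt (PosNum c1).
    exists n; apply: le_lt_trans (_ : _ <= (c * 2 + 1) * 2 ^- n) _.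
      by rewrite ler_wpM2r ?invr_ge0 ?exprn_ge0// lerDl.
    rewrite -ltr_pdivlMl ?ltr_wpDl ?mulr_ge0// mulrC.
    by have := nc n (leqnn n); rewrite /= div1r.
  exists (a n); exists n => // m /= nm; rewrite /ball /= distrC.
  exact: le_lt_trans (dist2 _ _ nm) neps.
exists l => // n.
have h : `|l - a n| <= c * 2 * 2 ^- n.
  apply/ler_addgt0Pr => eps eps0.
  move/cvgrPdist_lt : al => /(_ _ eps0) al.
  have [m [/= lm nm]] := filter_ex (filterI al (nbhs_infty_ge n)).
  rewrite (le_trans (ler_distD (a m) _ _))// addrC lerD// ?(ltW lm)//.
  exact: dist2.
rewrite -real_normK ?num_real//.
apply: le_trans (_ : (c * 2 * 2 ^- n) ^+ 2 <= _).
  by rewrite ler_sqr ?nnegrE ?mulr_ge0 ?invr_ge0 ?exprn_ge0.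
rewrite !exprMn cM exprVn -exprM mulnC exprM.
have -> : 2 ^+ 2 = 4 :> R by ring.
by rewrite le_eqVlt; apply/orP; left; apply/eqP; ring.
Qed.

Context d (T : measurableType d) (mu : {measure set T -> \bar R}).

(** The series [G] of 4^k (h_(k+1) - h_k)^2 has integral at most the sum of 4^k 8^-k, which is 2.
    Its value at x is the constant [M] of [fast_cauchy_cvg] there, and integrating the pointwise
    bound gives 4 * 2 * 4^-n. *)
Lemma fast_cauchy_L2 (h : nat -> T -> R) :
  (forall n, measurable_fun setT (h n)) ->
  (forall n, (\int[mu]_x ((h n.+1 x - h n x) ^+ 2)%:E <= (8 ^- n)%:E)%E) ->
  exists2 g : T -> R, measurable_fun setT g &
    forall n, (\int[mu]_x ((g x - h n x) ^+ 2)%:E <= (8 * 4 ^- n)%:E)%E.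
Proof.
move=> mh dh; pose D k x : \bar R := (4 ^+ k * (h k.+1 x - h k x) ^+ 2)%:E.
have mD k : measurable_fun setT (D k).
  apply/measurable_EFinP; apply: measurable_funM => //.
  by apply: measurable_funX; exact: measurable_funB.
have D0 k x : (0 <= D k x)%E by rewrite lee_fin mulr_ge0 ?sqr_ge0 ?exprn_ge0.
pose G x := (\sum_(0 <= k <oo) D k x)%E.
have mG : measurable_fun setT G by exact: ge0_emeasurable_sum.
have G0 x : (0 <= G x)%E by exact: nneseries_ge0.
have intG : (\int[mu]_x G x <= 2%:E)%E.
  rewrite integral_nneseries//.
  apply: le_trans (@epsilon_trick0 R 2 xpredT _); last by [].
  apply: lee_nneseries => [k _ _|k _]; first by apply: integral_ge0 => x _.
  rewrite (_ : (fun x => D k x) =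
     (fun x => (4 ^+ k)%:E * ((h k.+1 x - h k x) ^+ 2)%:E)%E)//.
  have mS : measurable_fun setT (fun x => ((h k.+1 x - h k x) ^+ 2)%:E).
    by apply/measurable_EFinP; apply: measurable_funX; exact: measurable_funB.
  have S0 x : setT x -> (0 <= ((h k.+1 x - h k x) ^+ 2)%:E)%E.
    by move=> _; rewrite lee_fin sqr_ge0.
  rewrite (ge0_integralZl_EFin mu measurableT S0 mS) ?exprn_ge0//.
  apply: le_trans (lee_wpmul2l _ (dh k)) _; first by rewrite lee_fin exprn_ge0.
  rewrite -EFinM lee_fin natrX -[8]/((4 * 2)%:R) natrM exprMn invfM mulVKf.
    by rewrite exprS invfM mulVKf.
  by rewrite expf_neq0.
(* The upper limit is measurable even where the sequence diverges. Where [G] is infinite the value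
   of [g] is arbitrary and the bound [gG] trivial. *)
pose g x := fine (limn_esup (fun n => (h n x)%:E)).
have mg : measurable_fun setT g.
  apply: (measurableT_comp (fine_measurable _)) => //.
  by apply: measurable_fun_limn_esup => n; exact/measurable_EFinP.
exists g => // n.
have c4 : 0 < 4 * 4 ^- n :> R by rewrite mulr_gt0// invr_gt0 exprn_gt0.
have gG x : (((g x - h n x) ^+ 2)%:E <= (4 * 4 ^- n)%:E * G x)%E.
  have [Gy|] := ltP (G x) +oo%E; last first.
    rewrite leye_eq => /eqP ->; by rewrite gt0_muley ?lte_fin// leey.
  have fG : G x \is a fin_num by rewrite ge0_fin_numE.
  have [|l hl lh] := @fast_cauchy_cvg (fun n => h n x) (fine (G x)).
    move=> k; rewrite -lee_fin fineK//.
    have := @nneseries_lim_ge R (D^~ x) xpredT 0 k.+1 (fun k _ _ => D0 k x).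
    apply: le_trans; rewrite big_nat_recr//= leeDr//.
    exact: sume_ge0.
  have -> : g x = l.
    have hE : (fun k => (h k x)%:E) @ \oo --> l%:E.
      by apply: cvg_EFin => //; exact: nearW.
    by rewrite /g (cvg_limn_einf_sup hE).2.
  by rewrite -[G x]fineK// -EFinM lee_fin; exact: lh.
apply: le_trans (ge0_le_integral _ measurableT _ _ _ (fun x _ => gG x)) _.
- by move=> x _; rewrite lee_fin sqr_ge0.
- apply/measurable_EFinP.
  by apply: measurable_funX; exact: measurable_funB.
- by apply: emeasurable_funM => //; exact: measurable_cst.
have c0 : 0 <= 4 * 4 ^- n :> R by rewrite mulr_ge0// invr_ge0 exprn_ge0.
rewrite ge0_integralZl_EFin//; apply: le_trans (lee_wpmul2l _ intG) _ => //.
by rewrite -EFinM lee_fin le_eqVlt; apply/orP; left; apply/eqP; ring.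
Qed.

End fast_cauchy.

Section L2_complete.
Context d (T : measurableType d) (R : realType) (mu : {measure set T -> \bar R}).
Local Notation dot := (@l2dot d T R mu).
Local Notation sqn := (sqn dot).

Lemma sqn_L2_class (f : L2fun mu) :
  (sqn (L2_class f))%:E = (\int[mu]_x (normsq (f x))%:E)%E.
Proof.
have -> : sqn (L2_class f) = Re (l2dot (L2_class f) (L2_class f)) by [].
rewrite l2dotE /cintegral /=.
rewrite (_ : (fun x => Re (f x * _)) = (fun x => normsq (f x))).
  have [mf fi] := (sqintP mu f).1 (L2funP f).
  by rewrite /Rintegral fineK//; exact: integrable_fin_num.
by apply/funext => x; rewrite conjM_normsq.
Qed.

Lemma sqn_L2_sub (u : L2 mu) (g : L2fun mu) :
  (sqn (L2_class g - u))%:E = (\int[mu]_x (normsq (g x - L2_repr u x))%:E)%E.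
Proof.
rewrite -[in LHS](L2_reprK u) -scaleN1r -L2_classZ -L2_classD sqn_L2_class.
by apply: eq_integral => x _; rewrite L2fun_addE L2fun_scaleE mulN1r.
Qed.

Lemma cmeasurable_L2fun (f : L2fun mu) : cmeasurable f.
Proof. by case: (L2funP f). Qed.

Lemma L2_fast_cauchy (u : nat -> L2 mu) :
  (forall n, sqn (u n.+1 - u n) <= 8 ^- n) ->
  exists v, forall n, sqn (v - u n) <= 16 * 4 ^- n.
Proof.
move=> du; pose f n : T -> R[i] := L2_repr (u n).
have mf n := cmeasurable_L2fun (L2_repr (u n)).
have df n : (\int[mu]_x (normsq (f n.+1 x - f n x))%:E <= (8 ^- n)%:E)%E.
  by rewrite -sqn_L2_sub L2_reprK lee_fin.
have mB (a b : T -> R) : measurable_fun setT a -> measurable_fun setT b ->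
    measurable_fun setT (fun x => ((a x - b x) ^+ 2)%:E).
  move=> ma mb; apply/measurable_EFinP.
  by apply: measurable_funX; exact: measurable_funB.
have nsB (z w : R[i]) : normsq (z - w) = (Re z - Re w) ^+ 2 + (Im z - Im w) ^+ 2.
  by case: z => a b; case: w => c e.
have [g1 mg1 g1P] : exists2 g : T -> R, measurable_fun setT g & forall n,
    (\int[mu]_x ((g x - Re (f n x)) ^+ 2)%:E <= (8 * 4 ^- n)%:E)%E.
  apply: fast_cauchy_L2 => n; first by case: (mf n).
  apply: le_trans (df n); apply: ge0_le_integral => //.
  - by move=> x _; rewrite lee_fin sqr_ge0.
  - by apply: mB; [case: (mf n.+1)|case: (mf n)].
  - under eq_fun do rewrite nsB EFinD.
    by apply: emeasurable_funD; apply: mB; solve [by case: (mf n.+1)|by case: (mf n)].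
  - by move=> x _; rewrite lee_fin nsB lerDl sqr_ge0.
have [g2 mg2 g2P] : exists2 g : T -> R, measurable_fun setT g & forall n,
    (\int[mu]_x ((g x - Im (f n x)) ^+ 2)%:E <= (8 * 4 ^- n)%:E)%E.
  apply: fast_cauchy_L2 => n; first by case: (mf n).
  apply: le_trans (df n); apply: ge0_le_integral => //.
  - by move=> x _; rewrite lee_fin sqr_ge0.
  - by apply: mB; [case: (mf n.+1)|case: (mf n)].
  - under eq_fun do rewrite nsB EFinD.
    by apply: emeasurable_funD; apply: mB; solve [by case: (mf n.+1)|by case: (mf n)].
  - by move=> x _; rewrite lee_fin nsB lerDr sqr_ge0.
pose g x := g1 x +i* g2 x.
have gP n : (\int[mu]_x (normsq (g x - f n x))%:E <= (16 * 4 ^- n)%:E)%E.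
  under eq_integral do rewrite nsB EFinD.
  rewrite ge0_integralD//.
  - apply: le_trans (leeD (g1P n) (g2P n)) _.
    by rewrite -EFinD lee_fin le_eqVlt; apply/orP; left; apply/eqP; ring.
  - by move=> x _; rewrite lee_fin sqr_ge0.
  - by apply: mB => //; case: (mf n).
  - by move=> x _; rewrite lee_fin sqr_ge0.
  - by apply: mB => //; case: (mf n).
have gf0 : square_integrable mu (fun x => g x - f 0%N x).
  split; last exact: le_lt_trans (gP 0%N) (ltry _).
  have := cmeasurableD (f := g) (conj mg1 mg2)
    (cmeasurableM (cmeasurable_cst T (-1 : R[i])) (mf 0%N)).
  by under eq_fun do rewrite mulN1r.
have gS : g \in sqint mu.
  apply/sqint_inP; have := square_integrableZD 1 gf0 (L2funP (L2_repr (u 0%N))).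
  by congr square_integrable; apply/funext => x; rewrite mul1r subrK.
exists (L2_class (MkL2fun gS)) => n.
by rewrite -lee_fin sqn_L2_sub; exact: gP.
Qed.

Lemma L2_complete (F : set_system (L2 mu)) : ProperFilter F -> cauchy F -> cvg F.
Proof.
move=> FF /cauchyP Fc; have nE : forall u : L2 mu, `|u| = sqrtC (dot u u) by [].
have Fs (r : R) : 0 < r ->
    exists2 S, F S & forall u v, S u -> S v -> sqn (u - v) < r.
  move=> r0; pose s := Num.sqrt (r / 4).
  have s0 : 0 < s by rewrite sqrtr_gt0 divr_gt0.
  have s2 : s ^+ 2 = r / 4 by rewrite sqr_sqrtr// divr_ge0// ltW.
  have [|w Fw] := Fc s%:C; first by rewrite ltcR.
  exists (ball w s%:C) => // u v.
  rewrite -ball_normE /ball_ /= !(norm_lt_sqn nE)// s2 => wu wv.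
  apply: le_lt_trans (sqnB_le _ _ w _) _; rewrite (sqnB_sym _ u w).
  by move: wu wv; rewrite /=; lra.
have /choice[S SP] n : exists S, F S /\ forall u v, S u -> S v -> sqn (u - v) < 8 ^- n.
  by have [|S FS Sn] := Fs (8 ^- n); [rewrite invr_gt0 exprn_gt0|exists S].
(* Choosing [u n] in two consecutive sets places [u n] and [u n.+1] both in [S n.+1], without making
   the sets nested. *)
have /choice[u uS] n : exists u, S n u /\ S n.+1 u.
  exact: filter_ex (filterI (SP n).1 (SP n.+1).1).
have [n|v vu] := @L2_fast_cauchy u.
  apply: le_trans (ltW ((SP n.+1).2 _ _ (uS n.+1).1 (uS n).2)) _.
  rewrite exprS invfM ler_piMl ?invr_ge0 ?exprn_ge0//.
  by rewrite invf_le1 ?ler1n.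
apply/cvg_ex; exists v; apply/(sqn_cvgP nE) => eps eps0.
have [n _ nc] := near_infty_natSinv_expn_lt (PosNum (divr_gt0 eps0 (ltr0n R 100))).
have {}nc : 2 ^- n < eps / 100 by have := nc n (leqnn n); rewrite /= div1r.
have n2 : 4 ^- n <= 2 ^- n :> R.
  by rewrite lef_pV2 ?posrE ?exprn_gt0// lerXn2r ?nnegrE// ler_nat.
have n8 : 8 ^- n <= 2 ^- n :> R.
  by rewrite lef_pV2 ?posrE ?exprn_gt0// lerXn2r ?nnegrE// ler_nat.
apply: filterS (SP n).1 => w Sw.
apply: le_lt_trans (sqnB_le _ _ (u n) _) _.
have := vu n; have := (SP n).2 _ _ (uS n).1 Sw; lra.
Qed.

End L2_complete.

(** * Absolutely continuous functions *)

Section absolutely_continuous_variation.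
Context (R : realType).
Implicit Types (h : R -> R).

Definition acont h := forall eps : R, 0 < eps -> exists2 delta : R, 0 < delta &
  forall m (x y : 'I_m -> R), (forall k, x k <= y k) ->
    trivIset setT (fun k => [set` `]x k, y k[]) ->
    \sum_(k < m) (y k - x k) < delta ->
    \sum_(k < m) `|h (y k) - h (x k)| < eps.

(** Absolute continuity for families over any finite type; [acont_variation] indexes by pairs of an
    interval and a cell of its partition. *)
Lemma acont_fin h (eps delta : R) (I : finType) (x y : I -> R) :
  (forall m (x y : 'I_m -> R), (forall k, x k <= y k) ->
    trivIset setT (fun k => [set` `]x k, y k[]) ->
    \sum_(k < m) (y k - x k) < delta ->
    \sum_(k < m) `|h (y k) - h (x k)| < eps) ->
  (forall k, x k <= y k) -> trivIset setT (fun k => [set` `]x k, y k[]) ->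
  \sum_k (y k - x k) < delta -> \sum_k `|h (y k) - h (x k)| < eps.
Proof.
move=> H xy triv.
have E (f : I -> R) : \sum_i f i = \sum_(k < #|I|) f (enum_val k).
  by rewrite (reindex (@enum_val _ xpredT)) //; exact: onW_bij (enum_val_bij _).
rewrite !E; apply: H => // i j _ _ ij.
by apply: enum_val_inj; apply: triv ij.
Qed.

Lemma variation_ord (a b : R) h s :
  variation a b h s =
    \sum_(i < size s) `|h (nth b (a :: s) i.+1) - h (nth b (a :: s) i)|.
Proof. by rewrite /variation big_mkord. Qed.

Lemma itv_partition_length (a b : R) s : itv_partition a b s ->
  \sum_(i < size s) (nth b (a :: s) i.+1 - nth b (a :: s) i) = b - a.
Proof.
move=> abs; rewrite -(big_mkord xpredT (fun i => nth b (a :: s) i.+1 - nth b (a :: s) i)).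
by rewrite telescope_sumr// (itv_partition_nth_size _ abs).
Qed.

Lemma itv_partition_lt (a b : R) s i j : (i < j)%N -> (j <= size s)%N ->
  itv_partition a b s -> nth b (a :: s) i < nth b (a :: s) j.
Proof.
move=> ij js [sa _]; rewrite (lt_sorted_ltn_nth b (s := a :: s))//.
by rewrite inE /= ltnS ltnW// (leq_trans ij).
Qed.

Lemma itv_partition_mono (a b : R) s i j : (i <= j)%N -> (j <= size s)%N ->
  itv_partition a b s -> nth b (a :: s) i <= nth b (a :: s) j.
Proof.
rewrite leq_eqVlt => /predU1P[->//|ij] js abs; apply/ltW.
exact: itv_partition_lt.
Qed.

(** The cells of partitions of disjoint intervals are again disjoint intervals of the same total
    length, so one [delta] controls the sum of the variations. *)
Lemma acont_variation h : acont h -> forall eps : R, 0 < eps ->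
  exists2 delta : R, 0 < delta &
  forall m (x y : 'I_m -> R) (s : 'I_m -> seq R),
    (forall k, itv_partition (x k) (y k) (s k)) ->
    trivIset setT (fun k => [set` `]x k, y k[]) ->
    \sum_(k < m) (y k - x k) < delta ->
    \sum_(k < m) variation (x k) (y k) h (s k) < eps.
Proof.
move=> ach eps /ach[delta delta0 H]; exists delta => // m x y s xys triv xyd.
pose p k i := nth (y k) (x k :: s k) i.
pose I := {k : 'I_m & 'I_(size (s k))}.
have sumE (F : forall k : 'I_m, 'I_(size (s k)) -> R) :
    \sum_(k < m) \sum_(i < size (s k)) F k i = \sum_(t : I) F (tag t) (tagged t).
  exact: (sig_big_dep xpredT (fun _ => xpredT)).
under eq_bigr do rewrite variation_ord.
rewrite sumE.
apply: (@acont_fin h eps delta I (fun t => p (tag t) (tagged t))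
  (fun t => p (tag t) (tagged t).+1)) => //.
- move=> [k i]; apply/ltW/itv_partition_lt => //.
- move=> [k i] [l j] _ _ /= [z []].
  rewrite /= !in_itv /= => /andP[z1 z2] /andP[z3 z4].
  have kl : k = l.
    apply: triv => //; exists z; split; rewrite /= in_itv /=; apply/andP; split.
    + by apply: le_lt_trans z1; apply: itv_partition_nth_ge => //; exact: leqW.
    + apply: lt_le_trans z2 _; apply: itv_partition_nth_le => //.
      by rewrite ltnS.
    + by apply: le_lt_trans z3; apply: itv_partition_nth_ge => //; exact: leqW.
    + apply: lt_le_trans z4 _; apply: itv_partition_nth_le => //.
      by rewrite ltnS.
  rewrite -{l}kl in j z3 z4 *.
  have [ij|ji|/val_inj ->//] := ltngtP i j.
  + have : p k i.+1 <= p k j by apply: itv_partition_mono => //; exact: ltnW.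
    by rewrite leNgt (lt_trans z3 z2).
  + have : p k j.+1 <= p k i by apply: itv_partition_mono => //; exact: ltnW.
    by rewrite leNgt (lt_trans z1 z4).
rewrite -(sumE (fun k i => p k i.+1 - p k i)).
by under eq_bigr do rewrite itv_partition_length//.
Qed.

Lemma trivIset_point1 (x y : 'I_1 -> R) : trivIset setT (fun k => [set` `]x k, y k[]).
Proof. by move=> i j _ _ _; rewrite !ord1. Qed.

(** [a, b] is cut into [N] pieces shorter than the [delta] that belongs to 1, each of variation at
    most 1. *)
Lemma acont_bounded_variation h a b : acont h -> a <= b -> bounded_variation a b h.
Proof.
move=> /acont_variation/(_ _ ltr01)[delta delta0 H] ab.
have small c d : c <= d -> d - c < delta -> bounded_variation c d h.
  move=> cd cdd; exists 1 => _ [s cds <-]; apply: ltW.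
  have := H 1%N (fun=> c) (fun=> d) (fun=> s); rewrite !big_ord1; apply => //.
  exact: trivIset_point1.
pose N := (Num.truncn ((b - a) / delta)).+1.
have N0 : 0 < N%:R :> R by rewrite ltr0n.
have hd : (b - a) / N%:R < delta.
  rewrite ltr_pdivrMr// mulrC -ltr_pdivrMr//.
  by have := truncnS_gt ((b - a) / delta).
have h0 : 0 <= (b - a) / N%:R by rewrite divr_ge0 ?subr_ge0.
have an k : a <= a + k%:R * ((b - a) / N%:R) by rewrite lerDl mulr_ge0.
suff bv n : bounded_variation a (a + n%:R * ((b - a) / N%:R)) h.
  by have := bv N; rewrite mulrC divfK ?gt_eqF// addrC subrK.
elim: n => [|n IH]; first by rewrite mul0r addr0; exact: bounded_variationxx.
have nn : a + n%:R * ((b - a) / N%:R) <= a + n.+1%:R * ((b - a) / N%:R).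
  by rewrite lerD2l ler_wpM2r// ler_nat.
apply/bounded_variationP => //; rewrite (total_variationD _ (an n) nn) fin_numD.
move/bounded_variationP : IH => -> //=.
apply/bounded_variationP => //; apply: small => //.
by rewrite opprD addrACA subrr add0r -mulrBl -natrB// subSnn mul1r.
Qed.

(* Clamping makes the variation function monotone and absolutely continuous
   on the whole line. *)
Definition clamp (a b x : R) : R := Num.max a (Num.min x b).

Lemma clamp_itv a b x : a <= b -> a <= clamp a b x <= b.
Proof. by move=> ab; rewrite /clamp le_max lexx /= ge_max ab ge_min lexx orbT. Qed.

Lemma clamp_id a b x : a <= x <= b -> clamp a b x = x.
Proof.
by move=> /andP[ax xb]; rewrite /clamp min_l// max_r.
Qed.

Lemma clamp_mono a b x y : x <= y -> clamp a b x <= clamp a b y.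
Proof.
rewrite /clamp !maxEle !minEle => xy.
case: (leP x b) => ?; case: (leP y b) => ?; case: (leP a x) => ?;
  case: (leP a y) => ?; case: (leP a b) => ? //; lra.
Qed.

Lemma clamp_contract a b x y : x <= y -> clamp a b y - clamp a b x <= y - x.
Proof.
rewrite /clamp !maxEle !minEle => xy.
case: (leP x b) => ?; case: (leP y b) => ?; case: (leP a x) => ?;
  case: (leP a y) => ?; case: (leP a b) => ? //; lra.
Qed.

Lemma clamp_sub a b x y z : x <= y ->
  clamp a b x < z < clamp a b y -> x < z < y.
Proof.
rewrite /clamp !maxEle !minEle => xy.
case: (leP x b) => ?; case: (leP y b) => ?; case: (leP a x) => ?;
  case: (leP a y) => ?; case: (leP a b) => ? //;
  move=> /andP[? ?]; apply/andP; split; lra.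
Qed.

Definition tvfun h a b x : R := fine (total_variation a (clamp a b x) h).

Lemma tvfun_sub h a b x y : acont h -> a <= b -> x <= y ->
  (tvfun h a b y - tvfun h a b x)%:E =
  total_variation (clamp a b x) (clamp a b y) h.
Proof.
move=> ach ab xy.
have /andP[ax xb] := clamp_itv x ab; have /andP[ay yb] := clamp_itv y ab.
have cxy := clamp_mono a b xy.
have fx : total_variation a (clamp a b x) h \is a fin_num.
  by apply/bounded_variationP => //; exact: acont_bounded_variation.
have fy : total_variation a (clamp a b y) h \is a fin_num.
  by apply/bounded_variationP => //; exact: acont_bounded_variation.
rewrite EFinB /tvfun !fineK// (total_variationD h ax cxy) addeAC.
by rewrite subee// add0e.
Qed.

Lemma tvfun_ge h a b x y : acont h -> a <= b -> x <= y ->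
  `|h (clamp a b y) - h (clamp a b x)| <= tvfun h a b y - tvfun h a b x.
Proof.
move=> ach ab xy; rewrite -lee_fin tvfun_sub//.
exact: total_variation_ge (clamp_mono a b xy).
Qed.

(** The bound is [<= eps] because increments of the variation function are suprema over partitions,
    which keep only the weak inequality. *)
Definition acmono (F : R -> R) := [/\ {homo F : x y / x <= y} &
  forall eps : R, 0 < eps -> exists2 delta : R, 0 < delta &
  forall m (x y : 'I_m -> R), (forall k, x k <= y k) ->
    trivIset setT (fun k => [set` `]x k, y k[]) ->
    \sum_(k < m) (y k - x k) < delta ->
    \sum_(k < m) (F (y k) - F (x k)) <= eps].

Lemma tvfun_acmono h a b : acont h -> a <= b -> acmono (tvfun h a b).
Proof.
move=> ach ab; split=> [x y xy|eps eps0].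
  by rewrite -subr_ge0; apply: le_trans (tvfun_ge ach ab xy).
have [delta delta0 H] := acont_variation ach eps0.
exists delta => // m x y xy triv xyd.
pose cx k := clamp a b (x k); pose cy k := clamp a b (y k).
have cxy k : cx k <= cy k by exact: clamp_mono.
apply/ler_addgt0Pr => e e0.
have em : 0 < e / (m%:R + 1) by rewrite divr_gt0// ltr_wpDl.
(* Partitions whose variation is within e / (m + 1) of the supremum: the total loss over [m]
   intervals is at most e. *)
have /choice[s sP] k : exists s, itv_partition (cx k) (cy k) s /\
    tvfun h a b (y k) - tvfun h a b (x k) <=
      variation (cx k) (cy k) h s + e / (m%:R + 1).
  have := tvfun_sub ach ab (xy k) => tvE.
  have fin : total_variation (cx k) (cy k) h \is a fin_num by rewrite -tvE.
  have [_ [_ [s sp <-] <-]] := ub_ereal_sup_adherent em fin.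
  rewrite -[ereal_sup _]tvE -EFinB lte_fin => h1.
  by exists s; split => //; rewrite -lerBlDr ltW.
apply: le_trans (_ : _ <= \sum_(k < m)
    (variation (cx k) (cy k) h (s k) + e / (m%:R + 1))) _.
  by apply: ler_sum => k _; exact: (sP k).2.
rewrite big_split /= sumr_const card_ord -[X in _ + X]mulr_natl lerD//.
  apply/ltW/H => [k|i j _ _ [z []]|]; first exact: (sP k).1.
    rewrite /= !in_itv /= => z1 z2; apply: triv => //; exists z.
    by split; rewrite /= in_itv; apply: clamp_sub; eauto.
  apply: le_lt_trans xyd; apply: ler_sum => k _; exact: clamp_contract.
rewrite mulrCA ler_piMr ?(ltW e0)// ler_pdivrMr ?mul1r ?lerDl//.
Qed.

(** Together with [tvfun] this is the Jordan decomposition of [h]. An increment of the sum is at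
    most twice that of the variation, hence eps / 2. *)
Lemma acmonoD_tvfun h a b : acont h -> a <= b ->
  acmono (fun x => tvfun h a b x + h (clamp a b x)).
Proof.
move=> ach ab; have [tvm tvac] := tvfun_acmono ach ab; split=> [x y xy|eps eps0].
  have := tvfun_ge ach ab xy; rewrite ler_norml => /andP[h1 h2]; lra.
have [|delta delta0 H] := tvac (eps / 2); first by rewrite divr_gt0.
exists delta => // m x y xy triv xyd.
have : 2 * \sum_(k < m) (tvfun h a b (y k) - tvfun h a b (x k)) <= eps.
  by have := H m x y xy triv xyd; lra.
apply: le_trans; rewrite mulr_sumr; apply: ler_sum => k _.
have := tvfun_ge ach ab (xy k); rewrite ler_norml => /andP[h1 h2]; lra.
Qed.

End absolutely_continuous_variation.

(** * Densities of absolutely continuous functions *)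

Section acmono_density.
Context (R : realType).
Local Notation leb := (@lebesgue_measure R).

Section stieltjes.
Variable F : R -> R.
Hypothesis Fac : acmono F.

Let F_rc : right_continuous F.
Proof.
move=> x; apply/cvgrPdist_lt => eps eps0; have [Fm Fe] := Fac.
have [|delta delta0 H] := Fe (eps / 2); first by rewrite divr_gt0.
have xd : x < x + delta by rewrite ltrDl.
near=> y.
have xy : x <= y by near: y; exact: nbhs_right_ge.
have := H 1%N (fun=> x) (fun=> y) (fun=> xy) (@trivIset_point1 _ _ _).
rewrite !big_ord1 ltrBlDl => /(_ _) h.
rewrite ler0_norm ?opprB ?subr_le0 ?Fm//.
apply: le_lt_trans (h _) _; last by rewrite ltr_pdivrMr// ltr_pMr// ltr1n.
by near: y; exact: nbhs_right_lt.
Unshelve. all: by end_near. Qed.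

Let F_nd : {homo F : x y / x <= y}. Proof. by case: Fac. Qed.

Definition acmono_cumulative : cumulative R R :=
  HB.pack F (isCumulative.Build R _ R F F_nd F_rc).

Local Notation nu := (lebesgue_stieltjes_measure acmono_cumulative).

Lemma stieltjes_itv (x y : R) : x <= y ->
  nu [set` `]x, y]] = (F y - F x)%:E.
Proof.
move=> xy; rewrite /lebesgue_stieltjes_measure /= /measure_extension.
rewrite measurable_mu_extE/=; last exact: is_ocitv.
exact: wlength_itv_bnd.
Qed.

(* A null set lies in a small open set, which is exhausted by finite unions of
   cells of a uniform grid; absolute continuity bounds the Stieltjes measure of
   each such union. *)
Lemma stieltjes_null (a b : R) (A : set R) : a < b ->
  measurable (A : set (measurableTypeR R)) -> leb A = 0%E ->
  nu (A `&` [set` `]a, b]]) = 0%E.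
Proof.
move=> ab mA A0; have [_ Fe] := Fac.
apply/eqP; rewrite eq_le measure_ge0 andbT.
apply/lee_addgt0Pr => eps eps0; rewrite add0e.
have [delta delta0 H] := Fe eps eps0.
have Ay : (leb A < +oo)%E by rewrite A0.
have [U [oU AU Ud]] := lebesgue_regularity_outer mA Ay delta0.
have mU : measurable (U : set (measurableTypeR R)) by exact: open_measurable.
have {}Ud : (leb U < delta%:E)%E.
  apply: le_lt_trans Ud; rewrite -[X in (_ <= X)%E]add0e -A0.
  apply: le_trans (measureU2 _ _ _) => //; last exact: measurableD.
  by apply: le_measure; rewrite ?inE//; [exact: measurableU (measurableD _ _)|rewrite setDUK].
pose w n := (b - a) / n.+1%:R.
have w0 n : 0 < w n by rewrite divr_gt0 ?subr_gt0.
pose x n j := a + j%:R * w n.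
(* Cells not contained in [U] are collapsed to the empty interval ]x, x], so that all cells keep the
   same index type. *)
pose y n j := if `[< [set` `[x n j, x n j.+1]] `<=` U >] then x n j.+1 else x n j.
pose C n j : set (measurableTypeR R) := [set` `]x n j, y n j]].
have xS n j : x n j <= x n j.+1 by rewrite /x lerD2l ler_pM2r// ler_nat.
have xy n j : x n j <= y n j by rewrite /y; case: ifP.
have yx n j : y n j <= x n j.+1 by rewrite /y; case: ifP.
have xmono n i j : (i <= j)%N -> x n i <= x n j.
  by move=> ij; rewrite /x lerD2l ler_pM2r// ler_nat.
have mC n j : measurable (C n j) by exact: measurable_itv.
have tC n : trivIset setT (C n).
  move=> i j _ _ [z []]; rewrite /C /= !in_itv /= => /andP[i1 i2] /andP[j1 j2].
  have [ij|ij|//] := ltngtP i j.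
    by have := lt_le_trans (lt_le_trans j1 i2) (le_trans (yx n i) (xmono n _ _ ij)); rewrite ltxx.
  by have := lt_le_trans (lt_le_trans i1 j2) (le_trans (yx n j) (xmono n _ _ ij)); rewrite ltxx.
pose UU n : set (measurableTypeR R) := \big[setU/set0]_(j < n.+1) C n j.
have mUU n : measurable (UU n) by exact: bigsetU_measurable.
have UUU n : UU n `<=` U.
  rewrite /UU -bigcup_mkord => z [j _]; rewrite /C /y /=; case: asboolP => [+ zj|_].
    by apply; move: zj; rewrite /= !in_itv /= => /andP[/ltW -> ->].
  by rewrite in_itv /= => /andP[h1 h2]; move: (lt_le_trans h1 h2); rewrite ltxx.
have len n : \sum_(j < n.+1) (y n j - x n j) < delta.
  rewrite -lte_fin; apply: le_lt_trans Ud; rewrite -sumEFin.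
  rewrite (eq_bigr (fun j : 'I_n.+1 => leb (C n j))) => [|j _]; last first.
    rewrite /C lebesgue_measure_itv /= lte_fin -EFinB; case: ltP => // h.
    by have -> : y n j = x n j; [apply/eqP; rewrite eq_le h xy|rewrite subrr].
  rewrite -(measure_bigsetU _ (mC n) (tC n)).
  by apply: le_measure; [rewrite inE; exact: mUU|rewrite inE|exact: UUU].
have nuUU n : (nu (UU n) <= eps%:E)%E.
  apply: le_trans (Boole_inequality _ (fun i _ => mC n i)) _.
  rewrite (eq_bigr (fun j : 'I_n.+1 => (F (y n j) - F (x n j))%:E)) => [|j _].
    rewrite sumEFin lee_fin.
    apply: (H _ (fun j : 'I_n.+1 => x n j) (fun j : 'I_n.+1 => y n j)) => //.
    move=> i j _ _ [z []]; rewrite /= !in_itv /= => /andP[i1 i2] /andP[j1 j2].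
    apply/val_inj/(tC n) => //; exists z.
    by rewrite /C /= !in_itv /= i1 j1 !ltW.
  exact: stieltjes_itv.
(* The grids are not nested and the [UU n] need not increase; their tail intersections do, and each
   point of [A] in ]a, b] lies in one of them. *)
pose W n : set (measurableTypeR R) := \bigcap_(m in [set m | (n <= m)%N]) UU m.
have mW n : measurable (W n) by exact: bigcap_measurableType.
have AW : A `&` [set` `]a, b]] `<=` \bigcup_n W n.
  move=> z [/AU Uz]; rewrite /= in_itv /= => /andP[az zb].
  have /nbhs_ballP[r /= r0 rU] := open_nbhs_nbhs (conj oU Uz).
  have r1 : 0 < r / (b - a) by rewrite divr_gt0// subr_gt0.
  have [N _ Nr] := near_infty_natSinv_lt (PosNum r1).
  exists N => // m /= Nm.
  have wr : w m < r.
    by have := Nr m Nm; rewrite /= ltr_pdivlMr ?subr_gt0// mulrC.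
  (* The first grid point not before [z] closes the cell that contains [z]; this cell, shorter than
     [r], lies in [U]. *)
  have exk : exists k, z <= x m k.
    exists m.+1; apply: le_trans zb _.
    by rewrite /x /w mulrC divfK// addrC subrK.
  pose k := ex_minn exk.
  have [zk kmin] : z <= x m k /\ forall l, z <= x m l -> (k <= l)%N.
    by rewrite /k; case: ex_minnP.
  have [k0|[j kj]] : k = 0%N \/ exists j, k = j.+1.
    by case: (k) => [|j]; [left|right; exists j].
  - by move: zk; rewrite k0 /x mul0r addr0 leNgt az.
  have xz : x m j < z.
    by rewrite ltNge; apply/negP => /kmin; rewrite kj ltnn.
  have jm : (j < m.+1)%N.
    rewrite -ltnS -kj; apply: leq_ltn_trans (kmin m.+1 _) _ => //.
    apply: le_trans zb _.
    by rewrite /x /w mulrC divfK// addrC subrK.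
  rewrite /UU -bigcup_mkord; exists j => //.
  rewrite kj in zk; rewrite /C /= in_itv /= xz /= /y; case: asboolP => //.
  case=> t; rewrite /= in_itv /= => /andP[t1 t2]; apply: rU.
  have xw : x m j.+1 = x m j + w m by rewrite /x -natr1 mulrDl mul1r addrA.
  rewrite /ball /= ltr_norml; apply/andP; split; lra.
have mAD : measurable ((A `&` [set` `]a, b]]) : set (measurableTypeR R)).
  by apply: measurableI => //; exact: measurable_itv.
have mWW : measurable (\bigcup_n W n) by exact: bigcupT_measurable.
apply: (@le_trans _ _ (nu (\bigcup_n W n))).
  by apply: le_measure => //; rewrite inE.
have Wc : (nu \o W) @ \oo --> nu (\bigcup_n W n).
  apply: nondecreasing_cvg_mu => // i j ij; apply/subsetPset => z Wz m /= jm.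
  by apply: Wz; exact: leq_trans jm.
rewrite -(cvg_lim _ Wc)//; apply: lime_le; first by apply/cvg_ex; exists (nu (\bigcup_n W n)).
apply: nearW => n /=; apply: le_trans (nuUU n); rewrite le_measure ?inE//.
by apply: bigcap_inf => /=.
Qed.

(** The density is the Radon-Nikodym derivative of the Stieltjes measure; restriction to ]a, b]
    makes that measure finite. *)
Lemma acmono_density (a b : R) : a < b -> exists2 g : R -> R,
  leb.-integrable setT (EFin \o g) &
  forall x, a <= x <= b -> F x - F a = (\int[leb]_(t in [set` `]a, x]]) g t)%R.
Proof.
move=> ab.
have mD : measurable ([set` `]a, b]] : set (measurableTypeR R)) by exact: measurable_itv.
have fin : (nu [set` `]a, b]] < +oo)%E by rewrite stieltjes_itv ?ltry// ltW.
pose nu' : {finite_measure set (measurableTypeR R) -> \bar R} := mfrestr mD fin.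
have dom : nu' `<< (leb : {measure set (measurableTypeR R) -> \bar R}).
  apply/null_content_dominatesP => A mA A0; exact: stieltjes_null.
have [f [f0 ffin fint fE]] := radon_nikodym_sigma_finite dom.
exists (fine \o f).
  by apply: eq_integrable fint => // x _; rewrite /= fineK.
move=> x /andP[ax xb]; apply/EFin_inj.
rewrite /Rintegral; under eq_integral do rewrite /= fineK//.
rewrite -fE; last exact: measurable_itv.
rewrite /nu' /= /mfrestr /mrestr setIidl; last first.
  by apply: subset_itvl; rewrite bnd_simp.
by rewrite stieltjes_itv.
Qed.
End stieltjes.

Lemma acont_density (h : R -> R) (a b : R) : a < b -> acont h -> exists2 g : R -> R,
  leb.-integrable setT (EFin \o g) &
  forall x, a <= x <= b -> h x = h a + (\int[leb]_(t in [set` `]a, x]]) g t)%R.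
Proof.
move=> ab ach; have ab' := ltW ab.
have [g1 ig1 g1E] := acmono_density (tvfun_acmono ach ab') ab.
have [g2 ig2 g2E] := acmono_density (acmonoD_tvfun ach ab') ab.
exists (fun x => g2 x - g1 x) => [|x axb].
  rewrite (_ : _ \o _ = (EFin \o g2) \- (EFin \o g1))%E; first exact: integrableB.
  by apply/funext => x.
have mI : measurable ([set` `]a, x]] : set (measurableTypeR R)) by exact: measurable_itv.
rewrite RintegralB//=; last 2 first.
- exact: integrableS ig2.
- exact: integrableS ig1.
rewrite -g1E// -g2E// (clamp_id axb) clamp_id ?lexx//; ring.
Qed.

(** At a Lebesgue point of [g] its primitive has derivative [g], and near an interior point [h] is
    that primitive plus a constant. *)
Lemma acont_ftc (h : R -> R) (a b : R) : a < b -> acont h -> exists2 g : R -> R,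
  leb.-integrable setT (EFin \o g) &
  (forall x, a <= x <= b -> h x = h a + (\int[leb]_(t in [set` `]a, x]]) g t)%R) /\
  {ae leb, forall x, a < x < b -> derivable h x 1 /\ derive1 h x = g x}.
Proof.
move=> ab ach; have [g ig gE] := acont_density ab ach; exists g => //; split=> //.
have lg : locally_integrable [set: R] g by apply: open_integrable_locally; first exact: openT.
have := lebesgue_differentiation lg.
apply: filterS; first exact: (ae_filter_ringOfSetsType leb).
move=> x gx /andP[ax xb].
have igab : leb.-integrable [set` `]a, b]] (EFin \o g).
  by apply: integrableS ig => //; exact: measurable_itv.
have [] := @FTC1_lebesgue_pt R g (BRight a) x b xb igab _ gx.
  by rewrite lte_fin.
set G := (fun y => _) => dG GE.
have nG : \forall y \near x, h a + G y = h y.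
  near=> y; have yab : a <= y <= b.
    apply/andP; split; near: y; first exact: lt_le_nbhsr.
    exact: lt_le_nbhsl.
  by rewrite (gE y yab).
have : is_derive x (1 : R) (cst (h a) + G) (g x).
  rewrite -[g x]add0r; apply: is_deriveD; rewrite -GE derive1E; exact/derivableP.
move=> /(near_eq_is_derive nG) [hd hv]; split=> //.
by rewrite derive1E.
Unshelve. all: by end_near. Qed.

End acmono_density.

(** * A smooth step *)

Section smooth_functions.
Context (R : realType).
Implicit Types (f g : R -> R) (p : {poly R}).

(** Unlike [smooth], which speaks of iterated [derive1], this carries the derivatives as witnesses,
    so that stability under products, inverses and affine substitutions is a plain induction. *)
Fixpoint ndiff (k : nat) f : Prop :=
  if k is k'.+1 then
    exists2 f' : R -> R, (forall x : R, is_derive x (1 : R) f (f' x)) & ndiff k' f'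
  else True.

Lemma is_derive1E f f' (x : R) : is_derive x (1 : R) f (f' x) ->
  derivable f x 1 /\ derive1 f x = f' x.
Proof. by move=> [h1 h2]; split=> //; rewrite derive1E. Qed.

Lemma ndiff_smooth f : (forall k, ndiff k f) -> smooth f.
Proof.
move=> fk k; move: {fk}(fk k.+1); elim: k f => [|k IH] f [f' ff' kf'] x.
  by have [] := is_derive1E (ff' x).
rewrite derive1Sn.
have -> : derive1 f = f' by apply/funext => y; have [] := is_derive1E (ff' y).
exact: IH kf' x.
Qed.

Lemma ndiffW k f : ndiff k.+1 f -> ndiff k f.
Proof. by elim: k f => [//|k IH] f [f' ff' /IH kf']; exists f'. Qed.

Lemma ndiff_cst k (c : R) : ndiff k (fun=> c).
Proof.
elim: k c => [//|k IH] c; exists (fun=> 0) => // x; exact: is_derive_cst.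
Qed.

Lemma ndiffD k f g : ndiff k f -> ndiff k g -> ndiff k (fun x => f x + g x).
Proof.
elim: k f g => [//|k IH] f g [f' ff' kf'] [g' gg' kg'].
exists (fun x => f' x + g' x) => [x|]; last exact: IH.
exact: is_deriveD.
Qed.

Lemma ndiffM k f g : ndiff k f -> ndiff k g -> ndiff k (fun x => f x * g x).
Proof.
elim: k f g => [//|k IH] f g fk gk.
have [f' ff' kf'] := fk; have [g' gg' kg'] := gk.
exists (fun x => f x * g' x + g x * f' x) => [x|].
  exact: is_deriveM.
by apply: ndiffD; apply: IH => //; exact: ndiffW.
Qed.

Lemma ndiffV k f : (forall x, f x != 0) -> ndiff k f -> ndiff k (fun x => (f x)^-1).
Proof.
move=> f0; elim: k => [//|k IH] fk.
have [f' ff' kf'] := fk.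
exists (fun x => -1 * ((f x)^-1 * (f x)^-1) * f' x) => [x|].
  apply: is_derive_eq (is_deriveV (f0 x) (ff' x)) _.
  by rewrite mulN1r expr2 invfM.
have kV := IH (ndiffW fk).
by do !apply: ndiffM => //; exact: ndiff_cst.
Qed.

Lemma ndiff_affine k f (c d : R) : ndiff k f -> ndiff k (fun x => f (c * x + d)).
Proof.
elim: k f => [//|k IH] f [f' ff' kf'].
exists (fun x => f' (c * x + d) * c) => [x|]; last first.
  by apply: ndiffM; [exact: IH|exact: ndiff_cst].
have h : is_derive x (1 : R) (fun x => c * x + d) c.
  have h := is_derive_poly (c *: 'X + d%:P) x.
  rewrite derivD derivZ derivX derivC addr0 hornerZ hornerC mulr1 in h.
  rewrite [X in is_derive _ _ X _](_ : _ = horner (c *: 'X + d%:P))//.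
  by apply/funext => y; rewrite !hornerE.
exact: (is_derive1_comp (f := f) (g := fun x => c * x + d) (ff' _) h).
Qed.

Lemma expR_exprn_bound (m : nat) (y : R) : 0 < y -> y ^+ m * expR (- y) <= m`!%:R.
Proof.
move=> y0; rewrite expRN ler_pdivrMr ?expR_gt0//.
rewrite mulrC -ler_pdivrMr ?ltr0n ?fact_gt0//.
case: m => [|m].
  by rewrite expr0 fact0 divr1 (le_trans _ (expR_ge1Dx y))// lerDl ltW.
by apply: le_trans (expR_ge1Dxn m (ltW y0)); rewrite lerDr.
Qed.

(** The spare power y^m becomes, at y = 1 / x, a bound C x^m that flattens [expinv p] at 0. *)
Lemma horner_expR_bound p (m : nat) : exists2 C : R, 0 <= C &
  forall y, 0 < y -> `|p.[y]| * y ^+ m * expR (- y) <= C.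
Proof.
elim/poly_ind: p m => [|p c IH] m.
  by exists 0 => // y _; rewrite horner0 normr0 !mul0r.
have [C C0 H] := IH m.+1; exists (C + `|c| * m`!%:R) => [|y y0].
  by rewrite addr_ge0// mulr_ge0.
rewrite hornerMXaddC.
apply: le_trans (_ : _ <= (`|p.[y] * y| + `|c|) * y ^+ m * expR (- y)) _.
  by rewrite ler_wpM2r ?expR_ge0// ler_wpM2r ?exprn_ge0 ?(ltW y0)// ler_normD.
rewrite !mulrDl lerD//; last by rewrite -mulrA ler_wpM2l// expR_exprn_bound.
by rewrite normrM (gtr0_norm y0) -[_ * y * _]mulrA -exprS; exact: H.
Qed.

(* The family of functions [p (1 / x) exp (- 1 / x)], extended by 0 to the left
   of 0, is stable under differentiation. *)
Definition expinv p (x : R) : R := if 0 < x then p.[x^-1] * expR (- x^-1) else 0.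

Lemma is_derive_expinv p (x : R) :
  is_derive x (1 : R) (expinv p) (expinv ('X^2 * (p - p^`())) x).
Proof.
have [x0|x0|->] := ltgtP x 0.
- rewrite {2}/expinv ltNge (ltW x0) /=.
  have nE : \forall y \near x, cst 0 y = expinv p y.
    near=> y; rewrite /expinv ltNge; suff -> : y <= 0 by [].
    by near: y; exact: lt_le_nbhsl.
  exact: near_eq_is_derive nE (is_derive_cst _ _ _).
- have xn0 : x != 0 by rewrite gt_eqF.
  rewrite {2}/expinv x0.
  have nE : \forall y \near x, p.[y^-1] * expR (- y^-1) = expinv p y.
    near=> y; rewrite /expinv; suff -> : 0 < y by [].
    by near: y; exact: lt_nbhsr.
  apply: (near_eq_is_derive nE).
  have hV : is_derive x (1 : R) (fun y : R => y^-1) (- x ^- 2).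
    apply: is_derive_eq; first exact: is_deriveV.
    by rewrite [_ *: _]mulr1.
  have hp : is_derive x (1 : R) (fun y : R => p.[y^-1]) (p^`().[x^-1] * - x ^- 2).
    exact: (is_derive1_comp (f := horner p)).
  have hN : is_derive x (1 : R) (fun y : R => - y^-1) (x ^- 2).
    by apply: is_derive_eq (is_deriveN hV) _; rewrite opprK.
  have he : is_derive x (1 : R) (fun y : R => expR (- y^-1)) (expR (- x^-1) * x ^- 2).
    exact: (is_derive1_comp (f := expR)).
  apply: is_derive_eq (is_deriveM hp he) _.
  rewrite hornerM hornerD hornerN hornerXn /GRing.scale /= exprVn; ring.
- rewrite {2}/expinv ltxx.
  (* At 0 the quadratic bound |expinv p y| <= C y^2 makes the difference quotient tend to 0. *)
  have [C C0 H] := horner_expR_bound p 2.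
  have bnd y : `|expinv p y| <= C * y ^+ 2.
    rewrite /expinv; case: ifPn => y0; last by rewrite normr0 mulr_ge0 ?sqr_ge0.
    rewrite normrM (ger0_norm (expR_ge0 _)).
    have yV : 0 < y^-1 by rewrite invr_gt0.
    by have := H _ yV; rewrite exprVn mulrAC ler_pdivrMr ?exprn_gt0.
  suff lim0 : h^-1 *: ((expinv p \o shift 0) (h *: 1) - expinv p 0) @[h --> 0^'] --> (0 : R).
    apply: DeriveDef; first by apply/cvg_ex; exists 0.
    exact: cvg_lim lim0.
  apply/cvgrPdist_lt => eps eps0; near=> h.
  have h0 : h != 0 by near: h; exact: nbhs_dnbhs_neq.
  rewrite /= sub0r normrN {2}/expinv ltxx subr0 addr0 [h *: 1]mulr1.
  rewrite normrM normfV ltr_pdivrMl ?normr_gt0//.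
  apply: le_lt_trans (bnd h) _; rewrite -[h ^+ 2]real_normK ?num_real// expr2 mulrCA.
  rewrite ltr_pM2l ?normr_gt0//.
  apply: le_lt_trans (_ : _ <= (C + 1) * `|h|) _; first by rewrite ler_wpM2r// lerDl.
  rewrite -ltr_pdivlMl ?ltr_wpDl// mulrC.
  near: h; apply: dnbhs0_lt; by rewrite divr_gt0// ltr_wpDl.
Unshelve. all: by end_near. Qed.

Lemma ndiff_expinv k p : ndiff k (expinv p).
Proof.
elim: k p => [//|k IH] p.
by exists (expinv ('X^2 * (p - p^`()))); first exact: is_derive_expinv.
Qed.

Lemma expinv1_gt0 (x : R) : 0 < x -> 0 < expinv 1 x.
Proof. by move=> x0; rewrite /expinv x0 hornerC mul1r expR_gt0. Qed.

Lemma expinv1_ge0 (x : R) : 0 <= expinv 1 x.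
Proof. by rewrite /expinv; case: ifP => // _; rewrite hornerC mul1r expR_ge0. Qed.

(** The usual transition function f(x) / (f(x) + f(1 - x)) with f(x) = exp(-1 / x) for x > 0; 1 - x
    is spelled as an affine map to suit [ndiff_affine]. *)
Definition smooth_step (x : R) : R :=
  expinv 1 x * (expinv 1 x + expinv 1 (-1 * x + 1))^-1.

Lemma smooth_step_den (x : R) : 0 < expinv 1 x + expinv 1 (-1 * x + 1).
Proof.
have [x0|x0] := ltP 0 x; first by rewrite ltr_pwDl ?expinv1_gt0 ?expinv1_ge0.
rewrite ltr_wpDl ?expinv1_ge0 ?expinv1_gt0//; lra.
Qed.

Lemma ndiff_smooth_step k : ndiff k smooth_step.
Proof.
apply: ndiffM; first exact: ndiff_expinv.
apply: ndiffV => [x|]; first by rewrite gt_eqF// smooth_step_den.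
by apply: ndiffD; [|apply: ndiff_affine]; exact: ndiff_expinv.
Qed.

Lemma smooth_step0 (x : R) : x <= 0 -> smooth_step x = 0.
Proof. by move=> x0; rewrite /smooth_step {1}/expinv ltNge x0 mul0r. Qed.

Lemma smooth_step1 (x : R) : 1 <= x -> smooth_step x = 1.
Proof.
move=> x1; have d0 := smooth_step_den x; move: d0; rewrite /smooth_step.
have -> : expinv 1 (-1 * x + 1) = 0.
  by rewrite /expinv ltNge (_ : _ <= 0)//; lra.
by rewrite addr0 => /gt_eqF/negbT h; rewrite mulfV.
Qed.

Lemma smooth_step_itv (x : R) : 0 <= smooth_step x <= 1.
Proof.
rewrite /smooth_step mulr_ge0 ?expinv1_ge0//=; last first.
  by rewrite invr_ge0 ltW// smooth_step_den.
by rewrite ler_pdivrMr ?smooth_step_den// mul1r lerDl expinv1_ge0.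
Qed.

Lemma smooth_step_derivable (x : R) : derivable smooth_step x 1.
Proof. by have [f' /(_ x)[]] := ndiff_smooth_step 1. Qed.

Lemma smooth_step_derive_continuous : continuous (derive1 smooth_step).
Proof.
have [f' ff' [f'' ff'' _]] := ndiff_smooth_step 2.
have -> : derive1 smooth_step = f'.
  by apply/funext => y; have [] := is_derive1E (ff' y).
by move=> x; apply: differentiable_continuous; apply/derivable1_diffP; case: (ff'' x).
Qed.

Lemma smooth_step_derive0 (x : R) : x < 0 \/ 1 < x -> derive1 smooth_step x = 0.
Proof.
case=> x0; rewrite derive1E.
  have nE : \forall y \near x, cst 0 y = smooth_step y.
    by near=> y; rewrite smooth_step0//; near: y; exact: lt_le_nbhsl.
  have hd : is_derive x (1 : R) smooth_step 0.
    exact: near_eq_is_derive nE (is_derive_cst _ _ _).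
  by case: hd.
have nE : \forall y \near x, cst 1 y = smooth_step y.
  by near=> y; rewrite smooth_step1//; near: y; exact: lt_le_nbhsr.
have hd : is_derive x (1 : R) smooth_step 0.
  exact: near_eq_is_derive nE (is_derive_cst _ _ _).
by case: hd.
Unshelve. all: by end_near. Qed.

Lemma smooth_step_derive_bounded :
  exists2 M : R, 0 <= M & forall x : R, `|derive1 smooth_step x| <= M.
Proof.
have [|c _ cmax] := @EVT_max R (fun x => `|derive1 smooth_step x|) 0 1 ler01.
  apply: continuous_subspaceT => x; apply: cvg_norm.
  exact: smooth_step_derive_continuous.
exists `|derive1 smooth_step c| => [|x]; first exact: normr_ge0.
have [x0|x0] := ltP x 0; first by rewrite smooth_step_derive0 ?normr0//; left.
have [x1|x1] := ltP 1 x; first by rewrite smooth_step_derive0 ?normr0//; right.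
by apply: cmax; rewrite in_itv /= x0.
Qed.

End smooth_functions.

(** * Integration by parts *)

Section absolutely_continuous_parts.
Context (R : realType).
Local Notation leb := (@lebesgue_measure R).
Implicit Types (h g : R -> R).

Definition acont_on (J : set R) h := forall eps : R, 0 < eps ->
  exists2 delta : R, 0 < delta &
  forall m (x y : 'I_m -> R), (forall k, [/\ x k <= y k, J (x k) & J (y k)]) ->
    trivIset setT (fun k => [set` `]x k, y k[]) ->
    \sum_(k < m) (y k - x k) < delta ->
    \sum_(k < m) `|h (y k) - h (x k)| < eps.

Lemma normC_ReIm (z : R[i]) : `|Re z|%:C <= `|z| /\ `|Im z|%:C <= `|z|.
Proof.
case: z => a b; rewrite normc_def /= !lecR -!sqrtr_sqr !ler_sqrt ?addr_ge0 ?sqr_ge0//.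
by rewrite lerDl lerDr !sqr_ge0.
Qed.

Lemma acont_on_ReIm (J : set R) (f : R -> R[i]) : absolutely_continuous_on J f ->
  acont_on J (fun x => Re (f x)) /\ acont_on J (fun x => Im (f x)).
Proof.
move=> acf; split=> eps /acf[delta delta0 H]; exists delta => // m x y xy t d.
  rewrite -ltcR rmorph_sum/=; apply: le_lt_trans (H m x y xy t d).
  apply: ler_sum => k _; apply: le_trans (normC_ReIm _).1.
  by rewrite ReD; case: (f (x k)).
rewrite -ltcR rmorph_sum/=; apply: le_lt_trans (H m x y xy t d).
apply: ler_sum => k _; apply: le_trans (normC_ReIm _).2.
by rewrite ImD; case: (f (x k)).
Qed.

Lemma acont_clamp (J : set R) h (a b : R) : a <= b -> acont_on J h ->
  (forall x, a <= x <= b -> J x) -> acont (h \o clamp a b).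
Proof.
move=> ab ach abJ eps /ach[delta delta0 H]; exists delta => // m x y xy triv xyd.
apply: H.
- move=> k; split; [exact: clamp_mono|exact: abJ (clamp_itv _ ab)..].
- move=> i j _ _ [z []]; rewrite /= !in_itv /= => z1 z2; apply: triv => //; exists z.
  by split; rewrite /= in_itv /=; apply: clamp_sub; eauto.
- by apply: le_lt_trans xyd; apply: ler_sum => k _; exact: clamp_contract.
Qed.

Lemma lipschitz_acont_on (J : set R) h (K : R) :
  (forall x y, J x -> J y -> x <= y -> `|h y - h x| <= K * (y - x)) -> acont_on J h.
Proof.
move=> hK eps eps0; exists (eps / (`|K| + 1)); first by rewrite divr_gt0// ltr_wpDl.
move=> m x y xy _ d.
apply: le_lt_trans (_ : _ <= (`|K| + 1) * \sum_(k < m) (y k - x k)) _.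
  rewrite mulr_sumr; apply: ler_sum => k _; have [xy' Jx Jy] := xy k.
  apply: le_trans (hK _ _ Jx Jy xy') _; rewrite ler_wpM2r ?subr_ge0//.
  by rewrite (le_trans (ler_norm K))// lerDl.
by rewrite mulrC -ltr_pdivlMr// ltr_wpDl.
Qed.

Lemma acont_clamp_bounded h (a b : R) : a <= b -> acont (h \o clamp a b) ->
  exists2 M : R, 0 <= M & forall x, `|h (clamp a b x)| <= M.
Proof.
move=> ab ach; pose k := h \o clamp a b.
have kE x : k (clamp a b x) = k x by rewrite /k /= (clamp_id (clamp_itv _ ab)).
have Tm := (tvfun_acmono ach ab).1.
exists (`|k a| + (tvfun k a b b - tvfun k a b a)).
  by rewrite addr_ge0// subr_ge0 Tm.
move=> x; rewrite -[h _]/(k x) -(kE x); have /andP[ax xb] := clamp_itv x ab.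
have := tvfun_ge ach ab ax; rewrite -/k !kE => d.
rewrite -[k _](subrK (k a)) addrC (le_trans (ler_normD _ _))// lerD2l.
by rewrite (le_trans d)// lerD2r Tm.
Qed.

Lemma acontM h g (a b : R) : a <= b -> acont (h \o clamp a b) -> acont (g \o clamp a b) ->
  acont ((fun x => h x * g x) \o clamp a b).
Proof.
move=> ab ach acg eps eps0.
have [M M0 hM] := acont_clamp_bounded ab ach.
have [N N0 gN] := acont_clamp_bounded ab acg.
have e1 : 0 < eps / 2 / (N + 1) by rewrite !divr_gt0// ltr_wpDl.
have e2 : 0 < eps / 2 / (M + 1) by rewrite !divr_gt0// ltr_wpDl.
have [d1 d10 H1] := ach _ e1; have [d2 d20 H2] := acg _ e2.
exists (Num.min d1 d2); first by rewrite lt_min d10.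
move=> m x y xy triv; rewrite lt_min => /andP[xd1 xd2].
have := H1 m x y xy triv xd1; have := H2 m x y xy triv xd2 => /=.
set S2 := \sum_(k < m) _; set S1 := \sum_(k < m) _ => h2 h1.
apply: le_lt_trans (_ : _ <= (N + 1) * S1 + (M + 1) * S2) _.
  rewrite /S1 /S2 !mulr_sumr -big_split /=; apply: ler_sum => k _.
  set cx := clamp a b (x k); set cy := clamp a b (y k).
  have -> : h cy * g cy - h cx * g cx = g cy * (h cy - h cx) + h cx * (g cy - g cx).
    by ring.
  apply: le_trans (ler_normD _ _) _; rewrite !normrM lerD// ler_wpM2r//.
    by apply: le_trans (gN (y k)) _; rewrite lerDl.
  by apply: le_trans (hM (x k)) _; rewrite lerDl.
have -> : eps = (N + 1) * (eps / 2 / (N + 1)) + (M + 1) * (eps / 2 / (M + 1)).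
  by field; rewrite !gt_eqF ?ltr_wpDl.
by rewrite ltrD// ltr_pM2l// ltr_wpDl.
Qed.

Lemma is_derive_near_eq (f k : R -> R) (x d : R) : (\forall y \near x, f y = k y) ->
  derivable f x 1 /\ derive1 f x = d -> derivable k x 1 /\ derive1 k x = d.
Proof.
move=> fk [f1 f2]; have h : is_derive x (1 : R) f d.
  by apply: DeriveDef => //; rewrite -derive1E.
have [k1 k2] := near_eq_is_derive fk h.
by split=> //; rewrite derive1E.
Qed.

(* On compact subintervals [h g] is the integral of [V g + U g'], so the
   difference of the two is constant on [`]a, b[]; the limits at [a] and [b]
   then give the value of the integral. *)
Lemma acont_parts h g (dg : R -> R) (U V : R -> R) (a b : R) : a < b ->
  acont_on [set` `]a, b[] h ->
  h x @[x --> a^'+] --> (0 : R) -> h x @[x --> b^'-] --> (0 : R) ->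
  (forall x, is_derive x (1 : R) g (dg x)) -> continuous dg ->
  (exists K : R, forall x, `|g x| <= K /\ `|dg x| <= K) ->
  leb.-integrable setT (EFin \o U) -> leb.-integrable setT (EFin \o V) ->
  {ae leb, forall x, a < x < b -> U x = h x /\ V x = derive1 h x} ->
  (\int[leb]_(x in [set` `]a, b[]) (V x * g x + U x * dg x) = 0)%R.
Proof.
move=> ab ach ha hb gdg cdg [K gK] iU iV UV.
have cg : continuous g.
  by move=> x; apply: differentiable_continuous; apply/derivable1_diffP; case: (gdg x).
have bnd (k : R -> R) : (forall x, `|k x| <= K) -> [bounded k x | x in setT].
  move=> kK; exists K; split; first exact: num_real.
  by move=> y Ky x _ /=; rewrite (le_trans (kK x))// ltW.
pose Phi x := V x * g x + U x * dg x.
have iPhi : leb.-integrable setT (EFin \o Phi).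
  rewrite (_ : _ \o _ = (EFin \o V) \* (EFin \o g) \+ (EFin \o U) \* (EFin \o dg))%E.
    apply: integrableD => //.
      apply: integrableMl => //; first exact: continuous_measurable_fun.
      by apply: bnd => x; case: (gK x).
    apply: integrableMl => //; first exact: continuous_measurable_fun.
    by apply: bnd => x; case: (gK x).
  by apply/funext => x.
have iPhiJ (J : set R) : measurable (J : set (measurableTypeR R)) ->
    leb.-integrable J (EFin \o Phi).
  by move=> mJ; apply: integrableS iPhi.
pose P x := (\int[leb]_(t in [set` `[a, x]]) Phi t)%R.
(* At [a] and [b] only one-sided limits of [h] are known, hence the strict inclusion. Clamped to
   [a', b'], [h] and [g] are absolutely continuous on the whole line, and [acont_ftc] applies to
   their product. *)
have key a' b' : a < a' -> a' < b' -> b' < b ->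
    h b' * g b' - h a' * g a' = P b' - P a'.
  move=> aa' a'b' b'b; have a'b'W := ltW a'b'.
  have inJ x : a' <= x <= b' -> [set` `]a, b[] x.
    move=> /andP[h1 h2]; rewrite /= in_itv /= (lt_le_trans aa')//=.
    exact: le_lt_trans b'b.
  have ach' := acont_clamp a'b'W ach inJ.
  have acg' : acont (g \o clamp a' b').
    apply: (@acont_clamp setT) => //; apply: (@lipschitz_acont_on _ _ K) => x y _ _ xy.
    have [|c _ ->] := @MVT_segment R g dg x y xy (fun z _ => gdg z).
      exact: continuous_subspaceT.
    rewrite normrM (ger0_norm (_ : 0 <= y - x)) ?subr_ge0// ler_wpM2r ?subr_ge0//.
    by case: (gK c).
  have [w iw [wE wd]] := acont_ftc a'b' (acontM a'b'W ach' acg').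
  have [w' iw' [_ wd']] := acont_ftc a'b' ach'.
  have clampn x : a' < x < b' -> \forall y \near x, clamp a' b' y = y.
    move=> /andP[h1 h2]; near=> y; apply: clamp_id; apply/andP; split; near: y.
      exact: lt_le_nbhsr.
    exact: lt_le_nbhsl.
  have wPhi : {ae leb, forall x, a' < x < b' -> w x = Phi x}.
    have FF := ae_filter_ringOfSetsType leb.
    apply: filterS3 UV wd wd' => x UVx wdx wdx' /[dup] xab /andP[ax xb].
    have [|Ux Vx] := UVx; first by rewrite (lt_trans aa')// (lt_trans xb).
    have hn : \forall y \near x, (h \o clamp a' b') y = h y.
      by apply: filterS (clampn x xab) => y /= ->.
    have [hd _] := is_derive_near_eq hn (wdx' xab).
    have hgn : \forall y \near x, ((fun x => h x * g x) \o clamp a' b') y = h y * g y.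
      by apply: filterS (clampn x xab) => y /= ->.
    have [_ <-] := is_derive_near_eq hgn (wdx xab).
    have hh : is_derive x (1 : R) h (V x).
      by apply: DeriveDef => //; rewrite -derive1E.
    have [_ hgd] := is_deriveM hh (gdg x).
    rewrite derive1E [LHS]hgd /Phi Ux addrC /GRing.scale /=; congr (_ + _).
    exact: mulrC.
  have := wE b'; rewrite a'b'W lexx /= => /(_ isT).
  rewrite (clamp_id (_ : a' <= b' <= b')) ?a'b'W ?lexx// clamp_id ?lexx//.
  move=> ->; rewrite addrAC subrr add0r.
  have -> : (\int[leb]_(t in [set` `]a', b']]) w t = \int[leb]_(t in [set` `]a', b']]) Phi t)%R.
    rewrite -!Rintegral_itv_bndo_bndc; last 2 first.
    - exact: iPhiJ (measurable_itv _).
    - by apply: integrableS iw => //; exact: measurable_itv.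
    congr fine; apply: ae_eq_integral => //.
    - by apply: measurable_int; apply: integrableS iw => //; exact: measurable_itv.
    - by apply: measurable_int; exact: iPhiJ (measurable_itv _).
    - have FF := ae_filter_ringOfSetsType leb.
      apply: filterS wPhi => x wx; rewrite /= in_itv /= => xab.
      by rewrite wx.
  have -> : P b' = P a' + (\int[leb]_(t in [set` `]a', b']]) Phi t)%R.
    rewrite /P (@itv_bndbnd_setU _ _ _ (BRight a')); last 2 first.
    - by rewrite bnd_simp ltW.
    - by rewrite bnd_simp.
    rewrite Rintegral_setU//=.
    + by apply: iPhiJ; apply: measurableU; exact: measurable_itv.
    + apply/disj_setPLR => z /=; rewrite !in_itv /= => /andP[_ z2] /andP[].
      by rewrite ltNge z2.
  by rewrite addrAC subrr add0r.
have /(continuous_within_itvP _ ab)[_ Pa Pb] : {within `[a, b], continuous P}.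
  by apply: parameterized_integral_continuous (ltW ab) (iPhiJ _ (measurable_itv _)).
have P0 : P a = 0.
  by rewrite /P set_itv1 Rintegral_set1.
have Hlim (c : R) (F : set_system R) (FF : Filter F) : F --> c ->
    h x @[x --> F] --> (0 : R) -> h x * g x @[x --> F] --> (0 : R).
  move=> Fc h0; rewrite -[X in _ --> X](mul0r (g c)).
  by apply: cvgM => //; apply: cvg_comp Fc (cg c).
pose m := (a + b) / 2.
have [am mb] : a < m /\ m < b by rewrite /m; lra.
pose c := h m * g m - P m.
have hc x : a < x < b -> h x * g x - P x = c.
  move=> /andP[ax xb]; have [xm|mx|->//] := ltgtP x m.
    by have := key _ _ ax xm mb; rewrite /c; lra.
  by have := key _ _ am mx xb; rewrite /c; lra.
have c0 : c = 0.
  have L : h x * g x - P x @[x --> a^'+] --> (0 - P a).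
    by apply: cvgB => //; apply: (Hlim a) => //; exact: cvg_at_right_filter.
  have L' : h x * g x - P x @[x --> a^'+] --> c.
    apply: cvg_near_cst; near=> x; apply: hc; apply/andP; split; near: x.
      exact: nbhs_right_gt.
    exact: nbhs_right_lt.
  by rewrite (cvg_unique _ L' L)// P0 subrr.
have Pb0 : P b = 0.
  have L : h x * g x - P x @[x --> b^'-] --> (0 - P b).
    by apply: cvgB => //; apply: (Hlim b) => //; exact: cvg_at_left_filter.
  have L' : h x * g x - P x @[x --> b^'-] --> c.
    apply: cvg_near_cst; near=> x; apply: hc; apply/andP; split; near: x.
      exact: nbhs_left_gt.
    exact: nbhs_left_lt.
  have /eqP : c = 0 - P b by exact: cvg_unique L' L.
  by rewrite c0 sub0r eq_sym oppr_eq0 => /eqP.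
rewrite Rintegral_itv_bndo_bndc; last exact: iPhiJ (measurable_itv _).
rewrite Rintegral_itv_obnd_cbnd; last exact: iPhiJ (measurable_itv _).
exact: Pb0.
Unshelve. all: by end_near. Qed.

End absolutely_continuous_parts.

(** * Integration over Omega and Fourier coefficients of a derivative *)

Section Omega_measure.
Context (R : realType) (n : nat) (alpha beta : 'I_n -> R).
Hypothesis n_gt0 : (0 < n)%N.
Hypothesis ltab : forall i, alpha i < beta i.
Hypothesis ltba : forall i j : 'I_n, (i < j)%N -> beta i < alpha j.
Local Notation leb := (@lebesgue_measure R).
Local Notation mu := (mu_Omega alpha beta).
Local Notation Omega := (Omega alpha beta).
Local Notation dot := (@l2dot _ _ _ mu).
Local Notation J i := ([set` `]alpha i, beta i[] : set (measurableTypeR R)).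

Definition ivol : R := (fine (leb Omega))^-1.

Lemma ivol_gt0 : 0 < ivol.
Proof.
rewrite invr_gt0 fine_gt0// Omega_lty andbT.
have i0 : 'I_n := Ordinal n_gt0.
apply: (@lt_le_trans _ _ (leb (J i0))).
  by rewrite lebesgue_measure_itv /= lte_fin ltab -EFinB lte_fin subr_gt0.
apply: le_measure; rewrite ?inE; [exact: measurable_itv|exact: measurable_Omega|].
by move=> x xi; exists i0.
Qed.

Lemma mu_OmegaE A : mu A = (ivol%:E * leb (A `&` Omega))%E.
Proof. by []. Qed.

Lemma ae_mu_Omega (P : R -> Prop) :
  {ae mu, forall x, P x} <-> {ae leb, forall x, Omega x -> P x}.
Proof.
have mO := measurable_Omega alpha beta.
split=> -[N [mN N0 NP]].
  exists (N `&` Omega); split.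
  - exact: measurableI.
  - move/eqP : N0; rewrite mu_OmegaE mule_eq0 eqe gt_eqF ?ivol_gt0//=.
    by move/eqP.
  - by move=> x /not_implyP[Ox Px]; split=> //; exact: NP.
exists (N `|` ~` Omega); split.
- by apply: measurableU => //; exact: measurableC.
- rewrite mu_OmegaE [X in leb X](_ : _ = N `&` Omega).
    by rewrite (subset_measure0 _ _ _ N0) ?mule0//; exact: measurableI.
  by rewrite setIUl setICl setU0.
- move=> x Px; have [Ox|] := pselect (Omega x); last by right.
  by left; apply: NP => /(_ Ox).
Qed.

Lemma ge0_integral_mu_Omega (f : R -> \bar R) :
  measurable_fun setT (f : measurableTypeR R -> \bar R) -> (forall x, 0 <= f x)%E ->
  (\int[mu]_x f x = ivol%:E * \int[leb]_(x in Omega) f x)%E.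
Proof.
have mO := measurable_Omega alpha beta.
move=> mf f0; rewrite (@ge0_negligible_integral _ _ _ mu setT (~` Omega) f)//; last 2 first.
- exact: measurableC.
- by rewrite mu_OmegaE setICl measure0 mule0.
rewrite setTD setCK.
rewrite (eq_measure_integral (mscale (NngNum (inv_vol_ge0 alpha beta)) leb)).
  by rewrite ge0_integral_mscale//; exact: measurable_funTS.
by move=> A mA AO; rewrite mu_OmegaE /= /mscale /= setIidl.
Qed.

Lemma integrable_mu_Omega (f : R -> R) : mu.-integrable setT (EFin \o f) ->
  leb.-integrable Omega (EFin \o f).
Proof.
move=> /integrableP[mf fi]; apply/integrableP; split; first exact: measurable_funTS.
move: fi; rewrite ge0_integral_mu_Omega//; last exact: measurableT_comp.
rewrite muleC; apply: contraLR; rewrite -!leNgt !leye_eq => /eqP ->.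
by rewrite gt0_mulye// lte_fin ivol_gt0.
Qed.

Lemma Rintegral_mu_Omega (f : R -> R) : mu.-integrable setT (EFin \o f) ->
  \int[mu]_x f x = ivol * \int[leb]_(x in Omega) f x.
Proof.
move=> fi; have fO := integrable_mu_Omega fi.
have mf : measurable_fun setT (EFin \o f) := measurable_int _ fi.
have mO := measurable_Omega alpha beta.
rewrite /Rintegral [X in fine X = _]integralE [X in _ = _ * fine X]integralE.
rewrite !ge0_integral_mu_Omega//; [|exact: measurable_funeneg|exact: measurable_funepos].
have fp : (\int[leb]_(x in Omega) (EFin \o f)^\+ x)%E \is a fin_num.
  by apply: integrable_fin_num => //; exact: integrable_funepos.
have fn : (\int[leb]_(x in Omega) (EFin \o f)^\- x)%E \is a fin_num.
  by apply: integrable_fin_num => //; exact: integrable_funeneg.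
move: fp fn; set X := (\int[_]_(_ in _) _)%E; set Y := (\int[_]_(_ in _) _)%E => fp fn.
clearbody X Y; case: X fp => [x||]// _; case: Y fn => [y||]// _.
by rewrite /= mulrBr.
Qed.

Lemma Omega_disjoint : trivIset setT (fun i => J i).
Proof.
move=> i j _ _ [x []]; rewrite /= !in_itv /= => /andP[i1 i2] /andP[j1 j2].
have [ij|ij|/val_inj//] := ltngtP i j.
  by have := ltba ij; rewrite ltNge (ltW (lt_trans j1 i2)).
by have := ltba ij; rewrite ltNge (ltW (lt_trans i1 j2)).
Qed.

Lemma Rintegral_Omega (f : R -> R) : leb.-integrable Omega (EFin \o f) ->
  (\int[leb]_(x in Omega) f x = \sum_i \int[leb]_(x in J i) f x)%R.
Proof.
move=> fO.
have OE : Omega = \big[setU/set0]_(i <- enum 'I_n) J i.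
  apply/seteqP; split=> [x [i _ xi]|x]; rewrite -bigcup_seq.
    by exists i => //=; rewrite mem_enum.
  by move=> [i _ xi]; exists i.
rewrite /Rintegral OE integral_bigsetU_EFin//.
- rewrite -sum_fine; first by rewrite big_enum.
  move=> i _; apply: integrable_fin_num; first exact: measurable_itv.
  apply: integrableS fO => //; [exact: measurable_Omega|].
  by move=> x xi; exists i.
- by rewrite enum_uniq.
- by apply: sub_trivIset Omega_disjoint.
- by rewrite -OE; exact: measurable_int fO.
Qed.

Lemma integrable_bounded_mul (f g : R -> R) :
  mu.-integrable setT (EFin \o f) -> continuous g -> (exists K, forall x, `|g x| <= K) ->
  mu.-integrable setT (EFin \o (fun x => f x * g x)).
Proof.
move=> fi cg [K gK].
rewrite (_ : _ \o _ = (EFin \o f) \* (EFin \o g))%E; last by apply/funext => x.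
apply: integrableMl => //; first exact: continuous_measurable_fun.
exists K; split; first exact: num_real.
by move=> y Ky x _ /=; rewrite (le_trans (gK x))// ltW.
Qed.

Lemma parts_Omega (h g dg : R -> R) (U V : R -> R) :
  (forall i, acont_on [set` `]alpha i, beta i[] h) ->
  (forall i, h x @[x --> (alpha i)^'+] --> (0 : R)) ->
  (forall i, h x @[x --> (beta i)^'-] --> (0 : R)) ->
  (forall x, is_derive x (1 : R) g (dg x)) -> continuous dg ->
  (exists K : R, forall x, `|g x| <= K /\ `|dg x| <= K) ->
  mu.-integrable setT (EFin \o U) -> mu.-integrable setT (EFin \o V) ->
  {ae mu, forall x, U x = h x} -> {ae mu, forall x, V x = derive1 h x} ->
  \int[mu]_x (V x * g x) + \int[mu]_x (U x * dg x) = 0.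
Proof.
move=> ach ha hb gdg cdg [K gK] iU iV /ae_mu_Omega aU /ae_mu_Omega aV.
have cg : continuous g.
  by move=> x; apply: differentiable_continuous; apply/derivable1_diffP; case: (gdg x).
have iVg : mu.-integrable setT (EFin \o (fun x => V x * g x)).
  by apply: integrable_bounded_mul => //; exists K => x; case: (gK x).
have iUdg : mu.-integrable setT (EFin \o (fun x => U x * dg x)).
  by apply: integrable_bounded_mul => //; exists K => x; case: (gK x).
have iS : mu.-integrable setT (EFin \o (fun x => V x * g x + U x * dg x)).
  have := integrableD measurableT iVg iUdg; apply: eq_integrable => // x _.
rewrite -RintegralD// Rintegral_mu_Omega// Rintegral_Omega; last exact: integrable_mu_Omega.
rewrite big1 ?mulr0// => i _.
have mO := measurable_Omega alpha beta.
have patchI (f : R -> R) : mu.-integrable setT (EFin \o f) ->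
    leb.-integrable setT (EFin \o (f \_ Omega)).
  by move=> /integrable_mu_Omega; rewrite integrable_mkcond// restrict_EFin.
have JO x : alpha i < x < beta i -> Omega x.
  by move=> xi; exists i => //=; rewrite in_itv.
have := @acont_parts R h g dg (U \_ Omega) (V \_ Omega) _ _ (ltab i) (ach i) (ha i) (hb i)
  gdg cdg (ex_intro _ K gK) (patchI _ iU) (patchI _ iV).
have aUV : {ae leb, forall x, alpha i < x < beta i ->
    (U \_ Omega) x = h x /\ (V \_ Omega) x = derive1 h x}.
  have FF := ae_filter_ringOfSetsType leb.
  apply: filterS2 aU aV => x Ux Vx /JO Ox; rewrite !patchE mem_set//.
  by rewrite Ux// Vx.
move=> /(_ aUV) <-; apply: eq_Rintegral => x; rewrite inE /= in_itv /= => /JO Ox.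
by rewrite !patchE mem_set.
Qed.

(** L2 is contained in L1 for a finite measure: [expi 0] is the constant 1, and a product of two
    square-integrable functions is integrable. *)
Lemma square_integrable_integrable (f : R -> R[i]) : square_integrable mu f ->
  mu.-integrable setT (EFin \o (fun x => Re (f x))) /\
  mu.-integrable setT (EFin \o (fun x => Im (f x))).
Proof.
move=> fs; have := cintegrableM fs (square_integrable_expi alpha beta 0).
have e0 x : f x * Num.conj (expi 0 x) = f x.
  rewrite /expi mulr0 mul0r cos0 sin0; case: (f x) => a b.
  by apply: complex_eqP; rewrite !(ReM, ImM, RecJ, ImcJ) /=; ring.
by under eq_fun do rewrite e0.
Qed.

Lemma dot_expL2E (u : L2 mu) (l : R) : let w := 2 * pi * l in
  let U1 x := Re (L2_repr u x) in let U2 x := Im (L2_repr u x) in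
  dot u (expL2 alpha beta l) =
  (\int[mu]_x (U1 x * cos (w * x)) + \int[mu]_x (U2 x * sin (w * x))) +i*
  (\int[mu]_x (U2 x * cos (w * x)) - \int[mu]_x (U1 x * sin (w * x))).
Proof.
move=> w U1 U2.
have cw : continuous (fun x : R => w * x).
  by move=> x; apply: cvgM; [exact: cvg_cst|exact: cvg_id].
have cc : continuous (fun x : R => cos (w * x)).
  by move=> x; apply: (continuous_comp (cw x)); exact: continuous_cos.
have cs : continuous (fun x : R => sin (w * x)).
  by move=> x; apply: (continuous_comp (cw x)); exact: continuous_sin.
have bc : exists K, forall x, `|cos (w * x)| <= K :> R.
  by exists 1 => x; rewrite ler_norml cos_geN1 cos_le1.
have bs : exists K, forall x, `|sin (w * x)| <= K :> R.
  by exists 1 => x; rewrite ler_norml sin_geN1 sin_le1.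
have [i1 i2] := square_integrable_integrable (L2funP (L2_repr u)).
rewrite -[in LHS](L2_reprK u) [LHS]l2dotE.
apply: complex_eqP => /=.
- rewrite -RintegralD//; try exact: integrable_bounded_mul.
  by apply: eq_Rintegral => x _; rewrite ReM RecJ ImcJ /expi /= /U1 /U2; ring.
- rewrite -RintegralB//; try exact: integrable_bounded_mul.
  by apply: eq_Rintegral => x _; rewrite ImM RecJ ImcJ /expi /= /U1 /U2; ring.
Qed.

Lemma is_derive_cosM (w x : R) :
  is_derive x (1 : R) (fun x => cos (w * x)) (- w * sin (w * x)).
Proof.
have hw : is_derive x (1 : R) (fun x => w * x) w.
  have := is_derive_poly (w *: 'X) x; rewrite derivZ derivX hornerZ hornerC mulr1.
  by rewrite (_ : horner _ = (fun x => w * x))//; apply/funext => y; rewrite !hornerE.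
apply: is_derive_eq (is_derive1_comp (f := cos) (g := fun x => w * x) (is_derive_cos _) hw) _.
by rewrite mulrC mulrN mulNr.
Qed.

Lemma is_derive_sinM (w x : R) :
  is_derive x (1 : R) (fun x => sin (w * x)) (w * cos (w * x)).
Proof.
have hw : is_derive x (1 : R) (fun x => w * x) w.
  have := is_derive_poly (w *: 'X) x; rewrite derivZ derivX hornerZ hornerC mulr1.
  by rewrite (_ : horner _ = (fun x => w * x))//; apply/funext => y; rewrite !hornerE.
apply: is_derive_eq (is_derive1_comp (f := sin) (g := fun x => w * x) (is_derive_sin _) hw) _.
by rewrite mulrC.
Qed.

(** [parts_Omega] is a real statement: it is applied to [Re f] and [Im f] against both the cosine
    and the sine, and the four identities recombine into the complex one. *)
Lemma dot_expL2_derive (f : R -> R[i]) (u v : L2 mu) (l : R) :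
  represents u f -> represents v (cderive f) ->
  (forall i, absolutely_continuous_on [set` `]alpha i, beta i[] f) ->
  (forall i, (f : R -> R[i]^o) x @[x --> (alpha i)^'+] --> (0 : R[i]^o) /\
             (f : R -> R[i]^o) x @[x --> (beta i)^'-] --> (0 : R[i]^o)) ->
  dot v (expL2 alpha beta l) = (2 * pi * l)%:C * 'i%C * dot u (expL2 alpha beta l).
Proof.
move=> uf vf acf lf.
have [iu1 iu2] := square_integrable_integrable (L2funP (L2_repr u)).
have [iv1 iv2] := square_integrable_integrable (L2funP (L2_repr v)).
have ac1 i := (acont_on_ReIm (acf i)).1.
have ac2 i := (acont_on_ReIm (acf i)).2.
have limRe (F : set_system R) (FF : Filter F) :
    (f : R -> R[i]^o) x @[x --> F] --> (0 : R[i]^o) ->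
    Re (f x) @[x --> F] --> (0 : R) /\ Im (f x) @[x --> F] --> (0 : R).
  move=> /cvgrPdist_lt f0; split; apply/cvgrPdist_lt => eps eps0.
    have := f0 eps%:C; rewrite ltcR => /(_ eps0); apply: filterS => x.
    rewrite !sub0r !normrN -ltcR; apply: le_lt_trans; exact: (normC_ReIm _).1.
  have := f0 eps%:C; rewrite ltcR => /(_ eps0); apply: filterS => x.
  rewrite !sub0r !normrN -ltcR; apply: le_lt_trans; exact: (normC_ReIm _).2.
have la1 i : Re (f x) @[x --> (alpha i)^'+] --> (0 : R).
  by case: (lf i) => ? ?; apply: (limRe _ _ _).1.
have la2 i : Im (f x) @[x --> (alpha i)^'+] --> (0 : R).
  by case: (lf i) => ? ?; apply: (limRe _ _ _).2.
have lb1 i : Re (f x) @[x --> (beta i)^'-] --> (0 : R).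
  by case: (lf i) => ? ?; apply: (limRe _ _ _).1.
have lb2 i : Im (f x) @[x --> (beta i)^'-] --> (0 : R).
  by case: (lf i) => ? ?; apply: (limRe _ _ _).2.
pose w := 2 * pi * l.
have cw : continuous (fun x : R => w * x).
  by move=> x; apply: cvgM; [exact: cvg_cst|exact: cvg_id].
have cc (c : R) : continuous (fun x : R => c * cos (w * x)).
  move=> x; apply: cvgM; first exact: cvg_cst.
  by apply: (continuous_comp (cw x)); exact: continuous_cos.
have cs (c : R) : continuous (fun x : R => c * sin (w * x)).
  move=> x; apply: cvgM; first exact: cvg_cst.
  by apply: (continuous_comp (cw x)); exact: continuous_sin.
have bc : exists K, forall x, `|cos (w * x)| <= K /\ `|- w * sin (w * x)| <= K :> R.
  exists (1 + `|w|) => x; split.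
    by rewrite (@le_trans _ _ 1) ?lerDl// ler_norml cos_geN1 cos_le1.
  rewrite normrM normrN ler_wpDl// ler_piMr//.
  by rewrite ler_norml sin_geN1 sin_le1.
have bs : exists K, forall x, `|sin (w * x)| <= K /\ `|w * cos (w * x)| <= K :> R.
  exists (1 + `|w|) => x; split.
    by rewrite (@le_trans _ _ 1) ?lerDl// ler_norml sin_geN1 sin_le1.
  rewrite normrM ler_wpDl// ler_piMr//.
  by rewrite ler_norml cos_geN1 cos_le1.
have aU1 : {ae mu, forall x, Re (L2_repr u x) = Re (f x)} by apply: filterS uf => x ->.
have aU2 : {ae mu, forall x, Im (L2_repr u x) = Im (f x)} by apply: filterS uf => x ->.
have aV1 : {ae mu, forall x, Re (L2_repr v x) = derive1 (fun y => Re (f y)) x}.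
  by apply: filterS vf => x ->.
have aV2 : {ae mu, forall x, Im (L2_repr v x) = derive1 (fun y => Im (f y)) x}.
  by apply: filterS vf => x ->.
have p1c := parts_Omega ac1 la1 lb1 (is_derive_cosM w) (cs _) bc iu1 iv1 aU1 aV1.
have p1s := parts_Omega ac1 la1 lb1 (is_derive_sinM w) (cc _) bs iu1 iv1 aU1 aV1.
have p2c := parts_Omega ac2 la2 lb2 (is_derive_cosM w) (cs _) bc iu2 iv2 aU2 aV2.
have p2s := parts_Omega ac2 la2 lb2 (is_derive_sinM w) (cc _) bs iu2 iv2 aU2 aV2.
have cc1 : continuous (fun x : R => cos (w * x)).
  by move=> x; apply: (continuous_comp (cw x)); exact: continuous_cos.
have cs1 : continuous (fun x : R => sin (w * x)).
  by move=> x; apply: (continuous_comp (cw x)); exact: continuous_sin.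
have sc (U : R -> R) (c : R) (g : R -> R) : mu.-integrable setT (EFin \o U) -> continuous g ->
    (exists K, forall x, `|g x| <= K) ->
    \int[mu]_x (U x * (c * g x)) = c * \int[mu]_x (U x * g x).
  move=> iU cg bg; rewrite -RintegralZl//; last exact: integrable_bounded_mul.
  by apply: eq_Rintegral => x _; rewrite mulrCA.
have bc1 : exists K, forall x, `|cos (w * x)| <= K :> R.
  by case: bc => K bK; exists K => x; case: (bK x).
have bs1 : exists K, forall x, `|sin (w * x)| <= K :> R.
  by case: bs => K bK; exists K => x; case: (bK x).
rewrite sc// in p1c; rewrite sc// in p1s; rewrite sc// in p2c; rewrite sc// in p2s.
rewrite !dot_expL2E -/w; move: p1c p1s p2c p2s.
set A1 := Rintegral _ _ _; set A2 := Rintegral _ _ _ => p1c.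
set A3 := Rintegral _ _ _; set A4 := Rintegral _ _ _ => p1s.
set A5 := Rintegral _ _ _; set A6 := Rintegral _ _ _ => p2c.
set A7 := Rintegral _ _ _; set A8 := Rintegral _ _ _ => p2s.
by apply: complex_eqP; rewrite !(ReM, ImM) /=; lra.
Qed.

End Omega_measure.

(** * Weak derivatives and test functions *)

Section step_kernel.
Context (R : realType).
Local Notation leb := (@lebesgue_measure R).
Local Notation S := (@smooth_step R).
Implicit Types (p q : R) (k : nat) (U W : R -> R).

(** A smooth approximation of the indicator of ]p, +oo[, going from 0 to 1 on an interval of length
    1 / (k + 1) to the right of [p]. *)
Definition ramp k p (x : R) : R := S (k.+1%:R * x + - (k.+1%:R * p)).
Definition ramp' k p (x : R) : R := k.+1%:R * derive1 S (k.+1%:R * x + - (k.+1%:R * p)).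

Lemma is_derive_ramp k p (x : R) : is_derive x (1 : R) (ramp k p) (ramp' k p x).
Proof.
have hS y : is_derive y (1 : R) S (derive1 S y).
  by apply: DeriveDef; [exact: smooth_step_derivable|rewrite derive1E].
have h := is_derive_poly (k.+1%:R *: 'X + (- (k.+1%:R * p))%:P) x.
rewrite derivD derivZ derivX derivC addr0 hornerZ hornerC mulr1 in h.
have hE : horner (k.+1%:R *: 'X + (- (k.+1%:R * p))%:P) = (fun x => k.+1%:R * x + - (k.+1%:R * p)).
  by apply/funext => y; rewrite !hornerE.
rewrite hE in h.
apply: is_derive_eq (is_derive1_comp (f := S)
  (g := fun x => k.+1%:R * x + - (k.+1%:R * p)) (hS _) h) _.
exact: mulrC.
Qed.

Lemma ramp_arg k p (x : R) : k.+1%:R * x + - (k.+1%:R * p) = k.+1%:R * (x - p).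
Proof. by rewrite mulrBr. Qed.

Lemma ramp0 k p (x : R) : x <= p -> ramp k p x = 0.
Proof.
by move=> xp; rewrite /ramp ramp_arg smooth_step0// pmulr_rle0// subr_le0.
Qed.

Lemma ramp1 k p (x : R) : p + k.+1%:R^-1 <= x -> ramp k p x = 1.
Proof.
move=> px; rewrite /ramp ramp_arg smooth_step1//.
by rewrite -ler_pdivrMl// mulr1 lerBrDl.
Qed.

Lemma ramp_itv k p (x : R) : 0 <= ramp k p x <= 1.
Proof. exact: smooth_step_itv. Qed.

Lemma ramp'0 k p (x : R) : x < p \/ p + k.+1%:R^-1 < x -> ramp' k p x = 0.
Proof.
move=> xp; rewrite /ramp' ramp_arg smooth_step_derive0 ?mulr0//.
case: xp => xp; [left|right].
  by rewrite pmulr_rlt0// subr_lt0.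
by rewrite -ltr_pdivrMl// mulr1 ltrBrDl.
Qed.

Lemma continuous_ramp k p : continuous (ramp k p).
Proof.
by move=> x; apply: differentiable_continuous; apply/derivable1_diffP;
  case: (is_derive_ramp k p x).
Qed.

Lemma continuous_ramp' k p : continuous (ramp' k p).
Proof.
have ca : continuous (fun x : R => k.+1%:R * x + - (k.+1%:R * p)).
  move=> x; apply: cvgD; last exact: cvg_cst.
  by apply: cvgM; [exact: cvg_cst|exact: cvg_id].
move=> x; apply: cvgM; first exact: cvg_cst.
by apply: (continuous_comp (ca x)); exact: smooth_step_derive_continuous.
Qed.

Lemma ramp'_bounded : exists2 M : R, 0 <= M & forall k p x, `|ramp' k p x| <= k.+1%:R * M.
Proof.
have [M M0 SM] := smooth_step_derive_bounded R; exists M => // k p x.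
by rewrite normrM ger0_norm// ler_wpM2l.
Qed.

Lemma integrable_mul_bounded (f g : R -> R) (K : R) :
  leb.-integrable setT (EFin \o f) -> continuous g -> (forall x, `|g x| <= K) ->
  leb.-integrable setT (EFin \o (fun x => f x * g x)).
Proof.
move=> fi cg gK.
rewrite (_ : _ \o _ = (EFin \o f) \* (EFin \o g))%E; last by apply/funext => x.
apply: integrableMl => //; first exact: continuous_measurable_fun.
exists K; split; first exact: num_real.
by move=> y Ky x _ /=; rewrite (le_trans (gK x))// ltW.
Qed.

(* The kernel [ramp' k p] has integral 1, height O(k) and is supported in a ball
   of radius O(1/k) around [p]. *)
Lemma ramp'_lebesgue_pt U p : leb.-integrable setT (EFin \o U) -> lebesgue_pt U p ->
  (\int[leb]_x (U x * ramp' k p x))%R @[k --> \oo] --> U p.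
Proof.
move=> iU Up; have [M M0 rM] := ramp'_bounded.
(* Twice the length of the support of the kernel, so that the open ball centred at [p] contains the
   whole support. *)
pose r k : R := 2 * k.+1%:R^-1.
have r0 k : 0 < r k by rewrite mulr_gt0.
have davg_r : (davg U p (r k)) @[k --> \oo] --> 0%E.
  have rlim : r k @[k --> \oo] --> (0 : R).
    rewrite -[X in _ --> X](mulr0 2); apply: cvgM; first exact: cvg_cst.
    exact: cvg_harmonic.
  move=> A /Up[eps /= eps0 epsA].
  move/cvgrPdist_lt : rlim => /(_ _ eps0); apply: filterS => k rk.
  by apply: epsA => //=.
have mB k : measurable (ball p (r k) : set (measurableTypeR R)).
  exact: measurable_ball.
have iUB k : leb.-integrable (ball p (r k)) (EFin \o (fun x => U x - U p)).
  rewrite (_ : _ \o _ = (EFin \o U) \- (EFin \o cst (U p)))%E; last by apply/funext => x.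
  apply: integrableB => //; first exact: integrableS iU.
  apply: measurable_bounded_integrable => //.
    have bl : (leb (ball p (r k)) < +oo)%E.
      by rewrite (lebesgue_measure_ball p (ltW (r0 k))) ltry.
    exact: bl.
  by exists `|U p|; split=> [|y Ky x _ /=]; [exact: num_real|exact: ltW].
(* The kernel has height at most (k + 1) M and the ball has length 4 / (k + 1), whence 4 M. *)
have bound k : (`|U p - (\int[leb]_x (U x * ramp' k p x))%R|%:E <=
    (4 * M)%:E * davg U p (r k))%E.
  have supp x : ~ ball p (r k) x -> ramp' k p x = 0.
    move=> px; apply: ramp'0; rewrite /ball /= in px.
    have : r k <= `|p - x| by rewrite leNgt; apply/negP.
    have k0 : 0 < k.+1%:R^-1 :> R by rewrite invr_gt0.
    rewrite /r; move: (k.+1%:R^-1) k0 => t t0; rewrite ler_normr.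
    by move=> /orP[] h; [left|right]; lra.
  have itvE : ball p (r k) = [set` `]p - r k, p + r k[].
    exact: ball_itv.
  have iKc : leb.-integrable [set` `[p - r k, p + r k]] (EFin \o ramp' k p).
    apply: (continuous_compact_integrable (f := ramp' k p : R -> R^o)).
      exact: segment_compact.
    by apply: continuous_subspaceT => x; exact: continuous_ramp'.
  have iK : leb.-integrable (ball p (r k)) (EFin \o ramp' k p).
    by apply: integrableS iKc => //; rewrite itvE; exact: subset_itvW.
  have int1 : (\int[leb]_(x in ball p (r k)) ramp' k p x)%R = 1.
    rewrite itvE Rintegral_itv_bndo_bndc; last by rewrite -itvE.
    rewrite Rintegral_itv_obnd_cbnd; last first.
      by apply: integrableS iKc => //; apply: subset_itvr; rewrite bnd_simp.
    rewrite /Rintegral (@continuous_FTC2 R (ramp' k p) (ramp k p)).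
    - rewrite /= ramp1 ?ramp0 ?subr0//; first by rewrite gerBl ltW.
      by rewrite lerD2l /r ler_peMl// ler1n.
    - by have := r0 k; lra.
    - by apply: continuous_subspaceT => x; exact: continuous_ramp'.
    - split.
      + by move=> x _; case: (is_derive_ramp k p x).
      + by apply: cvg_at_right_filter; exact: continuous_ramp.
      + by apply: cvg_at_left_filter; exact: continuous_ramp.
    - by move=> x _; rewrite derive1E; case: (is_derive_ramp k p x).
  have -> : (\int[leb]_x (U x * ramp' k p x) = \int[leb]_(x in ball p (r k)) (U x * ramp' k p x))%R.
    rewrite [RHS]Rintegral_mkcond; apply: eq_Rintegral => x _; rewrite patchE.
    by case: ifPn => //; rewrite notin_setE => /supp ->; rewrite mulr0.
  have iUK : leb.-integrable (ball p (r k)) (EFin \o (fun x => U x * ramp' k p x)).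
    have iUKT := integrable_mul_bounded iU (@continuous_ramp' k p) (rM k p).
    exact: integrableS iUKT.
  have iUpK : leb.-integrable (ball p (r k)) (EFin \o (fun x => U p * ramp' k p x)).
    by rewrite (_ : _ \o _ = (fun x => (U p)%:E * (ramp' k p x)%:E))%E; [exact: integrableZl|apply/funext].
  rewrite -[X in X - _](mulr1) -[in U p * _]int1 -RintegralZl// -RintegralB//.
  have iD : leb.-integrable (ball p (r k)) (EFin \o (fun x => U p * ramp' k p x - U x * ramp' k p x)).
    rewrite (_ : _ \o _ = (EFin \o (fun x => (U p * ramp' k p x)%R)) \-
      (EFin \o (fun x => (U x * ramp' k p x)%R)))%E; last exact/funext.
    exact: integrableB.
  have le1 := le_normr_Rintegral (mB k) iD.
  rewrite -lee_fin in le1; apply: le_trans le1 _.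
  rewrite /Rintegral fineK; last first.
    by apply: integrable_fin_num => //; exact: integrable_abse iD.
  apply: (@le_trans _ _ (\int[leb]_(x in ball p (r k)) ((k.+1%:R * M)%:E * `|(U x - U p)%:E|))%E).
    apply: ge0_le_integral => //.
    - by apply: measurable_int; exact: integrable_abse iD.
    - by apply: measurable_int; apply: integrableZl => //; exact: integrable_abse (iUB k).
    - move=> x _; rewrite -mulrBl normrM lee_fin mulrC distrC ler_wpM2r//.
  rewrite ge0_integralZl//; last 2 first.
  - by apply: measurable_int; exact: integrable_abse (iUB k).
  - by rewrite lee_fin mulr_ge0.
  rewrite /davg /iavg (lebesgue_measure_ball p (ltW (r0 k))) inver.
  rewrite mulrn_eq0 /= gt_eqF// muleA -EFinM lee_wpmul2r//.
    by apply: integral_ge0 => x _.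
  rewrite lee_fin /r -[X in X *+ 2]mulr1 -mulr_natr le_eqVlt; apply/orP; left; apply/eqP.
  have c0 : k.+1%:R != 0 :> R by rewrite pnatr_eq0.
  by move: (k.+1%:R : R) c0 => c c0; rewrite mulr1 mulr2n; field; rewrite c0.
apply/cvgrPdist_le => eps eps0.
have e0 : 0 < eps / (4 * M + 1) by rewrite divr_gt0// ltr_wpDl// mulr_ge0.
have h : \forall k \near \oo, (davg U p (r k) < (eps / (4 * M + 1))%:E)%E.
  have := davg_r [set x | (x < (eps / (4 * M + 1))%:E)%E].
  by apply; apply: open_nbhs_nbhs; split; [exact: open_ereal_lt_ereal|rewrite /= lte_fin].
apply: filterS h => k hk; rewrite -lee_fin; apply: le_trans (bound k) _.
apply: (@le_trans _ _ ((4 * M)%:E * (eps / (4 * M + 1))%:E)%E).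
  by rewrite lee_wpmul2l ?lee_fin ?mulr_ge0// ltW.
rewrite -EFinM lee_fin mulrC mulrAC ler_pdivrMr ?ltr_wpDl ?mulr_ge0//.
by rewrite ler_pM2l// lerDl.
Qed.

(** The difference of the two ramps is bounded by 1 and tends to the indicator of ]p, q] at every
    point, so dominated convergence applies. *)
Lemma ramp_indicator_cvg W p q : p < q -> leb.-integrable setT (EFin \o W) ->
  (\int[leb]_x (W x * (ramp k p x - ramp k q x)))%R @[k --> \oo] -->
  (\int[leb]_(x in [set` `]p, q]]) W x)%R.
Proof.
move=> pq iW.
have mI : measurable ([set` `]p, q]] : set (measurableTypeR R)) by exact: measurable_itv.
have bnd k x : `|ramp k p x - ramp k q x| <= 1.
  have := ramp_itv k p x; have := ramp_itv k q x.
  by rewrite ler_norml => /andP[? ?] /andP[? ?]; apply/andP; split; lra.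
have cr k : continuous (fun x => ramp k p x - ramp k q x).
  by move=> x; apply: cvgB; exact: continuous_ramp.
have iWr k := integrable_mul_bounded iW (cr k) (bnd k).
have mW := measurable_int _ iW.
have [] := @dominated_convergence _ _ R leb setT measurableT
  (fun k x => (W x * (ramp k p x - ramp k q x))%:E) ((EFin \o W) \_ [set` `]p, q]])
  (fun x => `|(W x)%:E|%E).
- by move=> k; exact: measurable_int (iWr k).
- by apply/(measurable_restrictT _ mI); exact: measurable_funTS.
- apply: aeW => x _; rewrite patchE; case: ifPn => xpq.
    apply: cvg_near_cst; move: xpq; rewrite inE /= in_itv /= => /andP[px xq].
    have xp0 : 0 < x - p by rewrite subr_gt0.
    have := near_infty_natSinv_lt (PosNum xp0); apply: filterS => k /= kx.
    have {}kx : k.+1%:R^-1 < x - p := kx.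
    have px1 : p + k.+1%:R^-1 <= x by rewrite -lerBrDl ltW.
    by rewrite ramp1// ramp0// subr0 mulr1.
  apply: cvg_near_cst; move: xpq; rewrite notin_setE /= in_itv /=.
  have [xp|px] := leP x p.
    by move=> _; apply: nearW => k; rewrite !ramp0 ?subrr ?mulr0// (le_trans xp)// ltW.
  rewrite /= => /negP; rewrite -ltNge => qx.
  have xq0 : 0 < x - q by rewrite subr_gt0.
  have := near_infty_natSinv_lt (PosNum xq0); apply: filterS => k /= kx.
  have {}kx : k.+1%:R^-1 < x - q := kx.
  have qx1 : q + k.+1%:R^-1 <= x by rewrite -lerBrDl ltW.
  have px1 : p + k.+1%:R^-1 <= x by rewrite (le_trans _ qx1)// lerD2r ltW.
  by rewrite !ramp1// subrr mulr0.
- exact: integrable_abse iW.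
- by apply: aeW => x k _; rewrite /= lee_fin normrM ler_piMr.
move=> _ _ h; rewrite /Rintegral; apply: fine_cvg.
rewrite fineK.
  rewrite integral_mkcond; exact: h.
by apply: integrable_fin_num => //; exact: integrableS iW.
Qed.

End step_kernel.

Section weak_derivative.
Context (R : realType) (n : nat) (alpha beta : 'I_n -> R).
Hypothesis n_gt0 : (0 < n)%N.
Hypothesis ltab : forall i, alpha i < beta i.
Local Notation leb := (@lebesgue_measure R).
Local Notation mu := (mu_Omega alpha beta).
Local Notation Omega := (Omega alpha beta).
Local Notation dot := (@l2dot _ _ _ mu).
Implicit Types (u v : L2 mu) (g : R -> R).

(** Extension by 0 turns integrals over [Omega] into integrals over the line, the setting of the
    kernels [ramp']. *)
Definition re_part u : R -> R := (fun x => Re (L2_repr u x)) \_ Omega.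
Definition im_part u : R -> R := (fun x => Im (L2_repr u x)) \_ Omega.

Lemma integrable_patch_Omega (f : R -> R) : mu.-integrable setT (EFin \o f) ->
  leb.-integrable setT (EFin \o (f \_ Omega)).
Proof.
have mO := measurable_Omega alpha beta.
by move=> /(integrable_mu_Omega n_gt0 ltab); rewrite integrable_mkcond// restrict_EFin.
Qed.

Lemma integrable_parts u : leb.-integrable setT (EFin \o re_part u) /\
  leb.-integrable setT (EFin \o im_part u).
Proof.
by have [i1 i2] := square_integrable_integrable (L2funP (L2_repr u)); split;
  apply: integrable_patch_Omega.
Qed.

Lemma Rintegral_mu_patch (f g : R -> R) : mu.-integrable setT (EFin \o f) ->
  continuous g -> (exists K, forall x, `|g x| <= K) ->
  \int[mu]_x (f x * g x) = ivol alpha beta * \int[leb]_x ((f \_ Omega) x * g x).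
Proof.
move=> fi cg gK; rewrite (Rintegral_mu_Omega n_gt0 ltab); last exact: integrable_bounded_mul.
congr (_ * _); rewrite Rintegral_mkcond; apply: eq_Rintegral => x _.
by rewrite !patchE; case: ifP => //; rewrite mul0r.
Qed.

Lemma square_integrable_real g : continuous g -> (exists K, forall x, `|g x| <= K) ->
  square_integrable mu (fun x => (g x)%:C).
Proof.
move=> cg [K gK].
have mg : cmeasurable (fun x : measurableTypeR R => (g x)%:C).
  by split; [exact: continuous_measurable_fun|exact: measurable_cst].
split=> //; apply: (@le_lt_trans _ _ (\int[mu]_x (K ^+ 2)%:E)%E).
  apply: ge0_le_integral => //.
  - by move=> x _; rewrite lee_fin normsq_ge0.
  - exact/measurable_EFinP/measurable_normsq.
  - move=> x _; rewrite lee_fin /normsq /= expr0n addr0 -real_normK ?num_real//.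
    by rewrite ler_sqr ?nnegrE//; exact: le_trans (gK x).
rewrite integral_cst//; apply: lte_mul_pinfty; rewrite ?lee_fin ?sqr_ge0//.
exact: mu_Omega_lty.
Qed.

Lemma represents_class u (f : R -> R[i]) (F : L2fun mu) :
  represents u f -> (forall x, F x = f x) -> u = L2_class F.
Proof.
move=> uf Ff; rewrite -[u]L2_reprK; apply/L2_classP.
by apply: filterS uf => x ->; rewrite Ff.
Qed.

Lemma dot_real u v g : continuous g -> (exists K, forall x, `|g x| <= K) ->
  represents v (fun x => (g x)%:C) ->
  dot v u = (ivol alpha beta)%:C *
    ((\int[leb]_x (re_part u x * g x))%R +i* - (\int[leb]_x (im_part u x * g x))%R).
Proof.
move=> cg gK vg; have sg := square_integrable_real cg gK.
rewrite (represents_class (F := MkL2fun (introT (sqint_inP mu _) sg)) vg)//.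
rewrite -[u in LHS]L2_reprK [LHS]l2dotE.
have [i1 i2] := square_integrable_integrable (L2funP (L2_repr u)).
apply: complex_eqP; rewrite !(ReM, ImM) /= mul0r ?subr0 ?addr0 ?mulrN.
  rewrite -Rintegral_mu_patch//; apply: eq_Rintegral => x _.
  by rewrite ReM RecJ ImcJ /=; ring.
rewrite -Rintegral_mu_patch// -mulN1r -RintegralZl//; last exact: integrable_bounded_mul.
by apply: eq_Rintegral => x _; rewrite ImM RecJ ImcJ /=; ring.
Qed.

Lemma smooth_derive1 g : smooth g -> smooth (derive1 g).
Proof. by move=> sg k x; have := sg k.+1 x; rewrite derive1Sn. Qed.

Lemma smooth_is_derive g (x : R) : smooth g -> is_derive x (1 : R) g (derive1 g x).
Proof. by move=> sg; apply: DeriveDef; [exact: (sg 0%N x)|rewrite derive1E]. Qed.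

Lemma smooth_continuous g : smooth g -> continuous g.
Proof.
move=> sg x; apply: differentiable_continuous; apply/derivable1_diffP.
exact: (sg 0%N x).
Qed.

Lemma derive1_outside g (a b : R) : (forall x, x < a \/ b < x -> g x = 0) ->
  forall x, x < a \/ b < x -> derive1 g x = 0.
Proof.
move=> g0 x xab; rewrite derive1E.
have nE : \forall y \near x, cst 0 y = g y.
  case: xab => xab.
    by near=> y; rewrite g0//; left; near: y; exact: lt_nbhsl.
  by near=> y; rewrite g0//; right; near: y; exact: lt_nbhsr.
have c0 : derivable (cst 0 : R -> R) x 1 /\ derive1 (cst 0 : R -> R) x = 0.
  by split; [exact: derivable_cst|rewrite derive1_cst].
by rewrite -derive1E; have [] := is_derive_near_eq nE c0.
Unshelve. all: by end_near. Qed.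

Lemma bounded_outside g (a b : R) : a <= b -> continuous g ->
  (forall x, x < a \/ b < x -> g x = 0) -> exists K, forall x, `|g x| <= K.
Proof.
move=> ab cg g0; have [|c _ cmax] := @EVT_max R (fun x => `|g x|) a b ab.
  by apply: continuous_subspaceT => x; apply: cvg_norm; exact: cg.
exists `|g c| => x; have [xa|ax] := ltP x a; first by rewrite g0 ?normr0//; left.
have [bx|xb] := ltP b x; first by rewrite g0 ?normr0//; right.
by apply: cmax; rewrite in_itv /= ax xb.
Qed.

Lemma test_real g i (a b : R) : smooth g -> alpha i < a -> b < beta i ->
  (forall x, x < a \/ b < x -> g x = 0) -> test_function alpha beta (fun x => (g x)%:C).
Proof.
move=> sg ia bi g0.
have sub : closure [set x | (g x)%:C != 0] `<=` [set` `[a, b]].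
  rewrite [X in _ `<=` X](closure_id _).1; last exact: itv_closed.
  apply: closureS => x /= gx; rewrite in_itv /=; apply/andP; split.
    by rewrite leNgt; apply/negP => xa; move: gx; rewrite g0 ?eqxx//; left.
  by rewrite leNgt; apply/negP => xa; move: gx; rewrite g0 ?eqxx//; right.
split.
- by split=> //; apply: ndiff_smooth => k; exact: ndiff_cst.
- apply: subclosed_compact sub; first exact: closed_closure.
  exact: segment_compact.
- move=> x /sub /=; rewrite in_itv /= => /andP[ax xb]; exists i => //=.
  by rewrite in_itv /= (lt_le_trans ia ax) (le_lt_trans xb bi).
Qed.

Lemma twopi_i_neq0 : (2 * pi)%:C * 'i%C != 0 :> R[i].
Proof.
apply/eqP => /(congr1 (@complex.Im R)); rewrite ImM /= mulr1 mul0r addr0 => /eqP.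
by rewrite mulf_eq0 (gt_eqF (pi_gt0 R)) orbF pnatr_eq0.
Qed.

(** Real and imaginary parts of <g', u> = 2 pi i <g, v>, the adjoint relation tested on a real [g].
    The signs come from the conjugates of [u] and [v] in these products. *)
Lemma weak_derivative_test u v g i (a b : R) :
  adjoint dot (D_Cc alpha beta) (u, v) -> smooth g -> alpha i < a -> a <= b -> b < beta i ->
  (forall x, x < a \/ b < x -> g x = 0) ->
  (\int[leb]_x (re_part u x * derive1 g x) = 2 * pi * \int[leb]_x (im_part v x * g x))%R /\
  (\int[leb]_x (im_part u x * derive1 g x) = - (2 * pi * \int[leb]_x (re_part v x * g x)))%R.
Proof.
move=> adj sg ia ab bi g0.
have cg := smooth_continuous sg; have cg' := smooth_continuous (smooth_derive1 sg).
have bg := bounded_outside ab cg g0.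
have bg' := bounded_outside ab cg' (derive1_outside g0).
pose G := L2_class (MkL2fun (introT (sqint_inP mu _) (square_integrable_real cg bg))).
pose G' := L2_class (MkL2fun (introT (sqint_inP mu _) (square_integrable_real cg' bg'))).
pose c : R[i] := ((2 * pi)%:C * 'i%C)^-1.
have Gr : represents G (fun x => (g x)%:C) by exact: L2_reprP.
have Gr' : represents G' (fun x => (derive1 g x)%:C) by exact: L2_reprP.
have cG' : represents (c *: G') (fun x => c * (derive1 g x)%:C).
  rewrite /represents /G' -L2_classZ; set F := MkL2fun _; apply: filterS (L2_reprP (c *: F)) => x ->.
  by rewrite L2fun_scaleE.
have DG : D_Cc alpha beta (G, c *: G').
  exists (fun x => (g x)%:C); split=> //; first exact: test_real sg ia bi g0.
  apply: filterS cG' => x ->; rewrite /cderive -/c; congr (_ * _).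
  apply: complex_eqP => //=.
  by rewrite derive1E (_ : (fun y : R => _) = cst 0) ?derive_cst.
have E0 : c * dot G' u = dot G v := etrans (esym (dotZl _ _ _ _)) (adj _ DG).
move: E0; rewrite (dot_real v cg bg Gr) (dot_real u cg' bg' Gr').
move/(congr1 (fun z => (2 * pi)%:C * 'i%C * z)); rewrite mulVKf ?twopi_i_neq0//.
have K0 := ivol_gt0 n_gt0 ltab.
move: (ivol alpha beta) K0 => K K0; set A1 := Rintegral _ _ _; set A2 := Rintegral _ _ _.
set A3 := Rintegral _ _ _; set A4 := Rintegral _ _ _ => E.
have := congr1 (@complex.Re R) E; have := congr1 (@complex.Im R) E; rewrite !(ReM, ImM) /= => E2 E1.
by split; apply: (mulfI (lt0r_neq0 K0)); lra.
Qed.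

Lemma ndiff_ramp m k (p : R) : ndiff m (ramp k p).
Proof. by apply: ndiff_affine; exact: ndiff_smooth_step. Qed.

Lemma derive1_ramp k (p : R) : derive1 (ramp k p) = ramp' k p.
Proof. by apply/funext => x; have [] := is_derive1E (is_derive_ramp k p x). Qed.

(** The relation is tested on a smoothed indicator of ]p, q], whose derivative tends to a Dirac mass
    at [p] minus one at [q]; at Lebesgue points these masses evaluate [u]. *)
Lemma weak_derivative u v i (p q : R) : adjoint dot (D_Cc alpha beta) (u, v) ->
  alpha i < p -> p < q -> q < beta i ->
  [/\ lebesgue_pt (re_part u) p, lebesgue_pt (re_part u) q,
      lebesgue_pt (im_part u) p & lebesgue_pt (im_part u) q] ->
  (re_part u q - re_part u p = - (2 * pi * \int[leb]_(x in [set` `]p, q]]) im_part v x) /\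
   im_part u q - im_part u p = 2 * pi * \int[leb]_(x in [set` `]p, q]]) re_part v x)%R.
Proof.
move=> adj ip pq qi [r1 r2 m1 m2].
have [iu1 iu2] := integrable_parts u; have [iv1 iv2] := integrable_parts v.
pose g k (x : R) := ramp k p x + -1 * ramp k q x.
have gE k : g k = (fun x => ramp k p x - ramp k q x).
  by apply/funext => x; rewrite /g mulN1r.
have sg k : smooth (g k).
  apply: ndiff_smooth => m; apply: ndiffD; first exact: ndiff_ramp.
  by apply: ndiffM; [exact: ndiff_cst|exact: ndiff_ramp].
have dg k : derive1 (g k) = (fun x => ramp' k p x - ramp' k q x).
  apply/funext => x; rewrite gE.
  by have [] := is_derive1E (f' := fun x => ramp' k p x - ramp' k q x)
    (is_deriveB (is_derive_ramp k p x) (is_derive_ramp k q x)).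
(* The second ramp ends at q + 1 / (k + 1), which lies inside the interval only for large [k]. *)
have test : \forall k \near \oo,
    (\int[leb]_x (re_part u x * derive1 (g k) x) = 2 * pi * \int[leb]_x (im_part v x * g k x))%R /\
    (\int[leb]_x (im_part u x * derive1 (g k) x) = - (2 * pi * \int[leb]_x (re_part v x * g k x)))%R.
  have q0 : 0 < beta i - q by rewrite subr_gt0.
  have := near_infty_natSinv_lt (PosNum q0); apply: filterS => k /= kx.
  have {}kx : k.+1%:R^-1 < beta i - q := kx.
  have k0 : 0 < k.+1%:R^-1 :> R by rewrite invr_gt0.
  apply: (@weak_derivative_test _ _ _ i p (q + k.+1%:R^-1)) => //.
  - by move: (k.+1%:R^-1) kx k0 => t *; lra.
  - by rewrite -ltrBrDl.
  - move=> x [xp|qx]; rewrite gE.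
      by rewrite !ramp0 ?subrr// ltW// (lt_trans xp).
    by rewrite !ramp1 ?subrr// ltW// (le_lt_trans _ qx)// lerD2r ltW.
have [M _ rM] := ramp'_bounded R.
have lim (U : R -> R) : leb.-integrable setT (EFin \o U) -> lebesgue_pt U p -> lebesgue_pt U q ->
    (\int[leb]_x (U x * derive1 (g k) x))%R @[k --> \oo] --> U p - U q.
  move=> iU Up Uq.
  have iUr k (c : R) := integrable_mul_bounded iU (@continuous_ramp' R k c) (rM k c).
  have -> : (fun k => (\int[leb]_x (U x * derive1 (g k) x))%R) =
      (fun k => \int[leb]_x (U x * ramp' k p x) - \int[leb]_x (U x * ramp' k q x))%R.
    apply/funext => k; rewrite -RintegralB//; last first.
    by apply: eq_Rintegral => x _; rewrite dg mulrBr.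
  by apply: cvgB; exact: ramp'_lebesgue_pt.
have lim2 (W : R -> R) (c : R) : leb.-integrable setT (EFin \o W) ->
    (c * \int[leb]_x (W x * g k x))%R @[k --> \oo] --> c * (\int[leb]_(x in [set` `]p, q]]) W x)%R.
  move=> iW; apply: cvgM; first exact: cvg_cst.
  have := ramp_indicator_cvg pq iW; apply: cvg_trans; apply: near_eq_cvg.
  by apply: nearW => k; rewrite gE.
have uniq (a b : nat -> R) (x y : R) : a k @[k --> \oo] --> x -> b k @[k --> \oo] --> y ->
    (\forall k \near \oo, a k = b k) -> x = y.
  move=> ax bY ab; have ay : a k @[k --> \oo] --> y.
    by apply: cvg_trans (near_eq_cvg _) bY; apply: filterS ab => k ->.
  exact: (cvg_unique (@norm_hausdorff _ _) ax ay).
split.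
  have h := uniq _ _ _ _ (lim _ iu1 r1 r2) (lim2 _ (2 * pi) iv2) _.
  rewrite -h ?opprB//; by apply: filterS test => k [].
have h := uniq _ _ _ _ (lim _ iu2 m1 m2) (lim2 _ (- (2 * pi)) iv1) _.
apply: oppr_inj; rewrite opprB -mulNr h//.
by apply: filterS test => k [_ ->]; rewrite mulNr.
Qed.

Lemma ae_lebesgue_pt (f : R -> R) : leb.-integrable setT (EFin \o f) ->
  {ae leb, forall x, lebesgue_pt f x}.
Proof.
by move=> fi; apply: lebesgue_differentiation; apply: open_integrable_locally => //; exact: openT.
Qed.

Lemma re_part0 : {ae leb, forall x, re_part 0 x = 0} /\ {ae leb, forall x, im_part 0 x = 0}.
Proof.
have h : represents (0 : L2 mu) (fun=> 0 : R[i]).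
  by rewrite /represents -L2_class0; exact: L2_reprP.
move: h => /(ae_mu_Omega n_gt0 ltab) h.
have FF := ae_filter_ringOfSetsType leb.
split; [rewrite /re_part|rewrite /im_part]; apply: filterS h => x h0; rewrite patchE;
  by case: ifPn => //; rewrite inE => /h0 ->.
Qed.

(** Density of the test functions, in the form that the adjoint of [D_Cc] is single-valued. The
    derivatives of the kernels [ramp' k p] tested against 0 force the integrals of [v] against these
    kernels to vanish, and the kernels recover [v] at Lebesgue points. *)
Lemma adjoint_D_Cc_zero v : adjoint dot (D_Cc alpha beta) (0, v) -> v = 0.
Proof.
move=> adj; have [iv1 iv2] := integrable_parts v; have [i01 i02] := integrable_parts 0.
have zero (f g : R -> R) : leb.-integrable setT (EFin \o f) -> continuous g ->
    {ae leb, forall x, f x = 0} -> (\int[leb]_x (f x * g x) = 0)%R.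
  move=> fi cg f0; have mf : measurable_fun setT f by apply/measurable_EFinP; case/integrableP: fi.
  have mg := continuous_measurable_fun cg.
  rewrite /Rintegral (ae_eq_integral (cst 0%E)) ?integral0//.
    by apply/measurable_EFinP; apply: measurable_funM.
  have FF := ae_filter_ringOfSetsType leb.
  by apply: filterS f0 => x /= fx _; rewrite fx mul0r.
have [M _ rM] := ramp'_bounded R.
rewrite -[v]L2_reprK -[RHS]L2_class0; apply/L2_classP/(ae_mu_Omega n_gt0 ltab).
have FF := ae_filter_ringOfSetsType leb.
apply: filterS2 (ae_lebesgue_pt iv1) (ae_lebesgue_pt iv2) => p p1 p2 Op.
have [i _ /=] := Op; rewrite in_itv /= => /andP[ip pi'].
have test : \forall k \near \oo,
    (\int[leb]_x (re_part v x * ramp' k p x) = 0)%R /\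
    (\int[leb]_x (im_part v x * ramp' k p x) = 0)%R.
  have q0 : 0 < beta i - p by rewrite subr_gt0.
  have := near_infty_natSinv_lt (PosNum q0); apply: filterS => k /= kx.
  have {}kx : k.+1%:R^-1 < beta i - p := kx.
  have k0 : 0 < k.+1%:R^-1 :> R by rewrite invr_gt0.
  have sr : smooth (ramp' k p : R -> R).
    rewrite -derive1_ramp; apply: smooth_derive1; apply: ndiff_smooth => m.
    exact: ndiff_ramp.
  have [] := @weak_derivative_test _ _ _ i p (p + k.+1%:R^-1) adj sr ip _ _ (@ramp'0 R k p).
  - by rewrite lerDl ltW.
  - by rewrite -ltrBrDl.
  have cr := smooth_continuous (smooth_derive1 sr).
  rewrite (zero (re_part 0)) ?(zero (im_part 0))//; try exact: re_part0.2; try exact: re_part0.1.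
  have p0 := pi_gt0 R.
  move=> /esym/eqP; rewrite mulf_eq0 mulf_eq0 pnatr_eq0 (gt_eqF p0) /= => /eqP ->.
  by move=> /esym/eqP; rewrite oppr_eq0 mulf_eq0 mulf_eq0 pnatr_eq0 (gt_eqF p0) /= => /eqP ->.
have lim0 (f : R -> R) : (\int[leb]_x (f x * ramp' k p x))%R @[k --> \oo] --> f p ->
    (\forall k \near \oo, \int[leb]_x (f x * ramp' k p x) = 0)%R -> f p = 0.
  move=> h1 h2; apply: (cvg_unique (@norm_hausdorff _ _) h1).
  exact: cvg_near_cst.
have := lim0 _ (ramp'_lebesgue_pt iv1 p1) _; have := lim0 _ (ramp'_lebesgue_pt iv2 p2) _.
rewrite /re_part /im_part !patchE mem_set// => h2 h1.
apply: complex_eqP; [apply: h1|apply: h2]; apply: filterS test => k []; rewrite /re_part /im_part //.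
Qed.

End weak_derivative.

(** * Test functions, and exponentials in the domain of the adjoint *)

Section test_functions.
Context (R : realType) (n : nat) (alpha beta : 'I_n -> R).
Hypothesis n_gt0 : (0 < n)%N.
Hypothesis ltab : forall i, alpha i < beta i.
Hypothesis ltba : forall i j : 'I_n, (i < j)%N -> beta i < alpha j.
Local Notation mu := (mu_Omega alpha beta).
Local Notation Omega := (Omega alpha beta).
Local Notation dot := (@l2dot _ _ _ mu).
Implicit Types (u v : L2 mu) (f : R -> R[i]).

Lemma normC_le_ReIm (z : R[i]) : `|z| <= (`|Re z| + `|Im z|)%:C.
Proof.
case: z => a b; rewrite normc_def /= lecR -(@ler_sqr _ (Num.sqrt _)) ?nnegrE ?addr_ge0//.
rewrite sqr_sqrtr ?addr_ge0 ?sqr_ge0// sqrrD !real_normK ?num_real//.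
by rewrite -addrA lerD2l lerDr mulrn_wge0// mulr_ge0.
Qed.

Lemma acont_on_complex (K : set R) f : acont_on K (fun x => Re (f x)) ->
  acont_on K (fun x => Im (f x)) -> absolutely_continuous_on K f.
Proof.
move=> acr aci eps eps0; have e0 : 0 < eps / 2 by rewrite divr_gt0.
have [d1 d10 H1] := acr _ e0; have [d2 d20 H2] := aci _ e0.
exists (Num.min d1 d2); first by rewrite lt_min d10.
move=> m x y xy t; rewrite lt_min => /andP[xy1 xy2].
have h1 := H1 m x y xy t xy1; have h2 := H2 m x y xy t xy2.
apply: (@le_lt_trans _ _ (\sum_(k < m) (`|Re (f (y k)) - Re (f (x k))| +
    `|Im (f (y k)) - Im (f (x k))|)%:C)).
  apply: ler_sum => k _; apply: le_trans (normC_le_ReIm _) _.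
  by rewrite ReD ImD; case: (f (x k)).
by rewrite -rmorph_sum /= ltcR big_split /= (splitr eps) ltrD.
Qed.

Lemma smooth_acont_on (g : R -> R) (a b : R) : a <= b -> smooth g ->
  acont_on [set` `]a, b[] g.
Proof.
move=> ab sg.
have [|c _ cmax] := @EVT_max R (fun x => `|derive1 g x|) a b ab.
  apply: continuous_subspaceT => x; apply: cvg_norm.
  exact: smooth_continuous (smooth_derive1 sg) x.
apply: (@lipschitz_acont_on _ _ _ (`|derive1 g c|)) => x y.
rewrite /= !in_itv /= => /andP[ax xb] /andP[ay yb] xy.
have [||z zxy ->] := @MVT_segment R g (derive1 g) x y xy.
- by move=> z _; exact: smooth_is_derive.
- by apply: continuous_subspaceT; exact: smooth_continuous.
rewrite normrM (ger0_norm (_ : 0 <= y - x)) ?subr_ge0// ler_wpM2r ?subr_ge0//.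
apply: cmax; move: zxy; rewrite !in_itv /= => /andP[xz zy].
by rewrite (le_trans (ltW ax) xz) (le_trans zy (ltW yb)).
Qed.

Lemma endpoint_notin_Omega i : ~ Omega (alpha i) /\ ~ Omega (beta i).
Proof.
split=> -[j _ /=]; rewrite in_itv /= => /andP[j1 j2].
  have [ij|ij|/val_inj ij] := ltngtP i j; last by rewrite ij ltxx in j1.
    by have := lt_trans (ltab i) (lt_trans (ltba ij) j1); rewrite ltxx.
  by have := lt_trans (ltba ij) j2; rewrite ltxx.
have [ij|ij|/val_inj ij] := ltngtP i j; last by rewrite ij ltxx in j2.
  by have := lt_trans (ltba ij) j1; rewrite ltxx.
by have := lt_trans (ltba ij) (lt_trans (ltab i) j2); rewrite ltxx.
Qed.

(** A test function vanishes off [Omega], in particular at the endpoints, where continuity gives the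
    limits; smoothness on the whole line makes it Lipschitz on each interval. *)
Lemma test_function_D0 f : test_function alpha beta f ->
  (forall i, absolutely_continuous_on [set` `]alpha i, beta i[] f) /\
  (forall i, (f : R -> R[i]^o) x @[x --> (alpha i)^'+] --> (0 : R[i]^o) /\
             (f : R -> R[i]^o) x @[x --> (beta i)^'-] --> (0 : R[i]^o)).
Proof.
move=> [[sr si] _ sO]; split=> [i|].
  by apply: acont_on_complex; apply: smooth_acont_on => //; rewrite ltW.
have f0 x : ~ Omega x -> f x = 0.
  move=> Ox; apply/eqP; apply: contra_notT Ox => fx; apply: sO.
  exact: subset_closure.
have lim x : ~ Omega x -> (f : R -> R[i]^o) y @[y --> x] --> (0 : R[i]^o).
  move=> Ox; have fx := f0 _ Ox.
  have cr := @smooth_continuous R (fun x => Re (f x)) sr x.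
  have ci := @smooth_continuous R (fun x => Im (f x)) si x.
  apply/cvgrPdist_lt => eps /posC_real[e e0 ->].
  have e20 : 0 < e / 2 by rewrite divr_gt0.
  move/cvgrPdist_lt : cr => /(_ _ e20) cr; move/cvgrPdist_lt : ci => /(_ _ e20) ci.
  apply: filterS2 cr ci => y; rewrite fx /= !sub0r !normrN => ry iy.
  apply: le_lt_trans (normC_le_ReIm _) _.
  by rewrite ltcR (splitr e) ltrD.
move=> i; have [ai bi] := endpoint_notin_Omega i.
by split; [apply: cvg_at_right_filter|apply: cvg_at_left_filter]; exact: lim.
Qed.

Lemma D0_coef u : D0_Omega alpha beta u ->
  exists w, forall l, dot w (expL2 alpha beta l) = l%:C * dot u (expL2 alpha beta l).
Proof.
move=> [f [uf acf lf [v vf]]]; exists (((2 * pi)%:C * 'i%C)^-1 *: v) => l.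
apply: etrans (dotZl _ _ _ _) _; apply: etrans (congr1 _
  (dot_expL2_derive n_gt0 ltab ltba l uf vf acf lf)) _.
apply: (mulfI (twopi_i_neq0 R)); rewrite mulVKf ?twopi_i_neq0//.
by rewrite rmorphM /=; ring.
Qed.

Lemma D_Cc_coef (p : L2 mu * L2 mu) l : D_Cc alpha beta p ->
  dot p.2 (expL2 alpha beta l) = l%:C * dot p.1 (expL2 alpha beta l).
Proof.
move=> [f [tf p1f p2f]]; have [acf lf] := test_function_D0 tf.
have vf : represents (((2 * pi)%:C * 'i%C) *: p.2) (cderive f).
  rewrite /represents -[p.2]L2_reprK -L2_classZ.
  have := L2_reprP (((2 * pi)%:C * 'i%C) *: L2_repr p.2).
  apply: filterS2 p2f => x px ->; rewrite L2fun_scaleE px mulVKf ?twopi_i_neq0//.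
have := dot_expL2_derive n_gt0 ltab ltba l p1f vf acf lf.
move/(etrans (esym (dotZl _ _ _ _))) => E; apply: (mulfI (twopi_i_neq0 R)).
by rewrite E rmorphM /=; ring.
Qed.

(** By [D_Cc_coef] the pair (e_l, l e_l) also belongs to the adjoint, which is single-valued. *)
Lemma adjoint_D_Cc_exp l v : adjoint dot (D_Cc alpha beta) (expL2 alpha beta l, v) ->
  v = l%:C *: expL2 alpha beta l.
Proof.
move=> adj; apply/eqP; rewrite -subr_eq0; apply/eqP.
apply: (adjoint_D_Cc_zero n_gt0 ltab) => q Dq /=.
have lr : Num.conj (l%:C : R[i]) = l%:C by apply: complex_eqP; rewrite ?RecJ ?ImcJ /= ?oppr0.
have E1 : dot q.1 (v - l%:C *: expL2 alpha beta l) =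
    dot q.1 v - Num.conj l%:C * dot q.1 (expL2 alpha beta l).
  by apply: etrans (dotBr _ _ _ _) _; congr (_ - _); exact: dotZr.
rewrite E1 lr -(D_Cc_coef l Dq) -(adj _ Dq) subrr.
exact: dot0r.
Qed.

End test_functions.

(** * Compactness of the embedding of the domain *)

Section cell_averages.
Context (R : realType).
Local Notation leb := (@lebesgue_measure R).

(** A bounded real sequence converges along any ultrafilter, here up to a given tolerance. *)
Lemma ultra_bounded (U : set_system nat) (a : nat -> R) (B eta : R) : UltraFilter U ->
  (forall k, `|a k| <= B) -> 0 < eta -> exists l, U [set k | `|a k - l| < eta].
Proof.
move=> UU aB eta0; have PU : ProperFilter U := ultra_proper.
have [|l [_ al]] := @segment_compact R (- B) B (a @ U) _.
  by apply: nearW => k; rewrite /= in_itv /= -ler_norml.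
exists l; have [//|h] := in_ultra_setVsetC [set k | `|a k - l| < eta] UU.
have aU : (a @ U) [set y | ~ `|y - l| < eta] by exact: h.
have [y [ny yl]] := al _ _ aU (nbhsx_ballx l eta eta0).
by exfalso; apply: ny; move: yl; rewrite /ball /= distrC.
Qed.

Lemma integrable_cst_lt (D : set (measurableTypeR R)) (k : R) : measurable D ->
  (leb D < +oo)%E -> leb.-integrable D (EFin \o (fun=> k)).
Proof.
move=> mD Dlt; apply: measurable_bounded_integrable => //.
by exists `|k|; split=> [|y Ky x _ /=]; [exact: num_real|exact: ltW].
Qed.

Lemma Rintegral_cst_itv (k x y : R) : x <= y ->
  \int[leb]_(z in [set` `]x, y]]) k = k * (y - x).
Proof.
move=> xy; have mD : measurable ([set` `]x, y]] : set (measurableTypeR R)).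
  exact: measurable_itv.
have D : leb [set` `]x, y]] = (y - x)%:E; last first.
  by rewrite -[y - x]/(fine (y - x)%:E) -D; exact: Rintegral_cst.
rewrite lebesgue_measure_itv /= lte_fin; have [//|yx] := ltP x y.
by rewrite (@le_anti _ _ x y) ?subrr// xy yx.
Qed.

(* The weights [t] play the role of Hoelder's inequality: [2 |w| <= t + w^2 / t]. *)
Lemma Rintegral_itv_abs_le (w : R -> R) (M t x y : R) : 0 < t -> x <= y ->
  leb.-integrable setT (EFin \o w) -> leb.-integrable setT (EFin \o (fun z => w z ^+ 2)) ->
  \int[leb]_z (w z ^+ 2) <= M ->
  `|\int[leb]_(z in [set` `]x, y]]) w z| <= t / 2 * (y - x) + M / (2 * t).
Proof.
move=> t0 xy iw iw2 wM; pose D : set (measurableTypeR R) := [set` `]x, y]].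
have mD : measurable D by exact: measurable_itv.
have Dlt : leb D = (y - x)%:E.
  rewrite /D lebesgue_measure_itv /= lte_fin; have [//|yx] := ltP x y.
  by rewrite (@le_anti _ _ x y) ?subrr// xy yx.
have iwD : leb.-integrable D (EFin \o w) by exact: integrableS iw.
have iw2D : leb.-integrable D (EFin \o (fun z => w z ^+ 2)) by exact: integrableS iw2.
have ic : leb.-integrable D (EFin \o (fun=> t / 2)).
  by apply: integrable_cst_lt => //; rewrite Dlt ltry.
have i2 : leb.-integrable D (EFin \o (fun z => (2 * t)^-1 * w z ^+ 2)).
  by rewrite (_ : _ \o _ = (fun z => ((2 * t)^-1)%:E * (w z ^+ 2)%:E))%E; [exact: integrableZl|apply/funext].
apply: le_trans (le_normr_Rintegral mD iwD) _.
apply: (@le_trans _ _ (\int[leb]_(z in D) (t / 2 + (2 * t)^-1 * w z ^+ 2))).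
  apply: le_Rintegral => //.
  - exact: integrable_abse iwD.
  - by have := integrableD mD ic i2; apply: eq_integrable.
  - move=> z _; have t20 : 0 < 2 * t by rewrite mulr_gt0.
    have -> : t / 2 + (2 * t)^-1 * w z ^+ 2 = (t ^+ 2 + w z ^+ 2) / (2 * t).
      by field; rewrite gt_eqF.
    rewrite ler_pdivlMr// -[w z ^+ 2]real_normK ?num_real//.
    have := sqr_ge0 (`|w z| - t); nra.
rewrite RintegralD// Rintegral_cst_itv// RintegralZl// lerD2l mulrC.
rewrite ler_wpM2r ?invr_ge0 ?mulr_ge0 ?(ltW t0)//; apply: le_trans wM.
rewrite /Rintegral fine_le//; try exact: integrable_fin_num.
apply: ge0_subset_integral => //; first exact: measurable_int iw2.
by move=> z _; rewrite lee_fin sqr_ge0.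
Qed.

Lemma cell_average_le (f : R -> R) (c d x K : R) : c < d ->
  leb.-integrable setT (EFin \o f) -> 0 <= K ->
  {ae leb, forall y, c < y <= d -> `|f x - f y| <= K} ->
  `|(d - c) * f x - \int[leb]_(z in [set` `]c, d]]) f z| <= (d - c) * K.
Proof.
move=> cd fi K0 fK; pose D : set (measurableTypeR R) := [set` `]c, d]].
have mD : measurable D by exact: measurable_itv.
have Dlt : leb D = (d - c)%:E by rewrite /D lebesgue_measure_itv /= lte_fin cd.
have fD : leb.-integrable D (EFin \o f) by exact: integrableS fi.
have ic (k : R) : leb.-integrable D (EFin \o (fun=> k)).
  by apply: integrable_cst_lt => //; rewrite Dlt ltry.
have -> : (d - c) * f x - \int[leb]_(z in D) f z = \int[leb]_(z in D) (f x - f z).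
  by rewrite (RintegralB mD (ic (f x)) fD) Rintegral_cst_itv ?(ltW cd)// mulrC.
have iB : leb.-integrable D (EFin \o (fun z => f x - f z)).
  by have := integrableB mD (ic (f x)) fD; apply: eq_integrable.
apply: le_trans (le_normr_Rintegral mD iB) _.
have -> : (d - c) * K = \int[leb]_(z in D) K by rewrite Rintegral_cst_itv ?(ltW cd)// mulrC.
have iBa : leb.-integrable D (EFin \o (fun z => `|f x - f z|)) by exact: integrable_abse iB.
rewrite /Rintegral fine_le//; [exact: integrable_fin_num|exact: integrable_fin_num (ic K)|].
apply: ae_ge0_le_integral => //.
  exact: measurable_int iBa.
Qed.

Lemma in_some_cell (a h x : R) m : 0 < h -> a < x <= a + m%:R * h ->
  exists j : 'I_m, a + j%:R * h < x <= a + j.+1%:R * h.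
Proof.
move=> h0; elim: m => [|m IH]; first by rewrite mul0r addr0 => /andP[ax /(lt_le_trans ax)]; rewrite ltxx.
have [xm|mx] := leP x (a + m%:R * h).
  by move=> /andP[ax _]; have [|j jx] := IH; [rewrite ax|exists (widen_ord (leqnSn m) j)].
by move=> /andP[_ xm]; exists ord_max; rewrite mx.
Qed.

End cell_averages.

Section compact_resolvent.
Context (R : realType) (n : nat) (alpha beta : 'I_n -> R).
Hypothesis n_gt0 : (0 < n)%N.
Hypothesis ltab : forall i, alpha i < beta i.
Local Notation leb := (@lebesgue_measure R).
Local Notation mu := (mu_Omega alpha beta).
Local Notation Omega := (Omega alpha beta).
Local Notation dot := (@l2dot _ _ _ mu).
Local Notation sqn := (sqn dot).
Implicit Types (u v : L2 mu).

Lemma mu_Omega_setT : mu setT = 1%E.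
Proof.
rewrite mu_OmegaE setTI /ivol; have := ivol_gt0 n_gt0 ltab; rewrite /ivol.
have : (leb Omega \is a fin_num).
  by rewrite ge0_fin_numE//; exact: Omega_lty.
move/fineK => E; rewrite -[in X in _ -> X]E => v0; rewrite /= -EFinM mulVf//.
by move: v0; rewrite invr_gt0 => /lt0r_neq0.
Qed.

Definition part (b : bool) u := if b then re_part u else im_part u.

Lemma part_sqr_le b u :
  (\int[leb]_x ((part b u x) ^+ 2)%:E <= (sqn u / ivol alpha beta)%:E)%E.
Proof.
have mO := measurable_Omega alpha beta; have K0 := ivol_gt0 n_gt0 ltab.
have mn := measurable_normsq (cmeasurable_L2fun (L2_repr u)).
have E : (\int[leb]_(x in Omega) (normsq (L2_repr u x))%:E)%E = (sqn u / ivol alpha beta)%:E.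
  have := sqn_L2_class (L2_repr u); rewrite L2_reprK ge0_integral_mu_Omega; last 2 first.
  - exact/measurable_EFinP.
  - by move=> x; rewrite lee_fin normsq_ge0.
  have : (0 <= \int[leb]_(x in Omega) (normsq (L2_repr u x))%:E)%E.
    by apply: integral_ge0 => x _; rewrite lee_fin normsq_ge0.
  move: (ivol alpha beta) K0 => K K0.
  case: (\int[leb]_(x in Omega) (normsq (L2_repr u x))%:E)%E => [s||]// _.
    by rewrite -EFinM => -[->]; rewrite mulrC mulrA mulVf ?mul1r// gt_eqF.
  by rewrite gt0_muley// lte_fin.
rewrite -E [leRHS]integral_mkcond.
have mp : measurable_fun setT (part b u).
  have [/integrableP[m1 _] /integrableP[m2 _]] := integrable_parts n_gt0 ltab u.
  by apply/measurable_EFinP; rewrite /part; case: b.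
apply: ge0_le_integral => //.
- by move=> x _; rewrite lee_fin sqr_ge0.
- by apply/measurable_EFinP; exact: measurable_funX.
- by apply/(measurable_restrictT _ mO); apply/measurable_EFinP; exact: measurable_funTS.
- move=> x _; rewrite /part /re_part /im_part; case: (b); rewrite !patchE; case: ifPn => _;
    rewrite lee_fin /normsq ?expr0n// ?lerDl ?lerDr sqr_ge0//.
Qed.

Lemma integrable_part b u : leb.-integrable setT (EFin \o part b u).
Proof. by have [? ?] := integrable_parts n_gt0 ltab u; rewrite /part; case: b. Qed.

Lemma integrable_part_sqr b u : leb.-integrable setT (EFin \o (fun x => part b u x ^+ 2)).
Proof.
have /integrableP[mp _] := integrable_part b u.
apply/integrableP; split.
  by apply/measurable_EFinP; apply: measurable_funX; exact/measurable_EFinP.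
under eq_integral do rewrite gee0_abs ?lee_fin ?sqr_ge0//.
by apply: le_lt_trans (part_sqr_le b u) _; rewrite ltry.
Qed.

Lemma Rintegral_part_sqr_le b u : \int[leb]_x (part b u x ^+ 2) <= sqn u / ivol alpha beta.
Proof.
rewrite -lee_fin fineK; first exact: part_sqr_le.
by apply: integrable_fin_num => //; exact: integrable_part_sqr.
Qed.

(** For almost all x < y in the cell, [weak_derivative] writes the increment of [u] as an integral
    of [v], which [Rintegral_itv_abs_le] bounds; integrating over y compares the value at x with the
    mean over the cell. *)
Lemma cell_oscillation u v (M t c d : R) b i : adjoint dot (D_Cc alpha beta) (u, v) ->
  sqn v / ivol alpha beta <= M -> 0 < t -> alpha i <= c -> c < d -> d <= beta i ->
  {ae leb, forall x, c < x <= d ->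
    `|(d - c) * part b u x - \int[leb]_(z in [set` `]c, d]]) part b u z| <=
    (d - c) * (t / 2 * (d - c) + (2 * pi) ^+ 2 * M / (2 * t))}.
Proof.
move=> adj vM t0 ic cd di; have [iu1 iu2] := integrable_parts n_gt0 ltab u.
have M0 : 0 <= M by rewrite (le_trans _ vM)// divr_ge0 ?sqn_ge0// ltW// (ivol_gt0 n_gt0 ltab).
(* [weak_derivative] wants points strictly inside the interval, whereas the last cell may contain
   [beta i]; this single point is discarded. *)
pose G x := [/\ lebesgue_pt (re_part u) x, lebesgue_pt (im_part u) x & x != beta i].
have FF := ae_filter_ringOfSetsType leb.
have aG : {ae leb, forall x, G x}.
  have ab : {ae leb, forall x, x != beta i}.
    exists [set beta i]; split => //; first exact: lebesgue_measure_set1.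
    by move=> x /= /negP; rewrite negbK => /eqP.
  by apply: filterS3 (ae_lebesgue_pt iu1) (ae_lebesgue_pt iu2) ab.
pose K := t / 2 * (d - c) + (2 * pi) ^+ 2 * M / (2 * t).
have osc x y : G x -> G y -> c < x -> x < y -> y <= d -> `|part b u x - part b u y| <= K.
  (* The real part of [u] varies with the imaginary part of [v] and conversely, hence [~~ b]; the
     sign in [s] disappears on squaring. *)
  move=> [x1 x2 _] [y1 y2 yb] cx xy yd; pose s : R := if b then - (2 * pi) else 2 * pi.
  have -> : `|part b u x - part b u y| = `|\int[leb]_(z in [set` `]x, y]]) (s * part (~~ b) v z)|.
    rewrite distrC RintegralZl//; last first.
      by apply: integrableS (integrable_part _ _) => //; exact: measurable_itv.
    have [] := weak_derivative n_gt0 ltab adj (le_lt_trans ic cx) xy _ (And4 x1 y1 x2 y2).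
      by rewrite lt_neqAle yb (le_trans yd).
    by rewrite /part /s => e1 e2; case: (b); rewrite /= ?e1 ?e2 ?mulNr.
  have is1 : leb.-integrable setT (EFin \o (fun z => s * part (~~ b) v z)).
    by have := integrableZl measurableT s (integrable_part (~~ b) v); apply: eq_integrable.
  have s2 z : (s * part (~~ b) v z) ^+ 2 = (2 * pi) ^+ 2 * part (~~ b) v z ^+ 2.
    by rewrite exprMn /s; case: (b); rewrite ?sqrrN.
  have is2 : leb.-integrable setT (EFin \o (fun z => (s * part (~~ b) v z) ^+ 2)).
    have := integrableZl measurableT ((2 * pi) ^+ 2) (integrable_part_sqr (~~ b) v).
    by apply: eq_integrable => // z _; rewrite /= s2.
  have h := Rintegral_itv_abs_le t0 (ltW xy) is1 is2 (lexx _).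
  apply: le_trans h _; rewrite /K lerD//.
    by rewrite ler_wpM2l ?divr_ge0 ?(ltW t0)//; lra.
  rewrite ler_wpM2r ?invr_ge0 ?mulr_ge0 ?(ltW t0)//.
  under eq_Rintegral do rewrite s2.
  rewrite RintegralZl//; last exact: integrable_part_sqr.
  by rewrite ler_wpM2l ?sqr_ge0//; apply: le_trans vM; exact: Rintegral_part_sqr_le.
have K0 : 0 <= K.
  apply: addr_ge0; apply: mulr_ge0; rewrite ?invr_ge0 ?subr_ge0 ?(ltW cd)//.
  - by rewrite divr_ge0// ltW.
  - by rewrite mulr_ge0 ?sqr_ge0.
  - by rewrite mulr_ge0// ltW.
apply: filterS (aG) => x Gx /andP[cx xd].
apply: cell_average_le => //; first exact: integrable_part.
apply: filterS aG => y Gy /andP[cy yd].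
have [xy|yx|->] := ltgtP x y; last by rewrite subrr normr0.
- exact: osc.
- by rewrite distrC; exact: osc.
Qed.

Lemma compact_graph_adjoint (A : set (L2 mu * L2 mu)) :
  A `<=` adjoint dot (D_Cc alpha beta) ->
  forall (x y : nat -> L2 mu) (M : R),
  (forall k, [/\ A (x k, y k), sqn (x k) <= M & sqn (y k) <= M]) ->
  forall U : set_system nat, UltraFilter U -> forall eps : R, 0 < eps ->
  exists2 S, U S & forall k l, S k -> S l -> sqn (x k - x l) < eps.
Proof.
move=> Aadj x y M bnd U UU eps eps0; have PU : ProperFilter U by exact: ultra_proper.
have K0 := ivol_gt0 n_gt0 ltab.
pose P := M / ivol alpha beta.
have uP k : sqn (x k) / ivol alpha beta <= P.
  by apply: ler_wpM2r; [rewrite invr_ge0 ltW|case: (bnd k)].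
have vP k : sqn (y k) / ivol alpha beta <= P.
  by apply: ler_wpM2r; [rewrite invr_ge0 ltW|case: (bnd k)].
have P0 : 0 <= P by rewrite (le_trans _ (uP 0%N))// divr_ge0 ?sqn_ge0// ltW.
(* Both parts will differ by at most [r] almost everywhere on [Omega]; as [mu] has mass 1, the
   squared distance is then at most 2 r^2. *)
have [r [r0 r2]] : exists r : R, 0 < r /\ 2 * r ^+ 2 < eps.
  exists (Num.min 1 (eps / 4)); have e4 : 0 < eps / 4 by rewrite divr_gt0.
  split; first by rewrite lt_min ltr01.
  by rewrite /Num.min; case: ifP => h; nra.
pose P2 := (2 * pi) ^+ 2 * P; have P20 : 0 <= P2 by rewrite mulr_ge0 ?sqr_ge0.
(* The oscillation bound has two terms. [t] brings the one independent of the mesh below r / 8, then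
   [m] does the same for the one proportional to the mesh. The 1 keeps [t] positive when
   [P2 = 0]. *)
pose t := 4 * P2 / r + 1.
have t0 : 0 < t.
  by apply: ltr_wpDl => //; apply: divr_ge0; [exact: mulr_ge0|exact: ltW].
have tP : P2 / (2 * t) <= r / 8.
  rewrite ler_pdivrMr ?mulr_gt0//.
  have -> : r / 8 * (2 * t) = P2 + r / 4 by rewrite /t; field; rewrite gt_eqF.
  by rewrite lerDl divr_ge0// ltW.
pose L := \sum_i (beta i - alpha i).
have L_ge i : beta i - alpha i <= L.
  rewrite /L (bigD1 i)//= lerDl sumr_ge0// => j _; by rewrite subr_ge0 ltW.
pose m := (Num.truncn (4 * t * L / r)).+1.
have mL : 4 * t * L / r < m%:R by exact: truncnS_gt.
have m0 : 0 < m%:R :> R by rewrite ltr0n.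
pose h i := (beta i - alpha i) / m%:R.
have h0 i : 0 < h i by rewrite divr_gt0// subr_gt0.
have ht i : t / 2 * h i <= r / 8.
  have : (4 * t) * h i <= r.
    rewrite /h mulrA ler_pdivrMr//; move: mL; rewrite ltr_pdivrMr// mulrC => mL.
    rewrite [leRHS]mulrC; apply: le_trans (ltW mL); rewrite mulrC.
    by apply: ler_wpM2l => //; apply: mulr_ge0 => //; exact: ltW.
  by move: (h i) (t) => hi tt *; lra.
pose c i (j : nat) := alpha i + j%:R * h i.
have cS i j : c i j.+1 - c i j = h i by rewrite /c -addn1 natrD; ring.
have c_ge i j : alpha i <= c i j by rewrite /c lerDl mulr_ge0// ltW.
have c_lt i j : c i j < c i j.+1 by rewrite -subr_gt0 cS.
have c_le i (j : 'I_m) : c i j.+1 <= beta i.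
  rewrite /c -lerBrDl; have -> : beta i - alpha i = m%:R * h i by rewrite /h mulrC divfK// gt_eqF.
  by rewrite ler_pM2r// ler_nat.
pose a k (p : 'I_n * 'I_m * bool) :=
  \int[leb]_(z in [set` `]c p.1.1 p.1.2, c p.1.1 p.1.2.+1]]) part p.2 (x k) z.
have a_lim p : exists l, U [set k | `|a k p - l| < h p.1.1 * (r / 4)].
  apply: (@ultra_bounded R U (a ^~ p) (1 / 2 * h p.1.1 + P / (2 * 1))) => //; last first.
    by rewrite mulr_gt0// divr_gt0.
  move=> k; rewrite /a -(cS p.1.1 p.1.2).
  apply: Rintegral_itv_abs_le => //; [exact: ltW|exact: integrable_part|exact: integrable_part_sqr|].
  by apply: le_trans (uP k); exact: Rintegral_part_sqr_le.
have {a_lim} [lim limP] := choice a_lim.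
exists [set k | forall p, `|a k p - lim p| < h p.1.1 * (r / 4)].
  exact: filter_forall.
move=> k l Sk Sl; apply: le_lt_trans r2.
rewrite -lee_fin -(L2_reprK (x k)) sqn_L2_sub.
have FF := ae_filter_ringOfSetsType leb.
have osc k0 : {ae leb, forall z, forall p : 'I_n * 'I_m * bool,
    c p.1.1 p.1.2 < z <= c p.1.1 p.1.2.+1 ->
    `|h p.1.1 * part p.2 (x k0) z - a k0 p| <= h p.1.1 * (r / 4)}.
  apply: filter_forall => p; have [Ak _ _] := bnd k0.
  have := cell_oscillation p.2 (Aadj _ Ak) (vP k0) t0 (c_ge p.1.1 p.1.2) (c_lt _ _) (c_le _ _).
  rewrite cS; apply: filterS => z zP /zP; move=> h1; apply: le_trans h1 _.
  rewrite ler_wpM2l ?(ltW (h0 _))// -/P2; have := ht p.1.1; move: tP.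
  by move: (P2 / (2 * t)) (t / 2 * _) => X Y *; lra.
have close : {ae mu, forall z, normsq (L2_repr (x k) z - L2_repr (x l) z) <= 2 * r ^+ 2}.
  apply/(ae_mu_Omega n_gt0 ltab); apply: filterS2 (osc k) (osc l) => z zk zl Oz.
  have [i _ /=] := Oz; rewrite in_itv /= => /andP[iz zi].
  have [|j jz] := @in_some_cell R (alpha i) (h i) z m (h0 i).
    by rewrite iz /h mulrC divfK ?gt_eqF// addrC subrK ltW.
  (* Four errors of r / 4: each of the two functions against its cell average, and each average
     against the common limit. *)
  have bP b : `|part b (x k) z - part b (x l) z| <= r.
    rewrite -(ler_pM2l (h0 i)) -[X in X * `|_|](gtr0_norm (h0 i)) -normrM mulrBr.
    have := zk (i, j, b) jz; have := zl (i, j, b) jz; have := Sk (i, j, b); have := Sl (i, j, b) => /=.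
    move: (a k _) (a l _) (lim _) (part _ _ _) (part _ _ _) => ak al li fl fk.
    move: (h i) => hi; rewrite !ltr_norml !ler_norml.
    by move=> /andP[? ?] /andP[? ?] /andP[? ?] /andP[? ?]; apply/andP; split; lra.
  have := bP true; have := bP false; rewrite /part /re_part /im_part !patchE mem_set//.
  move=> b2 b1; have r00 := ltW r0.
  have sq (p : R) : `|p| <= r -> p ^+ 2 <= r ^+ 2.
    by move=> pr; rewrite -[p ^+ 2]real_normK ?num_real// ler_sqr.
  rewrite (_ : 2 * r ^+ 2 = r ^+ 2 + r ^+ 2); last by rewrite mulr_natl mulr2n.
  rewrite /normsq ReD ImD lerD//; apply: sq.
    by move: b1; case: (L2_repr (x l) z).
  by move: b2; case: (L2_repr (x l) z).
apply: (@le_trans _ _ (\int[mu]_z (2 * r ^+ 2)%:E)%E); last first.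
  by rewrite integral_cst// mu_Omega_setT mule1.
apply: ae_ge0_le_integral => //.
- by move=> z _; rewrite lee_fin normsq_ge0.
- by apply/measurable_EFinP/measurable_normsq; exact: cmeasurable_L2fun (L2_repr (x k) - L2_repr (x l)).
- by move=> z _; rewrite lee_fin mulr_ge0// sqr_ge0.
- by apply: filterS close => z zr _; rewrite lee_fin.
Qed.

End compact_resolvent.

(** * Spectral sets *)

Section exponentials.
Context (R : realType) (n : nat) (alpha beta : 'I_n -> R).
Hypothesis n_gt0 : (0 < n)%N.
Hypothesis ltab : forall i, alpha i < beta i.
Local Notation mu := (mu_Omega alpha beta).
Local Notation Omega := (Omega alpha beta).
Local Notation dot := (@l2dot _ _ _ mu).
Local Notation e := (expL2 alpha beta).

Lemma continuous_mulr (w : R) : continuous (fun x : R => w * x).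
Proof. by move=> x; apply: cvgM; [exact: cvg_cst|exact: cvg_id]. Qed.

Lemma Re_dot_exp (l m : R) : Re (dot (e l) (e m)) = \int[mu]_x cos (2 * pi * (l - m) * x).
Proof.
apply: etrans (congr1 (@complex.Re R) (l2dotE _ _)) _.
apply: eq_Rintegral => x _; rewrite ReM RecJ ImcJ /expi /=.
rewrite mulrN opprK -cosB; congr cos; ring.
Qed.

Lemma dot_exp_exp (l : R) : dot (e l) (e l) = 1.
Proof.
have m1 : fine (mu setT) = 1 by rewrite (mu_Omega_setT n_gt0 ltab).
apply: complex_eqP.
  rewrite Re_dot_exp; have one : \int[mu]_(x in setT) (1 : R) = 1 by rewrite Rintegral_cst// m1 mulr1.
  by apply: etrans one; apply: eq_Rintegral => x _; rewrite subrr mulr0 mul0r cos0.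
apply: etrans (congr1 (@complex.Im R) (l2dotE _ _)) _.
have zero : \int[mu]_(x in setT) (0 : R) = 0 by rewrite Rintegral_cst// mul0r.
apply: etrans zero; apply: eq_Rintegral => x _; rewrite ImM RecJ ImcJ /expi /=; ring.
Qed.

Lemma exp_neq0 (l : R) : e l != 0.
Proof.
apply/eqP => e0; have := dot_exp_exp l; rewrite {1}e0.
by move=> /(etrans (esym (dot0l _ _))) /eqP; rewrite eq_sym oner_eq0.
Qed.

Lemma Omega_bounded : exists2 B : R, 0 < B & forall x, Omega x -> `|x| <= B.
Proof.
exists (1 + \sum_i (`|alpha i| + `|beta i|)).
  by rewrite ltr_pwDl// sumr_ge0// => i _; rewrite addr_ge0.
move=> x [i _ /=]; rewrite in_itv /= => /andP[ax xb].
apply: (@le_trans _ _ (`|alpha i| + `|beta i|)); last first.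
  rewrite (bigD1 i)//= addrCA lerDl addr_ge0//.
  by apply: sumr_ge0 => j _; rewrite addr_ge0.
have := ler_norm (beta i); have := ler_norm (- alpha i); rewrite normrN.
have := normr_ge0 (alpha i); have := normr_ge0 (beta i).
by rewrite ler_norml => *; apply/andP; split; lra.
Qed.

(* [Re <e_l, e_m>] is the mean over the bounded set [Omega] of
   [cos (2 pi (l - m) x)], hence close to 1 when [l - m] is small. *)
Lemma exp_separated : exists2 rho : R, 0 < rho &
  forall l m, `|l - m| < rho -> dot (e l) (e m) != 0.
Proof.
have [B B0 OB] := Omega_bounded.
have /cvgrPdist_lt /(_ (1 / 2)) := @continuous_cos R 0.
case=> [//|d /= d0 dcos]; have p0 := pi_gt0 R.
have b0 : 0 < 2 * pi * B by rewrite !mulr_gt0.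
(* Below this gap the phase 2 pi (l - m) x stays under [d] on [Omega], where the cosine exceeds 1 /
   2. *)
exists (d / (2 * pi * B)); first by rewrite divr_gt0.
move=> l m; rewrite ltr_pdivlMr// => lm.
have cc (w : R) : continuous (fun x => cos (w * x)).
  by move=> x; apply: (continuous_comp (@continuous_mulr w x)); exact: continuous_cos.
pose w := 2 * pi * (l - m).
have ic : mu.-integrable setT (EFin \o (fun x => cos (w * x))).
  apply: measurable_bounded_integrable => //.
  - by rewrite (mu_Omega_setT n_gt0 ltab) ltry.
  - exact: continuous_measurable_fun.
  - exists 1; split=> [|y y1 x _ /=]; first exact: num_real.
    by rewrite (le_trans _ (ltW y1))// ler_norml cos_geN1 cos_le1.
have i2 : mu.-integrable setT (EFin \o (fun x : R => 1 / 2 : R)).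
  apply: measurable_bounded_integrable => //.
  - by rewrite (mu_Omega_setT n_gt0 ltab) ltry.
  - by exists (1 / 2); split=> [|y y1 x _ /=]; [exact: num_real|rewrite ger0_norm ?ltW].
have : 1 / 2 <= Re (dot (e l) (e m)).
  rewrite Re_dot_exp -/w -[leLHS]mulr1.
  rewrite (_ : 1 / 2 * 1 = \int[mu]_(x in setT) (1 / 2)); last first.
    by rewrite Rintegral_cst// (mu_Omega_setT n_gt0 ltab).
  rewrite !(Rintegral_mu_Omega n_gt0 ltab)// ler_wpM2l ?(ltW (ivol_gt0 n_gt0 ltab))//.
  apply: le_Rintegral; first exact: measurable_Omega.
  - exact: integrable_mu_Omega.
  - exact: integrable_mu_Omega.
  - move=> x /OB xB; have := dcos (w * x); rewrite /= sub0r normrN cos0.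
    have wx : `|w * x| < d.
      apply: le_lt_trans lm; rewrite /w !normrM (gtr0_norm p0) (@gtr0_norm _ 2)//.
      rewrite [leRHS](_ : _ = 2 * pi * `|l - m| * B); last by ring.
      by rewrite ler_wpM2l// !mulr_ge0// ltW.
    by move=> /(_ wx); rewrite ltr_norml => /andP[]; lra.
by move=> h; apply/eqP => h0; move: h; rewrite h0 /=; lra.
Qed.

(** If z is not real, its imaginary part bounds the distance. Otherwise at most one [lam i] is
    within rho / 2 of z, and that one differs from z. *)
Lemma separated_spectrum (I : choiceType) (lam : I -> R) (rho : R) : 0 < rho ->
  (forall i j, i != j -> rho <= `|lam i - lam j|) ->
  forall z : R[i], (forall i, (lam i)%:C != z) ->
  exists2 c : R, 0 < c & forall i, c <= normsq ((lam i)%:C - z).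
Proof.
move=> rho0 sep [a b] az.
have E i : normsq ((lam i)%:C - (a +i* b)) = (lam i - a) ^+ 2 + b ^+ 2.
  by rewrite /normsq /= sub0r sqrrN.
have [b0|b0] := eqVneq b 0; last first.
  exists (b ^+ 2); first by rewrite exprn_even_gt0.
  by move=> i; rewrite E lerDr sqr_ge0.
have r2 : 0 < (rho / 2) ^+ 2 by rewrite exprn_gt0// divr_gt0.
have far i : rho / 2 <= `|lam i - a| -> (rho / 2) ^+ 2 <= normsq ((lam i)%:C - (a +i* b)).
  move=> h; rewrite E b0 expr0n addr0 -[leRHS]real_normK ?num_real//.
  by rewrite ler_sqr ?nnegrE// divr_ge0// ltW.
have [[i0 i0a]|none] := pselect (exists i0, `|lam i0 - a| < rho / 2); last first.
  exists ((rho / 2) ^+ 2) => // i; apply: far; rewrite leNgt; apply/negP => h.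
  by apply: none; exists i.
have i00 : lam i0 - a != 0.
  by apply/eqP => h; have /negP := az i0; apply; rewrite b0 -(subr0_eq h).
exists (Num.min ((rho / 2) ^+ 2) ((lam i0 - a) ^+ 2)).
  by rewrite lt_min r2 exprn_even_gt0.
move=> i; have [->|ii0] := eqVneq i i0; first by rewrite E ge_min lerDl sqr_ge0 orbT.
rewrite ge_min far//; have := sep _ _ ii0.
have := ler_normD (lam i - a) (a - lam i0); rewrite addrA subrK (distrC a).
by move: (`|lam i - a|) (`|lam i0 - a|) i0a (`|lam i - lam i0|) => *; lra.
Qed.

End exponentials.

Section spectral_set.
Context (R : realType) (n : nat) (alpha beta : 'I_n -> R).
Hypothesis n_gt0 : (0 < n)%N.
Hypothesis ltab : forall i, alpha i < beta i.
Hypothesis ltba : forall i j : 'I_n, (i < j)%N -> beta i < alpha j.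
Local Notation mu := (mu_Omega alpha beta).
Local Notation H := (L2 mu).
Local Notation dot := (@l2dot _ _ _ mu).
Local Notation e := (expL2 alpha beta).
Let normE (u : H) : `|u| = sqrtC (dot u u) := l2normE u.
Let complete (F : set_system H) : ProperFilter F -> cauchy F -> cvg F := @L2_complete _ _ _ _ F.

Section forward.
Variable Lambda : set R.
Hypothesis spec : is_spectrum alpha beta Lambda.
Local Notation A := (spectral_op alpha beta Lambda).
Local Notation eL := (fun l : Lambda => e (val l)).
Local Notation lam := (fun l : Lambda => val l).

Lemma spectrum_orthonormal (i j : Lambda) : dot (eL i) (eL j) = (i == j)%:R.
Proof.
have [_ orth _] := spec.
have [->|ij] := eqVneq i j; first exact: dot_exp_exp.
exact: orth.
Qed.

Lemma spectrum_total u : (forall l : Lambda, dot u (eL l) = 0) -> u = 0.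
Proof. by have [_ _ dns] := spec; move=> h; exact: (span_total normE dns h). Qed.

Let orth := spectrum_orthonormal.
Let total := spectrum_total.

Lemma spectral_opP u v : A (u, v) <->
  forall l : Lambda, dot v (eL l) = (val l)%:C * dot u (eL l).
Proof. exact: (diag_opP normE complete lam orth total u v). Qed.

Lemma fourier_is_unitary : fourier_unitary alpha beta Lambda.
Proof.
split.
- by move=> a u v; apply/funext => l; exact: l2dotZDl.
- split.
  + by move=> u _; apply: le_lt_trans (bessel_esum (e := eL) orth u) _; rewrite ltry.
  + move=> u v _ _ uv; apply: (coef_inj total) => l.
    exact: (congr1 (fun f : Lambda -> R[i] => f l) uv).
  + move=> a al; have [s asum] := riesz_fischer normE complete orth al.
    exists s => //; apply/funext => l; exact: (hassum_coef normE orth l asum).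
- move=> u; apply: (parseval normE orth (a := fun l => dot u (eL l))).
  exact: (hassum_of_coef normE complete orth total (u := u) (fun=> erefl)).
Qed.

Lemma spectral_op_fourier :
  A = ((fourier_op alpha beta Lambda)^-1 \; mult_id Lambda \; fourier_op alpha beta Lambda)%relation.
Proof.
apply/seteqP; split=> -[u v].
  move=> /spectral_opP uv.
  have bes w : l2_Lambda Lambda (fourier alpha beta Lambda w).
    by apply: le_lt_trans (bessel_esum (e := eL) orth w) _; rewrite ltry.
  exists (fourier alpha beta Lambda v) => //=; exists (fourier alpha beta Lambda u) => //=.
  have E : fourier alpha beta Lambda v = (fun l => (val l)%:C * fourier alpha beta Lambda u l).
    by apply/funext => l; exact: uv.
  split=> //; first exact: bes.
  (* The weighted sum for [u] is the plain sum for [v], finite by Bessel's inequality. *)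
  have := bes v; rewrite E /l2_Lambda /wl2_Lambda /=.
  by under eq_esum do rewrite normsqCM.
move=> [b [a /= ua [/= _ _ ba]] vb]; apply/spectral_opP => l.
apply: etrans (esym (congr1 (fun f : Lambda -> R[i] => f l) vb)) _.
rewrite /= ba; congr (_ * _); exact: (congr1 (fun f : Lambda -> R[i] => f l) ua).
Qed.

(** Coefficientwise z u_l = l u_l: a nonzero coefficient forces z = l, so there is only one. *)
Lemma spectral_op_eigenvector z u : eigenvector A z u ->
  exists c l, Lambda l /\ u = c *: e l.
Proof.
move=> [u0 /spectral_opP uz].
have zl l : dot u (eL l) != 0 -> z = (val l)%:C.
  move=> ul; apply: (mulIf ul); rewrite -(uz l); apply/esym; exact: dotZl.
have [[l ul]|none] := pselect (exists l, dot u (eL l) != 0); last first.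
  exfalso; move/eqP : u0; apply; apply: spectrum_total => l.
  by apply/eqP; apply/negP => /negP ul; apply: none; exists l.
exists (dot u (eL l)), (val l); split; first exact: set_valP.
apply: (coef_inj total) => m.
apply: etrans _ (esym (dotZl _ _ _ _)); apply: etrans _ (congr1 _ (esym (orth l m))).
have [<-|lm] := eqVneq l m; first by rewrite mulr1.
rewrite mulr0; apply/eqP; apply/negP => /negP um.
have := zl _ um; rewrite (zl _ ul) => /(congr1 (@complex.Re R)) /= /val_inj /eqP.
by rewrite (negbTE lm).
Qed.

Lemma spectral_set_forward :
    let F := fourier_op alpha beta Lambda in
    [/\ op_domain A = [set u | exists2 f : Lambda -> R[i],
          hassum (fun l => f l *: expL2 alpha beta (val l)) u &
          wl2_Lambda Lambda f],
        fourier_unitary alpha beta Lambda &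
        A = (F^-1 \; mult_id Lambda \; F)%relation] /\
    [/\ D0_Omega alpha beta `<=` op_domain A,
        (forall l, Lambda l -> op_domain A (expL2 alpha beta l)),
        self_adjoint (@l2dot _ _ _ (mu_Omega alpha beta)) A,
        D_Cc alpha beta `<=` A &
        forall z u, eigenvector A z u ->
          exists c l, Lambda l /\ u = c *: expL2 alpha beta l].
Proof.
split; split.
- exact: (diag_op_domain normE complete lam orth).
- exact: fourier_is_unitary.
- exact: spectral_op_fourier.
- move=> u /(D0_coef n_gt0 ltab ltba) [w uw]; exists w; apply/spectral_opP => l.
  exact: uw.
- move=> l Ll; exists (l%:C *: e l).
  exact: (diag_op_basis normE complete lam orth total (SigSub (mem_set Ll))).
- exact: (diag_op_self_adjoint normE complete lam orth total).
- by move=> [u v] uv; apply/spectral_opP => l; exact: (D_Cc_coef n_gt0 ltab ltba (val l) uv).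
- exact: spectral_op_eigenvector.
Qed.

End forward.

Section converse.
Variable A : set (H * H).
Hypothesis sA : self_adjoint dot A.
Hypothesis DA : D_Cc alpha beta `<=` A.
Hypothesis eigA : forall z u, eigenvector A z u -> exists c l, u = c *: e l.
Let Lambda := [set l | op_domain A (e l)].
Local Notation eL := (fun l : Lambda => e (val l)).
Local Notation lam := (fun l : Lambda => val l).

(** Taking adjoints reverses the inclusion [DA], and [A] is its own adjoint. *)
Lemma extension_sub_adjoint : A `<=` adjoint dot (D_Cc alpha beta).
Proof. by have [_ _ AE] := sA; move=> p; rewrite -{1}AE => Ap q /DA; exact: Ap. Qed.

Lemma extension_exp (l : R) : op_domain A (e l) -> A (e l, l%:C *: e l).
Proof.
move=> [v ev].
by rewrite -(adjoint_D_Cc_exp n_gt0 ltab ltba (extension_sub_adjoint ev)).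
Qed.

Let Ae (l : Lambda) : A (eL l, (val l)%:C *: eL l).
Proof. exact: extension_exp (set_valP l). Qed.

Lemma extension_orthonormal (i j : Lambda) : dot (eL i) (eL j) = (i == j)%:R.
Proof.
have [->|ij] := eqVneq i j; first exact: dot_exp_exp.
have := sa_sym sA (Ae i) (Ae j).
move=> /(etrans (esym (dotZl _ _ _ _))) /esym /(etrans (esym (dotZr _ _ _ _))) /esym.
rewrite (_ : Num.conj (val j)%:C = (val j)%:C :> R[i]); last first.
  by apply: complex_eqP; rewrite ?RecJ ?ImcJ /= ?oppr0.
move/eqP; rewrite -subr_eq0 -mulrBl mulf_eq0 => /orP[|/eqP//].
rewrite subr_eq0 => /eqP /(congr1 (@complex.Re R)) /= /val_inj ji.
by rewrite ji eqxx in ij.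
Qed.

Lemma extension_total u : (forall l : Lambda, dot u (eL l) = 0) -> u = 0.
Proof.
have compact_graph := compact_graph_adjoint n_gt0 ltab extension_sub_adjoint.
apply: (sa_compact_total normE complete sA extension_orthonormal Ae compact_graph).
(* The eigenvector is c e_l with c nonzero; dividing by c shows that l is in [Lambda], and the
   coefficient of [w] at l is c. *)
move=> t w w0 Aw; have [c [l wE]] := eigA (conj w0 Aw).
have c0 : c != 0 by apply: contra_neq w0 => c0; rewrite wE c0 scale0r.
have el : op_domain A (e l).
  have [A0 Alin _] := sa_linear sA; exists (c^-1 *: (t%:C *: w)).
  have := Alin c^-1 _ _ Aw A0; rewrite /= !addr0.
  by rewrite -[e l](scalerK c0) -wE.
exists (SigSub (mem_set (el : Lambda l))) => /=; rewrite wE.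
apply: contra_neq c0 => /(etrans (esym (etrans (dotZl _ _ _ _)
  (congr1 _ (dot_exp_exp n_gt0 ltab l))))).
by rewrite mulr1.
Qed.

Lemma spectral_set_converse : is_spectrum alpha beta Lambda /\
  op_spectrum A = [set l%:C | l in Lambda].
Proof.
have orth := extension_orthonormal; have total := extension_total.
split.
  split=> [i|i j ij|]; first exact: exp_neq0.
    by apply: etrans (orth i j) _; rewrite (negbTE ij).
  exact: (total_dense normE complete orth total).
have [rho rho0 sep] := exp_separated n_gt0 ltab.
rewrite (sa_diag_op normE complete (lam := lam) orth total sA Ae).
rewrite (diag_op_spectrum normE complete orth total); last first.
  (* Frequencies closer than [rho] are not orthogonal, so distinct elements of [Lambda] are at least
     [rho] apart. *)
  apply: (separated_spectrum rho0) => i j ij; rewrite leNgt; apply/negP => /sep.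
  by move/eqP; apply; apply: etrans (orth i j) _; rewrite (negbTE ij).
apply/seteqP; split=> [_ [l _ <-]|_ [l Ll <-]].
  by exists (val l) => //; exact: set_valP.
by exists (SigSub (mem_set Ll)).
Qed.

End converse.
End spectral_set.

Theorem theorem6p5 (R : realType) (n : nat) (alpha beta : 'I_n -> R)
    (n_gt0 : (0 < n)%N)
    (ltab : forall i, alpha i < beta i)
    (ltba : forall i j : 'I_n, (i < j)%N -> beta i < alpha j) :
  (forall Lambda : set R, is_spectrum alpha beta Lambda ->
    let A := spectral_op alpha beta Lambda in
    let F := fourier_op alpha beta Lambda in
    [/\ op_domain A = [set u | exists2 f : Lambda -> R[i],
          hassum (fun l => f l *: expL2 alpha beta (val l)) u &
          wl2_Lambda Lambda f],
        fourier_unitary alpha beta Lambda &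
        A = (F^-1 \; mult_id Lambda \; F)%relation] /\
    [/\ D0_Omega alpha beta `<=` op_domain A,
        (forall l, Lambda l -> op_domain A (expL2 alpha beta l)),
        self_adjoint (@l2dot _ _ _ (mu_Omega alpha beta)) A,
        D_Cc alpha beta `<=` A &
        forall z u, eigenvector A z u ->
          exists c l, Lambda l /\ u = c *: expL2 alpha beta l]) /\
  (forall A : set (L2 (mu_Omega alpha beta) * L2 (mu_Omega alpha beta)),
    self_adjoint (@l2dot _ _ _ (mu_Omega alpha beta)) A ->
    D_Cc alpha beta `<=` A ->
    (forall z u, eigenvector A z u -> exists c l, u = c *: expL2 alpha beta l) ->
    let Lambda := [set l | op_domain A (expL2 alpha beta l)] in
    is_spectrum alpha beta Lambda /\
    op_spectrum A = [set l%:C | l in Lambda]).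
Proof.
split=> [Lambda spec|A sA DA eigA]; first exact: spectral_set_forward.
exact: spectral_set_converse.
Qed.
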